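(* Let $n\ge1$, let $M$ be an infinite-dimensional simple completely pointed $\mathfrak{sl}_{n+1}$-module and let $J=\operatorname{Ann}_{U(\mathfrak{sl}_{n+1})}M$. Then there exists $\lambda\in\Bbbk$ such that the primitive quotient $U(\mathfrak{sl}_{n+1})/J$ is isomorphic, as a $\mathbb{Z}V$-graded $R_E^\lambda$-ring, to $\mathcal{A}^\lambda(\widetilde{A_n})$.
   Context: $\Bbbk$ is an algebraically closed field of characteristic zero; rings are associative and unital. A weight module $M=\bigoplus_{\mu\in\mathfrak{h}^*}M_\mu$ over a semisimple Lie algebra with Cartan subalgebra $\mathfrak{h}$ is completely pointed if $\dim_\Bbbk M_\mu\le1$ for all $\mu$. TGW algebras. Given a $\Bbbk$-algebra $R$, commuting $\Bbbk$-algebra automorphisms $\sigma=(\sigma_i)_{i\in I}$ of $R$ and nonzero central elements $t=(t_i)_{i\in I}$, the TGW construction (with all $\mu_{ij}=1$) is the free $R$-ring on symbols $X_i,Y_i$ ($i\in I$) modulo $X_ir=\sigma_i(r)X_i$, $Y_ir=\sigma_i^{-1}(r)Y_i$, $Y_iX_i=t_i$, $X_iY_i=\sigma_i(t_i)$, and $X_iY_j=Y_jX_i$ for $i\neq j$; it is graded by the free abelian group $\mathbb{Z}I$ with $\deg X_i=i$, $\deg Y_i=-i$, $\deg R=0$. The TGW algebra $\mathcal{A}(R,\sigma,t)$ is its quotient by the sum of all graded ideals having zero intersection with the degree-zero component. The algebra $\mathcal{A}(\widetilde{A_n})$. $\widetilde{A_n}$ is the multiquiver with vertex set $V=\{1,\dots,n\}$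 and edge set $E=\{1,\dots,n+1\}$ which is a linear chain with a leaf at each end: edge $1$ has target $1$ and no source, edge $i$ ($2\le i\le n$) goes from $i-1$ to $i$, edge $n+1$ has source $n$ and no target, all multiplicities being $1$; its incidence matrix is $\gamma_{ii}=1$, $\gamma_{i+1,i}=-1$ and zero otherwise (rows indexed by $E$, columns by $V$). $\mathcal{A}(\widetilde{A_n})=\mathcal{A}(R_E,\sigma,t)$ with index set $V$, $R_E=\Bbbk[u_1,\dots,u_{n+1}]$, $\sigma_i(u_i)=u_i-1$, $\sigma_i(u_{i+1})=u_{i+1}+1$, $\sigma_i(u_j)=u_j$ for $j\ne i,i+1$, and $t_i=u_i(u_{i+1}-1)$. $R_E$ embeds in $\mathcal{A}(\widetilde{A_n})$ as the degree-zero component. The element $\mathbb{E}=\sum_{i\in E}(u_i-1)\in R_E$ is central in $\mathcal{A}(\widetilde{A_n})$. For $\lambda\in\Bbbk$, $\mathcal{A}^\lambda(\widetilde{A_n})=\mathcal{A}(\widetilde{A_n})/\langle\mathbb{E}-\lambda\rangle$ and $R_E^\lambda=R_E/\langle\mathbb{E}-\lambda\rangle$; $\mathcal{A}^\lambda(\widetilde{A_n})$ is naturally a $\mathbb{Z}V$-graded $R_E^\lambda$-ring. $V=\{1,\dots,n\}$ is identified with the set of simple roots of $\mathfrak{sl}_{n+1}$, so $\mathbb{Z}V$ is the root lattice, which grades $U(\mathfrak{sl}_{n+1})$ and $U(\mathfrak{sl}_{n+1})/J$ via the adjoint action of $\mathfrak{h}$. With $h_i=[e_i,f_i]$ the standard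 coroots (for Chevalley generators $e_i,f_i$), $U(\mathfrak{sl}_{n+1})$, and hence its quotient by $J$, is an $R_E^\lambda$-ring via the algebra map $R_E^\lambda\to U(\mathfrak{sl}_{n+1})$ determined by $\bar u_i-\bar u_{i+1}\mapsto h_i$ ($1\le i\le n$), where $\bar u_i$ is the image of $u_i$ (the elements $\bar u_i-\bar u_{i+1}$ are free polynomial generators of $R_E^\lambda$). *)

(* Defs.v *)
From HB Require Import structures.
From mathcomp Require Import all_boot all_order all_algebra.
From mathcomp Require Import generic_quotient boolp.
From mathcomp Require Import mpoly.

Set Implicit Arguments.
Unset Strict Implicit.
Unset Printing Implicit Defensive.

Import GRing.Theory.
Local Open Scope ring_scope.
Local Open Scope quotient_scope.

(* Rings are [pzRingType]s, as a presented ring may a priori be zero. *)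

Definition two_sided_ideal (A : pzRingType) (J : A -> Prop) : Prop :=
  [/\ J 0, (forall x y, J x -> J y -> J (x + y)),
      (forall a x, J x -> J (a * x)) & (forall a x, J x -> J (x * a))].

Inductive ideal_gen (A : pzRingType) (S : A -> Prop) : A -> Prop :=
| ideal_gen_in x : S x -> ideal_gen S x
| ideal_gen0 : ideal_gen S 0
| ideal_genD x y : ideal_gen S x -> ideal_gen S y -> ideal_gen S (x + y)
| ideal_genMl a x : ideal_gen S x -> ideal_gen S (a * x)
| ideal_genMr a x : ideal_gen S x -> ideal_gen S (x * a).

Lemma ideal_gen_id (A : pzRingType) (J : A -> Prop) :
  two_sided_ideal J -> forall x, ideal_gen J x <-> J x.
Proof.
case=> J0 JD Jl Jr x; split=> [|/ideal_gen_in//].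
by elim=> // [y z _ + _|a y _|a y _]; [apply: JD|apply: Jl|apply: Jr].
Qed.

Section Quotient.
Variables (A : pzRingType) (S : A -> Prop).

Lemma ideal_genN x : ideal_gen S x -> ideal_gen S (- x).
Proof. by move=> Jx; rewrite -mulN1r; apply: ideal_genMl. Qed.

Lemma ideal_genB x y : ideal_gen S x -> ideal_gen S y -> ideal_gen S (x - y).
Proof. by move=> Jx /ideal_genN; apply: ideal_genD. Qed.

Definition quo_rel : rel A := fun x y => `[< ideal_gen S (x - y) >].

Lemma quo_relP : equiv_class_of quo_rel.
Proof.
split=> [x|x y|y x z]; rewrite /quo_rel.
- by apply/asboolP; rewrite subrr; apply: ideal_gen0.
- by apply/asboolP/asboolP => /ideal_genN; rewrite opprB.
move=> /asboolP xy /asboolP yz; apply/asboolP.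
by rewrite -(subrKA y); apply: ideal_genD.
Qed.

Canonical quo_equiv := EquivRelPack quo_relP.

(* The quotient of A by the two-sided ideal generated by S. *)
Definition quo : Type := {eq_quot quo_equiv}.
HB.instance Definition _ := Choice.on quo.

Definition quo_pi : A -> quo := fun x => \pi_({eq_quot quo_equiv}) x.

Lemma quo_piP x y : (quo_pi x = quo_pi y) <-> ideal_gen S (x - y).
Proof.
split=> [/eqmodP /asboolP //|h].
by apply/eqmodP/asboolP.
Qed.

Lemma quo_ind (P : quo -> Prop) : (forall x, P (quo_pi x)) -> forall y, P y.
Proof. by move=> h y; rewrite -[y]reprK; apply: h. Qed.

Lemma quo_piK y : quo_pi (repr y) = y.
Proof. exact: reprK. Qed.

Lemma quo_repr x : ideal_gen S (repr (quo_pi x) - x).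
Proof. by apply/quo_piP; rewrite quo_piK. Qed.

Definition quo_add (x y : quo) : quo := quo_pi (repr x + repr y).
Definition quo_opp (x : quo) : quo := quo_pi (- repr x).
Definition quo_mul (x y : quo) : quo := quo_pi (repr x * repr y).

Lemma quo_addE x y : quo_add (quo_pi x) (quo_pi y) = quo_pi (x + y).
Proof.
by apply/quo_piP; rewrite opprD addrACA; apply: ideal_genD; apply: quo_repr.
Qed.

Lemma quo_oppE x : quo_opp (quo_pi x) = quo_pi (- x).
Proof. by apply/quo_piP; rewrite -opprD; apply/ideal_genN/quo_repr. Qed.

Lemma quo_mulE x y : quo_mul (quo_pi x) (quo_pi y) = quo_pi (x * y).
Proof.
apply/quo_piP; rewrite -(subrKA (x * repr (quo_pi y))) -mulrBl -mulrBr.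
by apply: ideal_genD; [apply: ideal_genMr|apply: ideal_genMl]; apply: quo_repr.
Qed.

Fact quo_addA : associative quo_add.
Proof.
by do 3!elim/quo_ind=> ?; rewrite !quo_addE addrA.
Qed.
Fact quo_addC : commutative quo_add.
Proof. by do 2!elim/quo_ind=> ?; rewrite !quo_addE addrC. Qed.
Fact quo_add0 : left_id (quo_pi 0) quo_add.
Proof. by elim/quo_ind=> ?; rewrite quo_addE add0r. Qed.
Fact quo_addN : left_inverse (quo_pi 0) quo_opp quo_add.
Proof. by elim/quo_ind=> ?; rewrite quo_oppE quo_addE addNr. Qed.
HB.instance Definition _ :=
  GRing.isZmodule.Build quo quo_addA quo_addC quo_add0 quo_addN.

Fact quo_mulA : associative quo_mul.
Proof. by do 3!elim/quo_ind=> ?; rewrite !quo_mulE mulrA. Qed.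
Fact quo_mul1 : left_id (quo_pi 1) quo_mul.
Proof. by elim/quo_ind=> ?; rewrite quo_mulE mul1r. Qed.
Fact quo_mulr1 : right_id (quo_pi 1) quo_mul.
Proof. by elim/quo_ind=> ?; rewrite quo_mulE mulr1. Qed.
Fact quo_mulDl : left_distributive quo_mul quo_add.
Proof.
do 3!elim/quo_ind=> ?.
by rewrite !(quo_addE, quo_mulE) mulrDl.
Qed.
Fact quo_mulDr : right_distributive quo_mul quo_add.
Proof.
do 3!elim/quo_ind=> ?.
by rewrite !(quo_addE, quo_mulE) mulrDr.
Qed.
HB.instance Definition _ := GRing.Zmodule_isPzRing.Build quo
  quo_mulA quo_mul1 quo_mulr1 quo_mulDl quo_mulDr.

Fact quo_pi_zmod : zmod_morphism quo_pi.
Proof.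
move=> x y; rewrite -[- quo_pi y]/(quo_opp _) -[RHS]/(quo_add _ _).
by rewrite quo_oppE quo_addE.
Qed.
HB.instance Definition _ := GRing.isZmodMorphism.Build A quo quo_pi quo_pi_zmod.
Fact quo_pi_monoid : monoid_morphism quo_pi.
Proof. by split=> // x y; rewrite -[RHS]/(quo_mul _ _) quo_mulE. Qed.
HB.instance Definition _ :=
  GRing.isMonoidMorphism.Build A quo quo_pi quo_pi_monoid.

Lemma quo_pi0 x : S x -> quo_pi x = 0.
Proof.
move=> Sx; rewrite -(rmorph0 quo_pi); apply/quo_piP.
by rewrite subr0; apply: ideal_gen_in.
Qed.

Section Lift.
Variables (B : pzRingType) (f : {rmorphism A -> B}).
Hypothesis fS : forall x, S x -> f x = 0.

Definition quo_lift of (forall x, S x -> f x = 0) : quo -> B :=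
  fun y => f (repr y).

Lemma quo_liftE x : quo_lift fS (quo_pi x) = f x.
Proof.
apply/eqP; rewrite -subr_eq0 -rmorphB; apply/eqP.
elim: (quo_repr x) => [{}x /fS //||{}x y _ fx _ fy|a {}x _ fx|a {}x _ fx].
- exact: rmorph0.
- by rewrite rmorphD fx fy addr0.
- by rewrite rmorphM fx mulr0.
- by rewrite rmorphM fx mul0r.
Qed.

Fact quo_lift_zmod : zmod_morphism (quo_lift fS).
Proof.
by do 2!elim/quo_ind=> ?; rewrite -rmorphB !quo_liftE rmorphB.
Qed.
HB.instance Definition _ :=
  GRing.isZmodMorphism.Build quo B (quo_lift fS) quo_lift_zmod.
Fact quo_lift_monoid : monoid_morphism (quo_lift fS).
Proof.
split; first by rewrite -(rmorph1 quo_pi) quo_liftE rmorph1.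
by do 2!elim/quo_ind=> ?; rewrite -rmorphM !quo_liftE rmorphM.
Qed.
HB.instance Definition _ :=
  GRing.isMonoidMorphism.Build quo B (quo_lift fS) quo_lift_monoid.
End Lift.
End Quotient.
Arguments quo A S : clear implicits.
Arguments quo_pi {A} S _.

(* The free R-ring on a set G of symbols (the coproduct of R with the free
   ring on G): ring expressions in the elements of R and the symbols of G,
   modulo the congruence generated by the ring axioms and the requirement that
   R -> R<G> be a ring morphism.  Elements of R do not commute with G. *)

Inductive rexpr (R G : Type) : Type :=
| RCst of R
| RGen of G
| RAdd of rexpr R G & rexpr R G
| ROpp of rexpr R G
| RMul of rexpr R G & rexpr R G.
Arguments RCst {R G}.
Arguments RGen {R G}.

HB.instance Definition _ R G := gen_eqMixin (rexpr R G).
HB.instance Definition _ R G := gen_choiceMixin (rexpr R G).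

Inductive rexpr_congr (R : pzRingType) (G : Type) :
  rexpr R G -> rexpr R G -> Prop :=
| rc_refl x : rexpr_congr x x
| rc_sym x y : rexpr_congr x y -> rexpr_congr y x
| rc_trans x y z : rexpr_congr x y -> rexpr_congr y z -> rexpr_congr x z
| rc_add x x' y y' : rexpr_congr x x' -> rexpr_congr y y' ->
    rexpr_congr (RAdd x y) (RAdd x' y')
| rc_opp x x' : rexpr_congr x x' -> rexpr_congr (ROpp x) (ROpp x')
| rc_mul x x' y y' : rexpr_congr x x' -> rexpr_congr y y' ->
    rexpr_congr (RMul x y) (RMul x' y')
| rc_addA x y z : rexpr_congr (RAdd x (RAdd y z)) (RAdd (RAdd x y) z)
| rc_addC x y : rexpr_congr (RAdd x y) (RAdd y x)
| rc_add0 x : rexpr_congr (RAdd (RCst 0) x) x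
| rc_addN x : rexpr_congr (RAdd (ROpp x) x) (RCst 0)
| rc_mulA x y z : rexpr_congr (RMul x (RMul y z)) (RMul (RMul x y) z)
| rc_mul1 x : rexpr_congr (RMul (RCst 1) x) x
| rc_mulr1 x : rexpr_congr (RMul x (RCst 1)) x
| rc_mulDl x y z :
    rexpr_congr (RMul (RAdd x y) z) (RAdd (RMul x z) (RMul y z))
| rc_mulDr x y z :
    rexpr_congr (RMul x (RAdd y z)) (RAdd (RMul x y) (RMul x z))
| rc_cstD a b : rexpr_congr (RCst (a + b)) (RAdd (RCst a) (RCst b))
| rc_cstM a b : rexpr_congr (RCst (a * b)) (RMul (RCst a) (RCst b)).

Section FreeRing.
Variables (R : pzRingType) (G : Type).
Local Notation E := (rexpr R G).

Definition free_rel : rel E := fun x y => `[< rexpr_congr x y >].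

Lemma free_relP : equiv_class_of free_rel.
Proof.
split=> [x|x y|y x z]; rewrite /free_rel.
- by apply/asboolP/rc_refl.
- by apply/asboolP/asboolP; apply: rc_sym.
- by move=> /asboolP xy /asboolP yz; apply/asboolP/(rc_trans xy).
Qed.

Canonical free_equiv := EquivRelPack free_relP.

Definition free_ring : Type := {eq_quot free_equiv}.
HB.instance Definition _ := Choice.on free_ring.

Definition free_pi : E -> free_ring := fun x => \pi_({eq_quot free_equiv}) x.

Lemma free_piP x y : (free_pi x = free_pi y) <-> rexpr_congr x y.
Proof.
split=> [/eqmodP /asboolP //|h].
by apply/eqmodP/asboolP.
Qed.

Lemma free_piK y : free_pi (repr y) = y.
Proof. exact: reprK. Qed.

Lemma free_ind (P : free_ring -> Prop) :
  (forall x, P (free_pi x)) -> forall y, P y.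
Proof. by move=> h y; rewrite -[y]free_piK; apply: h. Qed.

Lemma free_repr x : rexpr_congr (repr (free_pi x)) x.
Proof. by apply/free_piP; rewrite free_piK. Qed.

Definition free_add (x y : free_ring) := free_pi (RAdd (repr x) (repr y)).
Definition free_opp (x : free_ring) := free_pi (ROpp (repr x)).
Definition free_mul (x y : free_ring) := free_pi (RMul (repr x) (repr y)).

Lemma free_addE x y : free_add (free_pi x) (free_pi y) = free_pi (RAdd x y).
Proof. by apply/free_piP/rc_add; apply: free_repr. Qed.
Lemma free_oppE x : free_opp (free_pi x) = free_pi (ROpp x).
Proof. by apply/free_piP/rc_opp; apply: free_repr. Qed.
Lemma free_mulE x y : free_mul (free_pi x) (free_pi y) = free_pi (RMul x y).
Proof. by apply/free_piP/rc_mul; apply: free_repr. Qed.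

Fact free_addA : associative free_add.
Proof.
by do 3!elim/free_ind=> ?; rewrite !free_addE; apply/free_piP/rc_addA.
Qed.
Fact free_addC : commutative free_add.
Proof.
by do 2!elim/free_ind=> ?; rewrite !free_addE; apply/free_piP/rc_addC.
Qed.
Fact free_add0 : left_id (free_pi (RCst 0)) free_add.
Proof. by elim/free_ind=> ?; rewrite free_addE; apply/free_piP/rc_add0. Qed.
Fact free_addN : left_inverse (free_pi (RCst 0)) free_opp free_add.
Proof.
by elim/free_ind=> ?; rewrite free_oppE free_addE; apply/free_piP/rc_addN.
Qed.
HB.instance Definition _ :=
  GRing.isZmodule.Build free_ring free_addA free_addC free_add0 free_addN.

Fact free_mulA : associative free_mul.
Proof.
by do 3!elim/free_ind=> ?; rewrite !free_mulE; apply/free_piP/rc_mulA.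
Qed.
Fact free_mul1 : left_id (free_pi (RCst 1)) free_mul.
Proof. by elim/free_ind=> ?; rewrite free_mulE; apply/free_piP/rc_mul1. Qed.
Fact free_mulr1 : right_id (free_pi (RCst 1)) free_mul.
Proof. by elim/free_ind=> ?; rewrite free_mulE; apply/free_piP/rc_mulr1. Qed.
Fact free_mulDl : left_distributive free_mul free_add.
Proof.
do 3!elim/free_ind=> ?; rewrite !(free_addE, free_mulE).
exact/free_piP/rc_mulDl.
Qed.
Fact free_mulDr : right_distributive free_mul free_add.
Proof.
do 3!elim/free_ind=> ?; rewrite !(free_addE, free_mulE).
exact/free_piP/rc_mulDr.
Qed.
HB.instance Definition _ := GRing.Zmodule_isPzRing.Build free_ring
  free_mulA free_mul1 free_mulr1 free_mulDl free_mulDr.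

Lemma free_piD x y : free_pi (RAdd x y) = free_pi x + free_pi y.
Proof. by rewrite -free_addE. Qed.
Lemma free_piN x : free_pi (ROpp x) = - free_pi x.
Proof. by rewrite -free_oppE. Qed.
Lemma free_piM x y : free_pi (RMul x y) = free_pi x * free_pi y.
Proof. by rewrite -free_mulE. Qed.

Definition free_cst (r : R) : free_ring := free_pi (RCst r).
Definition free_gen (g : G) : free_ring := free_pi (RGen g).

Lemma free_cstD : {morph free_cst : x y / x + y}.
Proof. by move=> x y; rewrite /free_cst -free_piD; apply/free_piP/rc_cstD. Qed.

Fact free_cst_zmod : zmod_morphism free_cst.
Proof.
move=> x y; apply: (addIr (free_cst y)).
by rewrite -free_cstD !subrK.
Qed.
HB.instance Definition _ :=
  GRing.isZmodMorphism.Build R free_ring free_cst free_cst_zmod.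
Fact free_cst_monoid : monoid_morphism free_cst.
Proof.
split=> // x y; rewrite /free_cst -free_piM; exact/free_piP/rc_cstM.
Qed.
HB.instance Definition _ :=
  GRing.isMonoidMorphism.Build R free_ring free_cst free_cst_monoid.

Section Lift.
Variables (B : pzRingType) (f : {rmorphism R -> B}) (g : G -> B).

Fixpoint rexpr_eval (x : E) : B :=
  match x with
  | RCst r => f r
  | RGen s => g s
  | RAdd x y => rexpr_eval x + rexpr_eval y
  | ROpp x => - rexpr_eval x
  | RMul x y => rexpr_eval x * rexpr_eval y
  end.

Lemma rexpr_eval_congr x y : rexpr_congr x y -> rexpr_eval x = rexpr_eval y.
Proof.
elim=> //=.
- by move=> {}x {}y z _ -> _ ->.
- by move=> {}x x' {}y y' _ -> _ ->.
- by move=> {}x x' _ ->.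
- by move=> {}x x' {}y y' _ -> _ ->.
- by move=> *; rewrite addrA.
- by move=> *; rewrite addrC.
- by move=> *; rewrite rmorph0 add0r.
- by move=> *; rewrite rmorph0 addNr.
- by move=> *; rewrite mulrA.
- by move=> *; rewrite rmorph1 mul1r.
- by move=> *; rewrite rmorph1 mulr1.
- by move=> *; rewrite mulrDl.
- by move=> *; rewrite mulrDr.
- by move=> *; rewrite rmorphD.
- by move=> *; rewrite rmorphM.
Qed.

Definition free_lift (y : free_ring) : B := rexpr_eval (repr y).

Lemma free_liftE x : free_lift (free_pi x) = rexpr_eval x.
Proof. exact/rexpr_eval_congr/free_repr. Qed.

Lemma free_lift_cst r : free_lift (free_cst r) = f r.
Proof. exact: free_liftE. Qed.
Lemma free_lift_gen s : free_lift (free_gen s) = g s.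
Proof. exact: free_liftE. Qed.

Fact free_lift_zmod : zmod_morphism free_lift.
Proof.
by do 2!elim/free_ind=> ?; rewrite -free_piN -free_piD !free_liftE.
Qed.
HB.instance Definition _ :=
  GRing.isZmodMorphism.Build free_ring B free_lift free_lift_zmod.
Fact free_lift_monoid : monoid_morphism free_lift.
Proof.
split; first by rewrite -(rmorph1 free_cst) free_lift_cst rmorph1.
by do 2!elim/free_ind=> ?; rewrite -free_piM !free_liftE.
Qed.
HB.instance Definition _ :=
  GRing.isMonoidMorphism.Build free_ring B free_lift free_lift_monoid.
End Lift.
End FreeRing.
Arguments free_ring R G : clear implicits.
Arguments free_cst {R G}.
Arguments free_gen {R G}.

(* Twisted generalized Weyl data, with all mu_ij = 1. *)

Record tgw_datum (k : fieldType) (R : algType k) (I : finType) := TgwDatum {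
  tgw_sigma : I -> {lrmorphism R -> R};
  tgw_sigmaV : I -> {lrmorphism R -> R};
  tgw_sigmaK : forall i, cancel (tgw_sigma i) (tgw_sigmaV i);
  tgw_sigmaVK : forall i, cancel (tgw_sigmaV i) (tgw_sigma i);
  tgw_sigma_comm : forall i j r,
    tgw_sigma i (tgw_sigma j r) = tgw_sigma j (tgw_sigma i r);
  tgw_t : I -> R;
  tgw_t_neq0 : forall i, tgw_t i != 0;
  tgw_t_central : forall i r, tgw_t i * r = r * tgw_t i
}.

Section TGW.
Variables (k : fieldType) (R : algType k) (I : finType) (D : tgw_datum R I).

Local Notation F := (free_ring R (I + I)%type).
Local Notation cst := (@free_cst R (I + I)%type).
Local Notation X := (fun i : I => free_gen (inl i) : F).
Local Notation Y := (fun i : I => free_gen (inr i) : F).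
Local Notation sigma := (tgw_sigma D).
Local Notation sigmaV := (tgw_sigmaV D).
Local Notation t := (tgw_t D).

Inductive tgwc_rel : F -> Prop :=
| tgwc_relX i r : tgwc_rel (X i * cst r - cst (sigma i r) * X i)
| tgwc_relY i r : tgwc_rel (Y i * cst r - cst (sigmaV i r) * Y i)
| tgwc_relYX i : tgwc_rel (Y i * X i - cst (t i))
| tgwc_relXY i : tgwc_rel (X i * Y i - cst (sigma i (t i)))
| tgwc_relC i j : i != j -> tgwc_rel (X i * Y j - Y j * X i).

Definition tgwc : pzRingType := quo F tgwc_rel.

Definition tgwc_cst : R -> tgwc := quo_pi tgwc_rel \o cst.
HB.instance Definition _ :=
  GRing.RMorphism.copy tgwc_cst (quo_pi tgwc_rel \o cst).
Definition tgwc_X (i : I) : tgwc := quo_pi tgwc_rel (X i).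
Definition tgwc_Y (i : I) : tgwc := quo_pi tgwc_rel (Y i).

(* The free abelian group ZI is {ffun I -> int}. *)
Definition zdelta (i : I) : {ffun I -> int} := [ffun j => (j == i)%:R].

(* tgwc_homog d is the homogeneous component of degree d: the component of the
   grading in which deg X_i = i, deg Y_i = - i and deg R = 0. *)
Inductive tgwc_homog : {ffun I -> int} -> tgwc -> Prop :=
| tgwc_homog_cst r : tgwc_homog 0 (tgwc_cst r)
| tgwc_homogX i : tgwc_homog (zdelta i) (tgwc_X i)
| tgwc_homogY i : tgwc_homog (- zdelta i) (tgwc_Y i)
| tgwc_homog0 d : tgwc_homog d 0
| tgwc_homogD d x y :
    tgwc_homog d x -> tgwc_homog d y -> tgwc_homog d (x + y)
| tgwc_homogM d e x y :
    tgwc_homog d x -> tgwc_homog e y -> tgwc_homog (d + e) (x * y).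

Definition graded_subset (J : tgwc -> Prop) : Prop :=
  forall x, J x -> exists (m : nat) (d : 'I_m -> {ffun I -> int})
    (y : 'I_m -> tgwc),
    (forall a, tgwc_homog (d a) (y a) /\ J (y a)) /\ x = \sum_(a < m) y a.

Definition tgw_graded_ideal (J : tgwc -> Prop) : Prop :=
  [/\ two_sided_ideal J, graded_subset J &
      forall x, J x -> tgwc_homog 0 x -> x = 0].

(* The ideal generated by the union of a family of ideals is their sum. *)
Definition tgw_rad (x : tgwc) : Prop :=
  exists J : tgwc -> Prop, tgw_graded_ideal J /\ J x.

Definition tgw : pzRingType := quo tgwc tgw_rad.

Definition tgw_cst : R -> tgw := quo_pi tgw_rad \o tgwc_cst.
HB.instance Definition _ :=
  GRing.RMorphism.copy tgw_cst (quo_pi tgw_rad \o tgwc_cst).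

Definition tgw_homog (d : {ffun I -> int}) (x : tgw) : Prop :=
  exists y, tgwc_homog d y /\ x = quo_pi tgw_rad y.

End TGW.

(* The algebra attached to the multiquiver \tilde{A_n}.  The vertex i of
   {1, .., n} is the ordinal i - 1 of 'I_n, and the edges i and i + 1 are the
   ordinals ein i and eout i of 'I_n.+1. *)

Notation RE k n := {mpoly k[n.+1]}.

Lemma mpoly_rmorph_eq (k : fieldType) (m : nat) (B : pzRingType)
    (f g : {rmorphism {mpoly k[m]} -> B}) :
  (forall c : k, f c%:MP = g c%:MP) -> (forall i, f 'X_i = g 'X_i) -> f =1 g.
Proof.
move=> fgC fgX p; rewrite (mpolyE p) !rmorph_sum; apply: eq_bigr => a _.
rewrite -mul_mpolyC !rmorphM fgC mpolyXE_id !rmorph_prod; congr (_ * _).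
by apply: eq_bigr => i _; rewrite !rmorphXn fgX.
Qed.

Section TypeA.
Variables (k : fieldType) (n : nat).

Definition ein (i : 'I_n) : 'I_n.+1 := widen_ord (leqnSn n) i.
Definition eout (i : 'I_n) : 'I_n.+1 := lift ord0 i.

Lemma eout_neq_ein i : eout i != ein i.
Proof. by rewrite -val_eqE /= /bump /= add1n neq_ltn ltnSn orbT. Qed.

(* The incidence matrix of the multiquiver. *)
Definition gammaA (e : 'I_n.+1) (i : 'I_n) : k :=
  if e == ein i then 1 else if e == eout i then -1 else 0.

(* sigma_i (u_e) = u_e - gamma_{e,i}; the inverse is obtained for s = -1. *)
Definition shiftA (s : k) (i : 'I_n) : RE k n -> RE k n :=
  comp_mpoly [tuple 'X_e - (s * gammaA e i)%:MP | e < n.+1].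
HB.instance Definition _ s i := GRing.LRMorphism.copy (shiftA s i)
  (comp_mpoly [tuple 'X_e - (s * gammaA e i)%:MP | e < n.+1]).

Lemma shiftAX s i e : shiftA s i 'X_e = 'X_e - (s * gammaA e i)%:MP.
Proof. by rewrite /shiftA /= comp_mpolyXU -tnth_nth tnth_mktuple. Qed.

Lemma shiftAC s i c : shiftA s i c%:MP = c%:MP.
Proof. exact: comp_mpolyC. Qed.

Definition sigmaA (i : 'I_n) : {lrmorphism RE k n -> RE k n} := shiftA 1 i.
Definition sigmaVA (i : 'I_n) : {lrmorphism RE k n -> RE k n} := shiftA (-1) i.

Lemma shiftAK s i : cancel (shiftA s i) (shiftA (- s) i).
Proof.
apply: (@mpoly_rmorph_eq _ _ _ (shiftA (- s) i \o shiftA s i) idfun) => [c|e] /=.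
  by rewrite !shiftAC.
by rewrite shiftAX rmorphB /= shiftAC shiftAX mulNr mpolyCN opprK addrK.
Qed.

Fact sigmaAK i : cancel (sigmaA i) (sigmaVA i).
Proof. exact: shiftAK. Qed.
Fact sigmaVAK i : cancel (sigmaVA i) (sigmaA i).
Proof. by have := shiftAK (-1) i; rewrite opprK. Qed.

Fact sigmaA_comm i j r : sigmaA i (sigmaA j r) = sigmaA j (sigmaA i r).
Proof.
apply: (@mpoly_rmorph_eq _ _ _ (shiftA 1 i \o shiftA 1 j)
  (shiftA 1 j \o shiftA 1 i)) => [c|e] /=; first by rewrite !shiftAC.
by rewrite !shiftAX !rmorphB /= !shiftAC !shiftAX addrAC.
Qed.

Definition tA (i : 'I_n) : RE k n := 'X_(ein i) * ('X_(eout i) - 1).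

Fact tA_neq0 i : tA i != 0.
Proof.
apply/eqP => /(congr1 (meval [eta (fun=> 0) with ein i |-> 1])) /eqP.
rewrite /tA rmorphM rmorphB /= !mevalXU meval1 raddf0 /= eqxx mul1r.
by rewrite (negPf (eout_neq_ein i)) sub0r oppr_eq0 oner_eq0.
Qed.

Fact tA_central i r : tA i * r = r * tA i.
Proof. exact: mulrC. Qed.

Definition datumA : tgw_datum (RE k n) 'I_n :=
  TgwDatum sigmaAK sigmaVAK sigmaA_comm tA_neq0 tA_central.

Definition algA : pzRingType := tgw datumA.

Definition eulerA : RE k n := \sum_(e < n.+1) ('X_e - 1).

Definition Rlam_rel (lam : k) (r : RE k n) : Prop := r = eulerA - lam%:MP.
Definition Rlam (lam : k) : pzRingType := quo (RE k n) (Rlam_rel lam).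

Definition Alam_rel (lam : k) (x : algA) : Prop :=
  x = tgw_cst datumA (eulerA - lam%:MP).
Definition Alam (lam : k) : pzRingType := quo algA (Alam_rel lam).

Fact Alam_cst_rel lam r : Rlam_rel lam r ->
  (quo_pi (Alam_rel lam) \o tgw_cst datumA) r = 0.
Proof. by move=> ->; apply: quo_pi0. Qed.

Definition Alam_cst (lam : k) : Rlam lam -> Alam lam :=
  quo_lift (@Alam_cst_rel lam).
Arguments Alam_cst : clear implicits.
HB.instance Definition _ (lam : k) :=
  GRing.RMorphism.copy (Alam_cst lam) (quo_lift (@Alam_cst_rel lam)).

Definition Alam_homog (lam : k) (d : {ffun 'I_n -> int}) (x : Alam lam) :=
  exists y, tgw_homog d y /\ x = quo_pi (Alam_rel lam) y.

End TypeA.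
Arguments Alam_cst {k n} lam _.

Section Enveloping.
Variables (k : fieldType) (g : lmodType k) (br : g -> g -> g).
Local Notation F := (free_ring k g).
Local Notation cst := (free_cst : k -> F).
Local Notation gen := (free_gen : g -> F).

Inductive env_rel : F -> Prop :=
| env_relC c x : env_rel (cst c * gen x - gen x * cst c)
| env_relL c x y : env_rel (gen (c *: x + y) - (cst c * gen x + gen y))
| env_relB x y : env_rel (gen (br x y) - (gen x * gen y - gen y * gen x)).

Definition env : Type := quo F env_rel.
HB.instance Definition _ := GRing.PzRing.on env.

Definition env_cst : k -> env := quo_pi env_rel \o cst.
HB.instance Definition _ :=
  GRing.RMorphism.copy env_cst (quo_pi env_rel \o cst).
Definition env_gen (x : g) : env := quo_pi env_rel (gen x).

Lemma env_genC c x : env_cst c * env_gen x = env_gen x * env_cst c.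
Proof.
rewrite /env_gen /env_cst /= -!rmorphM.
exact/quo_piP/ideal_gen_in/env_relC.
Qed.

Lemma env_gen_lin c x y :
  env_gen (c *: x + y) = env_cst c * env_gen x + env_gen y.
Proof.
rewrite /env_gen /env_cst /= -rmorphM -rmorphD.
exact/quo_piP/ideal_gen_in/env_relL.
Qed.

Lemma env_gen_scale c x : env_gen (c *: x) = env_cst c * env_gen x.
Proof.
have g0 : env_gen 0 = 0.
  have := env_gen_lin 1 0 0; rewrite scaler0 addr0 rmorph1 mul1r.
  by move/esym/eqP; rewrite -subr_eq0 addrK => /eqP.
by have := env_gen_lin c x 0; rewrite g0 !addr0.
Qed.

Fact env_gen_zmod : zmod_morphism env_gen.
Proof.
move=> x y; have := env_gen_lin (-1) y x.
by rewrite scaleN1r addrC rmorphN rmorph1 mulN1r [RHS]addrC.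
Qed.
HB.instance Definition _ := GRing.isZmodMorphism.Build g env env_gen env_gen_zmod.

Lemma env_gen_br x y :
  env_gen (br x y) = env_gen x * env_gen y - env_gen y * env_gen x.
Proof.
rewrite /env_gen -!rmorphM -rmorphB.
exact/quo_piP/ideal_gen_in/env_relB.
Qed.

Section Lift.
Variables (B : pzRingType) (f : {rmorphism k -> B}) (h : g -> B).
Hypotheses (fhC : forall c x, f c * h x = h x * f c)
  (h_lin : forall c x y, h (c *: x + y) = f c * h x + h y)
  (h_br : forall x y, h (br x y) = h x * h y - h y * h x).

Fact env_lift_rel x : env_rel x -> free_lift f h x = 0.
Proof.
case=> [c {}x|c {}x y|{}x y];
  rewrite !(rmorphB, rmorphD, rmorphM) /= !(free_lift_cst, free_lift_gen).
- by rewrite fhC subrr.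
- by rewrite h_lin subrr.
- by rewrite h_br subrr.
Qed.

Definition env_lift : env -> B := quo_lift env_lift_rel.
HB.instance Definition _ :=
  GRing.RMorphism.copy env_lift (quo_lift env_lift_rel).

Lemma env_lift_cst c : env_lift (env_cst c) = f c.
Proof. exact: etrans (quo_liftE _ _) (free_lift_cst _ _ _). Qed.
Lemma env_lift_gen x : env_lift (env_gen x) = h x.
Proof. exact: etrans (quo_liftE _ _) (free_lift_gen _ _ _). Qed.
End Lift.

Fact env_nonzero : 1 != 0 :> env.
Proof.
pose h (x : g) : k := 0.
have h1 c x : idfun c * h x = h x * idfun c by rewrite mulrC.
have h2 c x y : h (c *: x + y) = idfun c * h x + h y by rewrite mulr0 addr0.
have h3 x y : h (br x y) = h x * h y - h y * h x by rewrite mul0r subrr.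
apply/eqP => /(congr1 (env_lift h1 h2 h3)) /eqP.
by rewrite rmorph1 rmorph0 oner_eq0.
Qed.
HB.instance Definition _ := GRing.PzSemiRing_isNonZero.Build env env_nonzero.

End Enveloping.

(* 'End(_) is limited to finite-dimensional spaces. *)

Section LinearEnd.
Variables (k : fieldType) (M : lmodType k).

Definition lend : Type := {f : M -> M | `[< linear f >]}.
HB.instance Definition _ := Choice.on lend.
Definition lend_fun (f : lend) : M -> M := val f.
Coercion lend_fun : lend >-> Funclass.

Lemma lend_lin (f : lend) : linear f.
Proof. exact/asboolP/(valP f). Qed.
Lemma lendP (f g : lend) : f =1 g -> f = g.
Proof. by move=> fg; apply/val_inj/funext. Qed.

Definition mk_lend (f : M -> M) (fL : linear f) : lend :=
  exist _ f (asboolT fL).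

Lemma lend0_lin : linear (fun _ : M => 0 : M).
Proof. by move=> c x y; rewrite scaler0 addr0. Qed.
Lemma lendN_lin (f : lend) : linear (fun x => - f x).
Proof. by move=> c x y; rewrite lend_lin opprD scalerN. Qed.
Lemma lendD_lin (f g : lend) : linear (fun x => f x + g x).
Proof. by move=> c x y; rewrite !lend_lin scalerDr addrACA. Qed.
Lemma lend1_lin : linear (fun x : M => x).
Proof. by []. Qed.
Lemma lendM_lin (f g : lend) : linear (fun x => f (g x)).
Proof. by move=> c x y; rewrite !lend_lin. Qed.

Definition lend_add f g : lend := mk_lend (lendD_lin f g).
Definition lend_opp f : lend := mk_lend (lendN_lin f).
Definition lend_mul f g : lend := mk_lend (lendM_lin f g).

Fact lend_addA : associative lend_add.
Proof. by move=> f g h; apply: lendP => x; apply: addrA. Qed.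
Fact lend_addC : commutative lend_add.
Proof. by move=> f g; apply: lendP => x; apply: addrC. Qed.
Fact lend_add0 : left_id (mk_lend lend0_lin) lend_add.
Proof. by move=> f; apply: lendP => x; apply: add0r. Qed.
Fact lend_addN : left_inverse (mk_lend lend0_lin) lend_opp lend_add.
Proof. by move=> f; apply: lendP => x; apply: addNr. Qed.
HB.instance Definition _ :=
  GRing.isZmodule.Build lend lend_addA lend_addC lend_add0 lend_addN.

Fact lend_mulA : associative lend_mul.
Proof. by move=> f g h; apply: lendP. Qed.
Fact lend_mul1 : left_id (mk_lend lend1_lin) lend_mul.
Proof. by move=> f; apply: lendP. Qed.
Fact lend_mulr1 : right_id (mk_lend lend1_lin) lend_mul.
Proof. by move=> f; apply: lendP. Qed.
Fact lend_mulDl : left_distributive lend_mul lend_add.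
Proof. by move=> f g h; apply: lendP. Qed.
Fact lend_mulDr : right_distributive lend_mul lend_add.
Proof.
move=> f g h; apply: lendP => x; rewrite -[RHS]/(f (g x) + f (h x)).
by rewrite -[LHS]/(f (g x + h x)) -[g x]scale1r lend_lin !scale1r.
Qed.
HB.instance Definition _ := GRing.Zmodule_isPzRing.Build lend
  lend_mulA lend_mul1 lend_mulr1 lend_mulDl lend_mulDr.

Fact lend_scal_lin (c : k) : linear (fun x : M => c *: x).
Proof. by move=> a x y; rewrite scalerDr !scalerA mulrC. Qed.
Definition lend_scal (c : k) : lend := mk_lend (lend_scal_lin c).
Fact lend_scal_zmod : zmod_morphism lend_scal.
Proof. by move=> a b; apply: lendP => x; apply: scalerBl. Qed.
HB.instance Definition _ :=
  GRing.isZmodMorphism.Build k lend lend_scal lend_scal_zmod.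
Fact lend_scal_monoid : monoid_morphism lend_scal.
Proof.
split=> [|a b]; apply: lendP => x; first exact: scale1r.
by apply/esym; apply: scalerA.
Qed.
HB.instance Definition _ :=
  GRing.isMonoidMorphism.Build k lend lend_scal lend_scal_monoid.

End LinearEnd.

Record lie_module (k : fieldType) (g : lmodType k) (br : g -> g -> g)
    (M : lmodType k) := LieModule {
  lact :> g -> M -> M;
  lact_linl : forall m, linear (lact^~ m);
  lact_linr : forall x, linear (lact x);
  lact_br : forall x y m,
    lact (br x y) m = lact x (lact y m) - lact y (lact x m)
}.

Section LieModule.
Variables (k : fieldType) (g : lmodType k) (br : g -> g -> g).
Variables (M : lmodType k) (a : lie_module br M).

Definition lact_end (x : g) : lend M := mk_lend (lact_linr a x).

Fact lact_endC c x :
  lend_scal M c * lact_end x = lact_end x * lend_scal M c.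
Proof.
apply: lendP => m.
have h0 : a x 0 = 0.
  by have := lact_linr a x (-1) 0 0; rewrite scaler0 addr0 scaleN1r addNr.
by have := lact_linr a x c m 0; rewrite !addr0 h0 addr0.
Qed.
Fact lact_end_lin c x y :
  lact_end (c *: x + y) = lend_scal M c * lact_end x + lact_end y.
Proof. by apply: lendP => m; apply: lact_linl. Qed.
Fact lact_end_br x y :
  lact_end (br x y) = lact_end x * lact_end y - lact_end y * lact_end x.
Proof. by apply: lendP => m; apply: lact_br. Qed.

Definition env_act : env br -> lend M :=
  env_lift lact_endC lact_end_lin lact_end_br.
HB.instance Definition _ := GRing.RMorphism.copy env_act
  (env_lift lact_endC lact_end_lin lact_end_br).

Definition env_ann (u : env br) : Prop := forall m : M, lend_fun (env_act u) m = 0.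

Lemma env_ann_ideal : two_sided_ideal env_ann.
Proof.
split=> [m|x y hx hy m|u x hx m|u x hx m]; rewrite ?rmorph0 ?rmorphD ?rmorphM //.
- by rewrite -[LHS]/(lend_fun (env_act x) m + lend_fun (env_act y) m) hx hy addr0.
- rewrite -[LHS]/(lend_fun (env_act u) (lend_fun (env_act x) m)) hx.
  set f := env_act u.
  by have := lend_lin f (-1) 0 0; rewrite scaler0 addr0 scaleN1r addNr.
- exact: hx.
Qed.

Definition lie_submodule (N : M -> Prop) : Prop :=
  [/\ N 0, (forall v w, N v -> N w -> N (v + w)),
      (forall (c : k) v, N v -> N (c *: v)) & (forall x v, N v -> N (a x v))].

Definition simple_module : Prop :=
  (exists v : M, v <> 0) /\
  forall N, lie_submodule N -> (forall v, N v -> v = 0) \/ (forall v, N v).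

End LieModule.

Definition infinite_dim (k : fieldType) (M : lmodType k) : Prop :=
  ~ exists (m : nat) (b : 'I_m -> M),
      forall v : M, exists c : 'I_m -> k, v = \sum_(i < m) c i *: b i.

Definition dim_le1 (k : fieldType) (M : lmodType k) (N : M -> Prop) : Prop :=
  exists b : M, forall v : M, N v -> exists c : k, v = c *: b.

Definition direct_sum (I : Type) (V : zmodType) (C : I -> V -> Prop) : Prop :=
  (forall v : V, exists (m : nat) (mu : 'I_m -> I) (w : 'I_m -> V),
     (forall j, C (mu j) (w j)) /\ v = \sum_(j < m) w j) /\
  (forall (m : nat) (mu : 'I_m -> I) (w : 'I_m -> V), injective mu ->
     (forall j, C (mu j) (w j)) -> \sum_(j < m) w j = 0 -> forall j, w j = 0).

Section Sl.
Variables (k : fieldType) (n : nat).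

Definition sl_pred : {pred 'M[k]_n.+1} := fun A => \tr A == 0.
Fact sl_submod : submod_closed sl_pred.
Proof.
split=> [|c A B]; rewrite /in_mem /= /sl_pred ?raddf0 // => /eqP tA /eqP tB.
by rewrite mxtraceD mxtraceZ tA tB mulr0 addr0.
Qed.
HB.instance Definition _ :=
  GRing.isSubmodClosed.Build k 'M[k]_n.+1 sl_pred sl_submod.

Record sl : Type := Sl { sl_mx :> 'M[k]_n.+1; _ : sl_pred sl_mx }.
HB.instance Definition _ := [isSub for sl_mx].
HB.instance Definition _ := [Choice of sl by <:].
HB.instance Definition _ := [SubChoice_isSubLmodule of sl by <:].

Fact sl_br_subproof (A B : 'M[k]_n.+1) : sl_pred (A *m B - B *m A).
Proof. by rewrite /sl_pred raddfB /= mxtrace_mulC subrr. Qed.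
Definition sl_br (A B : sl) : sl := Sl (sl_br_subproof A B).

Definition h_pred : {pred sl} := fun A => is_diag_mx (sl_mx A).
Fact h_submod : submod_closed h_pred.
Proof.
split=> [|c A B]; rewrite /in_mem /= /h_pred.
  by apply/is_diag_mxP => i j _; rewrite mxE.
move=> /is_diag_mxP dA /is_diag_mxP dB; apply/is_diag_mxP => i j ij.
by rewrite !mxE dA // dB // mulr0 addr0.
Qed.
HB.instance Definition _ := GRing.isSubmodClosed.Build k sl h_pred h_submod.

Record cartan : Type := Cartan { cartan_sl :> sl; _ : h_pred cartan_sl }.
HB.instance Definition _ := [isSub for cartan_sl].
HB.instance Definition _ := [Choice of cartan by <:].
HB.instance Definition _ := [SubChoice_isSubLmodule of cartan by <:].

Fact sl_e_subproof (i j : 'I_n.+1) : i != j -> sl_pred (delta_mx i j).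
Proof.
move=> ij; rewrite /sl_pred /mxtrace big1 // => a _; rewrite mxE.
by case: eqP => // ->; rewrite (negPf ij).
Qed.
Fact ein_neq_eout (i : 'I_n) : ein i != eout i.
Proof. by rewrite eq_sym eout_neq_ein. Qed.

Definition sl_e (i : 'I_n) : sl := Sl (sl_e_subproof (ein_neq_eout i)).
Definition sl_f (i : 'I_n) : sl := Sl (sl_e_subproof (eout_neq_ein i)).
Definition sl_h (i : 'I_n) : sl := sl_br (sl_e i) (sl_f i).

Definition Usl := env sl_br.

(* The element sum_i d_i alpha_i of the root lattice, as a function on h. *)
Definition root_eval (d : {ffun 'I_n -> int}) (h : cartan) : k :=
  \sum_(i < n) (sl_mx h (ein i) (ein i) - sl_mx h (eout i) (eout i)) *~ d i.

Section Weights.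
Variables (M : lmodType k) (a : lie_module sl_br M).

Definition weight_space (mu : {linear cartan -> k^o}) (v : M) : Prop :=
  forall h : cartan, a h v = (mu h : k) *: v.

Definition weight_module : Prop := direct_sum weight_space.

Definition completely_pointed : Prop :=
  weight_module /\ forall mu, dim_le1 (weight_space mu).

Definition Uquo : pzRingType := quo Usl (env_ann a).

Definition Uquo_pi : Usl -> Uquo := quo_pi (env_ann a).
HB.instance Definition _ := GRing.RMorphism.copy Uquo_pi (quo_pi (env_ann a)).

(* Grading of U / Ann M by the root lattice, via the adjoint action of h. *)
Definition Uquo_homog (d : {ffun 'I_n -> int}) (x : Uquo) : Prop :=
  forall h : cartan,
    Uquo_pi (env_gen sl_br h) * x - x * Uquo_pi (env_gen sl_br h) =
    Uquo_pi (env_cst sl_br (root_eval d h)) * x.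

End Weights.
End Sl.

(* The algebra map R_E^lam -> U(sl_{n+1}) sending u_i - u_{i+1} to h_i.  As
   sum_e u_e = lam + n + 1 in R_E^lam, it must send u_e to
   (lam + n + 1 + sum_j (E_ee - E_jj)) / (n + 1). *)

Lemma mmap_comm_monoid (k : fieldType) (m : nat) (S : nzRingType)
    (f : {rmorphism k -> S}) (h : 'I_m -> S) :
  (forall c i, GRing.comm (f c) (h i)) ->
  (forall i j, GRing.comm (h i) (h j)) -> monoid_morphism (mmap f h).
Proof.
move=> fhC hC.
have h1C c a : GRing.comm (f c) (mmap1 h a).
  by apply: commr_prod => i _; apply/commrX/fhC.
have h1M a b : mmap1 h (a + b) = mmap1 h a * mmap1 h b.
  rewrite /mmap1 (eq_bigr (fun i => h i ^+ a i * h i ^+ b i)); last first.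
    by move=> i _; rewrite mnmDE exprD.
  suff H (s : seq 'I_m) : \prod_(i <- s) (h i ^+ a i * h i ^+ b i) =
      \prod_(i <- s) h i ^+ a i * \prod_(i <- s) h i ^+ b i by [].
  elim: s => [|i s IH]; first by rewrite !big_nil mulr1.
  rewrite !big_cons IH -!mulrA; congr (_ * _); rewrite !mulrA; congr (_ * _).
  by apply: commr_prod => j _; apply/commrX/commr_sym/commrX/hC.
split=> [|p q].
  by rewrite -[1 in LHS]mpolyC1; apply: etrans (mmapC _ _ _) (rmorph1 f).
rewrite {1}(mpolyE p) {1}(mpolyE q) mulr_suml raddf_sum /= {2}/mmap mulr_suml.
apply: eq_bigr => a _; rewrite mulr_sumr raddf_sum /= {2}/mmap mulr_sumr.
apply: eq_bigr => b _.
rewrite -scalerAl -scalerAr !mmapZ -mpolyXD mmapX h1M !mulrA; congr (_ * _).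
by rewrite -!mulrA; congr (_ * _); apply: h1C.
Qed.

Section CartanMap.
Variables (k : fieldType) (n : nat) (k0 : [pchar k] =i pred0).
Local Notation U := (Usl k n).
Local Notation cst := (env_cst (@sl_br k n)).
Local Notation gen := (env_gen (@sl_br k n)).

Fact sl_diag_subproof (e j : 'I_n.+1) :
  @sl_pred k n (delta_mx e e - delta_mx j j).
Proof.
suff tr1 a : \tr (delta_mx a a : 'M[k]_n.+1) = 1.
  by rewrite /sl_pred raddfB /= !tr1 subrr.
rewrite /mxtrace (bigD1 a) //= big1 ?mxE ?eqxx ?addr0 // => b ba.
by rewrite mxE (negPf ba).
Qed.
Definition sl_diag (e j : 'I_n.+1) : sl k n := Sl (sl_diag_subproof e j).

Fact sl_diag_h e j : sl_diag e j \in @h_pred k n.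
Proof.
apply/is_diag_mxP => a b ab; rewrite !mxE.
suff H c : ((a == c) && (b == c) = false) by rewrite !H subrr.
by apply/negP => /andP[/eqP ac /eqP bc]; rewrite ac bc eqxx in ab.
Qed.

Lemma cartan_gen_comm (x y : sl k n) : x \in @h_pred k n -> y \in @h_pred k n ->
  GRing.comm (gen x) (gen y).
Proof.
move=> /diag_mxP[dx xE] /diag_mxP[dy yE].
apply/eqP; rewrite -subr_eq0 -env_gen_br; apply/eqP.
suff -> : sl_br x y = 0 by rewrite raddf0.
by apply: val_inj; rewrite /= xE yE diag_mxC subrr.
Qed.

Definition sl_eps (e : 'I_n.+1) : sl k n :=
  n.+1%:R^-1 *: \sum_(j < n.+1) sl_diag e j.

Definition Uu (lam : k) (e : 'I_n.+1) : U :=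
  cst (n.+1%:R^-1 * (lam + n.+1%:R)) + gen (sl_eps e).

Lemma cst_Uu_comm lam c e : GRing.comm (cst c) (Uu lam e).
Proof.
apply: commrD; last exact: env_genC.
by rewrite /GRing.comm -!rmorphM mulrC.
Qed.

Lemma Uu_comm lam e e' : GRing.comm (Uu lam e) (Uu lam e').
Proof.
apply: commrD; first exact/commr_sym/cst_Uu_comm.
apply/commr_sym/commrD; first exact/commr_sym/env_genC.
by apply: cartan_gen_comm; apply/rpredZ/rpred_sum => j _; apply: sl_diag_h.
Qed.

Definition RE_U (lam : k) : RE k n -> U := mmap cst (Uu lam).
HB.instance Definition _ lam := GRing.Additive.copy (RE_U lam)
  (mmap cst (Uu lam)).
HB.instance Definition _ lam := GRing.isMonoidMorphism.Build (RE k n) U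
  (RE_U lam) (mmap_comm_monoid (cst_Uu_comm lam) (Uu_comm lam)).

Lemma RE_UX lam e : RE_U lam 'X_e = Uu lam e.
Proof. by rewrite /RE_U mmapX mmap1U. Qed.

Lemma RE_UC lam c : RE_U lam c%:MP = cst c.
Proof. exact: mmapC. Qed.

Lemma natS_neq0 : n.+1%:R != 0 :> k.
Proof. by have /pcharf0P -> := k0. Qed.

Lemma sum_sl_eps : \sum_e sl_eps e = 0.
Proof.
rewrite -scaler_sumr.
suff -> : \sum_e \sum_j sl_diag e j = 0 by rewrite scaler0.
apply: val_inj; rewrite raddf_sum raddf0.
under eq_bigr do rewrite raddf_sum /= sumrB.
by rewrite sumrB [X in _ - X]exchange_big subrr.
Qed.

Fact Rlam_U_rel lam r : Rlam_rel lam r -> RE_U lam r = 0.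
Proof.
move=> ->; rewrite rmorphB /= RE_UC /eulerA rmorph_sum /=.
under eq_bigr do rewrite rmorphB rmorph1 /= RE_UX.
rewrite sumrB big_split /= -(raddf_sum gen) sum_sl_eps raddf0 addr0.
rewrite !sumr_const card_ord -rmorphMn /= -mulr_natl mulrA.
rewrite mulfV ?natS_neq0 // mul1r rmorphD /= -(rmorph1 cst) -rmorphMn /=.
by rewrite addrK subrr.
Qed.

Definition Rlam_U (lam : k) : Rlam n lam -> U :=
  quo_lift (@Rlam_U_rel lam).
Arguments Rlam_U : clear implicits.
HB.instance Definition _ (lam : k) :=
  GRing.RMorphism.copy (Rlam_U lam) (quo_lift (@Rlam_U_rel lam)).

Lemma Rlam_U_cst lam c : Rlam_U lam (quo_pi _ c%:MP) = cst c.
Proof. exact: etrans (quo_liftE _ _) (RE_UC _ _). Qed.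

Lemma Rlam_U_h lam (i : 'I_n) :
  Rlam_U lam (quo_pi _ 'X_(ein i) - quo_pi _ 'X_(eout i)) = gen (sl_h k i).
Proof.
rewrite -rmorphB; apply: (etrans (quo_liftE _ _)).
rewrite rmorphB /= !RE_UX opprD addrACA subrr add0r -raddfB; congr gen.
rewrite -scalerBr -sumrB.
suff E j : sl_diag (ein i) j - sl_diag (eout i) j = sl_h k i.
  rewrite (eq_bigr _ (fun j _ => E j)) sumr_const card_ord.
  by rewrite -scaler_nat scalerA mulVf ?natS_neq0 // scale1r.
apply: val_inj; rewrite raddfB /= !mul_delta_mx.
by rewrite opprB addrA subrK.
Qed.

Lemma Rlam_U_uniq lam (f : {rmorphism Rlam n lam -> U}) :
  (forall c, f (quo_pi _ c%:MP) = cst c) ->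
  (forall i : 'I_n,
    f (quo_pi _ 'X_(ein i) - quo_pi _ 'X_(eout i)) = gen (sl_h k i)) ->
  f =1 Rlam_U lam.
Proof.
move=> fC fH; elim/quo_ind; set p := quo_pi _.
apply: (@mpoly_rmorph_eq _ _ _ (f \o p) (Rlam_U lam \o p)) => /= [c|e].
  by rewrite fC Rlam_U_cst.
pose d a : U := f (p 'X_a) - Rlam_U lam (p 'X_a).
have dS (i : 'I_n) : d (ein i) = d (eout i).
  have := fH i; rewrite -(Rlam_U_h lam i) !rmorphB /= -/p.
  move=> /eqP; rewrite subr_eq /d => /eqP ->.
  by apply/eqP; rewrite subr_eq [X in _ == X]addrC addrA addrAC.
have d0 a : d a = d ord0.
  case: a; elim=> [|a IH] lta; first by congr d; apply: val_inj.
  have lta' : (a < n)%N by [].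
  rewrite -(IH (ltnW lta)).
  transitivity (d (eout (Ordinal lta'))); first by congr d; apply: val_inj.
  by rewrite -dS; congr d; apply: val_inj.
have sum_d : \sum_a d a = 0.
  rewrite sumrB -!rmorph_sum /=.
  have -> : \sum_a 'X_a = (eulerA k n - lam%:MP) + (lam + n.+1%:R)%:MP.
    rewrite /eulerA sumrB sumr_const card_ord mpolyCD rmorphMn /= mpolyC1.
    by rewrite addrA !subrK.
  by rewrite rmorphD /= quo_pi0 // add0r fC Rlam_U_cst subrr.
apply/eqP; rewrite -subr_eq0 -/(d e) d0; apply/eqP.
move: sum_d; rewrite (eq_bigr _ (fun a _ => d0 a)) sumr_const card_ord.
rewrite -mulr_natl -(rmorph_nat cst) => /(congr1 ( *%R (cst n.+1%:R^-1))).
by rewrite mulrA -(rmorphM cst) mulVf ?natS_neq0 // rmorph1 mul1r mulr0.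
Qed.

End CartanMap.
Arguments Rlam_U {k n} k0 lam _.

(* Main.v *)
Require Import Defs.
From HB Require Import structures.
From mathcomp Require Import all_boot all_order all_algebra.
From mathcomp Require Import boolp functions mpoly ring zify.

Set Implicit Arguments.
Unset Strict Implicit.
Unset Printing Implicit Defensive.

Import Order.TTheory GRing.Theory Num.Theory.
Local Open Scope ring_scope.

(* Write [e i j] for the action on [M] of the image of the matrix unit E_ij
   under the projection gl -> sl.  Since [M] is simple and infinite-dimensional,
   some [E = e a b] is injective: otherwise all root vectors act locally
   nilpotently and, by a PBW argument, [M] has finite dimension.

   As weight spaces have dimension at most one, the degree zero part of U(sl)
   acts by scalars on weight vectors, hence commutatively; this yields the cubic
   relation e_ba e_cb e_ac = e_ca e_bc e_ab on [M].  On a weight vector [v] one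
   has e_ac e_cb v = x_c E v for every third index c.  Comparing the cubic
   relation at [v] and at [E v] shows that, once the weight p of [v] (a function
   on indices, defined up to a constant) is normalised by p_c = x_c, one has
   e_ji e_ij v = p_i (p_j - 1) v for all i <> j, and that the normalisation is
   preserved by all the e_ij.  With lam = sum_i (p_i - 1), which is then constant
   on [M], letting u_i act on [v] by p_i, X_i by e_i and Y_i by f_i defines an
   action of the TGW construction on [M].  The simplicity of [M] and the fact that
   the degree zero part of the TGW construction is R_E make the radical act by
   zero, so that A^lam acts on [M], with the same image in End(M) as U(sl).

   It remains to see that A^lam acts faithfully.  Let the TGW construction act on
   the skew Laurent polynomials over R_E by X_i = u_(i+1) z_i and
   Y_i = u_i z_i^-1.  The kernel of this action is contained in the radical, and
   it shows that each graded component of the TGW algebra is R_E Z_d for an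
   explicit Z_d such that Z_d Z_(-d) is a product of factors u_e + c.  An element
   r Z_d that kills [M] thus has r vanishing on all weights of [M], up to such
   factors; as for each third index c one of e_ac and e_cb is injective, the
   weights are Zariski dense in the hyperplane sum_i (p_i - 1) = lam, and r lies
   in the ideal generated by the Euler element minus lam. *)

(** * Weight vectors in pointed modules *)

Section Pointed.
Variables (k : fieldType) (k0 : [pchar k] =i pred0) (I : eqType).
Variables (M : lmodType k) (e : I -> I -> {linear M -> M}).

(** Only differences of diagonal operators are prescribed, since [e i i] stands for the traceless
    image of a matrix unit. For nonzero [v] this leaves [p] free up to an additive constant, which
    is normalised later. *)
Definition weight_vec (p : I -> k) (v : M) :=
  forall i j, e i i v - e j j v = (p i - p j) *: v.

Definition wshift (p : I -> k) (i j : I) : I -> k :=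
  fun l => p l + (l == i)%:R - (l == j)%:R.

Hypothesis eC : forall i j i' j' v,
  e i j (e i' j' v) =
  e i' j' (e i j v) + (j == i')%:R *: e i j' v - (j' == i)%:R *: e i' j v.
Hypothesis wv1 : forall p v w, weight_vec p v -> v != 0 -> weight_vec p w ->
  exists c, w = c *: v.

Lemma eZ i j c v : e i j (c *: v) = c *: e i j v.
Proof. exact: linearZ. Qed.
Lemma eD i j v w : e i j (v + w) = e i j v + e i j w.
Proof. exact: linearD. Qed.
Lemma eB i j v w : e i j (v - w) = e i j v - e i j w.
Proof. exact: linearB. Qed.
Lemma e0 i j : e i j 0 = 0.
Proof. exact: linear0. Qed.

Lemma eCC i j i' j' v : j != i' -> j' != i ->
  e i j (e i' j' v) = e i' j' (e i j v).
Proof. by move=> /negPf h /negPf h'; rewrite eC h h' !scale0r addr0 subr0. Qed.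

Lemma eCr i j l v : l != i -> e i j (e j l v) = e j l (e i j v) + e i l v.
Proof. by move=> /negPf h; rewrite eC h eqxx scale0r scale1r subr0. Qed.

Lemma eCl i j l v : j != l -> e i j (e l i v) = e l i (e i j v) - e l j v.
Proof. by move=> /negPf h; rewrite eC h eqxx scale0r scale1r addr0. Qed.

Lemma eCh p i j v : weight_vec p v ->
  e i j (e j i v) = e j i (e i j v) + (p i - p j) *: v.
Proof. by move=> wv; rewrite eC !eqxx !scale1r -addrA wv. Qed.

Arguments eCC : clear implicits.
Arguments eCr : clear implicits.
Arguments eCl : clear implicits.
Arguments eCh {p} i j {v}.

Lemma addBK_eq (V : zmodType) (x y z : V) : x - z + y = x -> y = z.
Proof.
by move=> h; apply: (addrI x); rewrite -{2}h addrAC subrK.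
Qed.

Lemma scal_inj (c d : k) (v : M) : v != 0 -> c *: v = d *: v -> c = d.
Proof.
move=> v0 /eqP; rewrite -subr_eq0 -scalerBl scaler_eq0 (negPf v0) orbF subr_eq0.
by move/eqP.
Qed.

Lemma weight_vec_ext p q v : p =1 q -> weight_vec p v -> weight_vec q v.
Proof. by move=> pq wv i j; rewrite wv !pq. Qed.

Lemma weight_vecD p v t : weight_vec p v -> weight_vec (fun i => p i + t) v.
Proof. by move=> wv i j; rewrite wv opprD addrACA subrr addr0. Qed.

Lemma weight_vecZ p v (c : k) : weight_vec p v -> weight_vec p (c *: v).
Proof. by move=> wv i j; rewrite !eZ -scalerBr wv !scalerA mulrC. Qed.

Lemma weight_vec_e p v i j : weight_vec p v -> weight_vec (wshift p i j) (e i j v).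
Proof.
move=> wv l m; rewrite (eC l l) (eC m m).
have -> : e i j (e l l v) + (l == i)%:R *: e l j v - (j == l)%:R *: e i l v =
    e i j (e l l v) + ((l == i)%:R - (l == j)%:R) *: e i j v.
  rewrite scalerBl addrA (eq_sym j); congr (_ + _ - _).
    by case: eqP => [->|]; rewrite ?scale0r.
  by case: eqP => [->|]; rewrite ?scale0r.
have -> : e i j (e m m v) + (m == i)%:R *: e m j v - (j == m)%:R *: e i m v =
    e i j (e m m v) + ((m == i)%:R - (m == j)%:R) *: e i j v.
  rewrite scalerBl addrA (eq_sym j); congr (_ + _ - _).
    by case: eqP => [->|]; rewrite ?scale0r.
  by case: eqP => [->|]; rewrite ?scale0r.
rewrite opprD addrACA -eB wv eZ -scalerBl -scalerDl.
by congr (_ *: _); rewrite /wshift; ring.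
Qed.

Ltac ne := first [assumption | by rewrite eq_sym | done].

(** The composite has weight zero, so it preserves the weight space spanned by [v]. *)
Lemma prod_scalar_ex p v i j : weight_vec p v -> exists c, e j i (e i j v) = c *: v.
Proof.
move=> wv; have [->|v0] := eqVneq v 0; first by exists 0; rewrite !e0 scaler0.
apply: (@wv1 p v) => //.
apply: (weight_vec_ext _ (weight_vec_e _ _ (weight_vec_e _ _ wv))) => l.
by rewrite /wshift; ring.
Qed.

(* Both identities say that [e j i * e i j] and [e l j * e j l] (resp. the
   opposite products) commute, which holds as they act by scalars. *)
Lemma cubic_rel p v i j l : i != j -> j != l -> i != l -> weight_vec p v ->
  e j i (e l j (e i l v)) = e l i (e j l (e i j v)).
Proof.
move=> ij jl il wv.
have [P hP] := prod_scalar_ex i j wv; have [R hR] := prod_scalar_ex j l wv.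
have : e j i (e i j (e l j (e j l v))) = e l j (e j l (e j i (e i j v))).
  by rewrite hP hR !eZ hP hR !scalerA mulrC.
rewrite (eCC i j l j); try ne.
rewrite (eCr i j l); try ne.
rewrite !eD (eCl j i l (e j l (e i j v))); try ne.
rewrite (eCC j i j l); try ne.
by move/addBK_eq.
Qed.

Lemma cubic_relV p v i j l : i != j -> j != l -> i != l -> weight_vec p v ->
  e i j (e j l (e l i v)) = e i l (e l j (e j i v)).
Proof.
move=> ij jl il wv.
have [P hP] := prod_scalar_ex j i wv; have [R hR] := prod_scalar_ex l j wv.
have : e i j (e j i (e j l (e l j v))) = e j l (e l j (e i j (e j i v))).
  by rewrite hP hR !eZ hP hR !scalerA mulrC.
rewrite (eCC j i j l); try ne.
rewrite (eCl j i l); try ne.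
rewrite !eB (eCr i j l); try ne.
rewrite (eCC i j l j); try ne.
by rewrite addrAC => /addBK_eq ->.
Qed.

Lemma wshiftl p i j : i != j -> wshift p i j i = p i + 1.
Proof. by move=> /negPf h; rewrite /wshift eqxx h subr0. Qed.
Lemma wshiftr p i j : i != j -> wshift p i j j = p j - 1.
Proof. by rewrite eq_sym => /negPf h; rewrite /wshift eqxx h addr0. Qed.
Lemma wshifto p i j l : l != i -> l != j -> wshift p i j l = p l.
Proof. by move=> /negPf h /negPf h'; rewrite /wshift h h' addr0 subr0. Qed.

Variables (a b : I) (ab : a != b).
Hypothesis Einj : forall v, e a b v = 0 -> v = 0.
Local Notation E := (e a b).

Lemma E_neq0 v : v != 0 -> E v != 0.
Proof. by apply: contraNneq => /Einj ->. Qed.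

Lemma EI v w : E v = E w -> v = w.
Proof. by move/eqP; rewrite -subr_eq0 -eB => /eqP /Einj /eqP; rewrite subr_eq0 => /eqP. Qed.

(** * The injective operator E_ab together with a third index c *)

Section ThirdIndex.
Variables (c : I) (ca : c != a) (cb : c != b).
Let ac : a != c. Proof. by rewrite eq_sym. Qed.
Let bc : b != c. Proof. by rewrite eq_sym. Qed.

Lemma path_acb_ex p v : weight_vec p v -> v != 0 ->
  exists x, e a c (e c b v) = x *: E v.
Proof.
move=> pv v0; apply: (wv1 (weight_vec_e a b pv)); first exact: E_neq0.
apply: (weight_vec_ext _ (weight_vec_e _ _ (weight_vec_e _ _ pv))) => l.
by rewrite /wshift; ring.
Qed.

Lemma path_cba x v : e a c (e c b v) = x *: E v ->
  e c b (e a c v) = (x - 1) *: E v.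
Proof.
rewrite eCr; last ne.
by move=> h; apply/eqP; rewrite scalerBl scale1r -h addrK.
Qed.

(* If e_ac v = 0 and e_bc v <> 0, the cubic relation forces the weight of
   E e_bc v to satisfy p_a = p_c; the same at [E v] gives a contradiction. *)
Lemma vanish_bc p v : weight_vec p v -> e a c v = 0 -> e b c v = 0.
Proof.
have key q u : weight_vec q u -> e a c u = 0 -> e b c u != 0 ->
    q a + 1 = q c - 1.
  move=> qu acu bcu.
  have Ebc : E (e b c u) = e b c (E u) by rewrite eCr ?acu ?addr0; last ne.
  have := cubic_rel ab bc ac qu; rewrite acu !e0 -Ebc => h.
  have qw := weight_vec_e a b (weight_vec_e b c qu).
  have := eCh a c qw; rewrite -h e0.
  rewrite (eCC a c a b); try ne; rewrite (eCC a c b c); try ne.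
  rewrite acu !e0 add0r => /esym /eqP.
  rewrite scaler_eq0 (negPf (E_neq0 bcu)) orbF subr_eq0 => /eqP.
  rewrite wshiftl // (wshifto _ (l := c)) // (wshifto _ (l := a)) //; try ne.
  by rewrite wshiftr //; ne.
move=> pv acv; apply/eqP; apply/negPn/negP => bcv.
have h1 := key _ _ pv acv bcv.
have Ebc : E (e b c v) = e b c (E v) by rewrite eCr ?acv ?addr0; last ne.
have := key _ _ (weight_vec_e a b pv).
rewrite (eCC a c a b); try ne; rewrite acv e0 -Ebc => /(_ erefl (E_neq0 bcv)).
rewrite wshiftl // wshifto // -h1 => /eqP.
by rewrite -subr_eq0 addrAC subrr add0r oner_eq0.
Qed.

(** This is the counterpart of [vanish_bc] for the opposite cubic relation, used at [E v]: if
    [e c a v] were nonzero, both [e b c] and [e c b] would kill [E (e c a v)], and their commutator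
    would force its weight to take equal values at [b] and [c]. Passing from [v] to [E v] changes
    only one of these values. *)
Lemma vanish_ca p v : weight_vec p v -> e c b v = 0 -> e c a v = 0.
Proof.
have key q u : weight_vec q u -> e c b u = 0 -> e c a u != 0 ->
    q b - 1 = q c + 1.
  move=> qu cbu cau.
  have Eca : E (e c a u) = e c a (E u) by rewrite eCl ?cbu ?subr0; last ne.
  have qw := weight_vec_e a b (weight_vec_e c a qu).
  have := cubic_relV ab bc ac (weight_vec_e a b qu).
  have [P hP] := prod_scalar_ex a b qu.
  rewrite hP !eZ cbu e0 scaler0 => /Einj; rewrite -Eca => h.
  have := eCh b c qw; rewrite h e0.
  rewrite (eCC c b a b); try ne; rewrite (eCC c b c a); try ne.
  rewrite cbu !e0 add0r => /esym /eqP.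
  rewrite scaler_eq0 (negPf (E_neq0 cau)) orbF subr_eq0 => /eqP.
  rewrite wshiftr // (wshifto _ (l := c)) // (wshifto _ (l := b)) //; try ne.
  by rewrite wshiftl //; ne.
move=> pv cbv; apply/eqP; apply/negPn/negP => cav.
have h1 := key _ _ pv cbv cav.
have Eca : E (e c a v) = e c a (E v) by rewrite eCl ?cbv ?subr0; last ne.
have := key _ _ (weight_vec_e a b pv).
rewrite (eCC c b a b); try ne; rewrite cbv e0 -Eca => /(_ erefl (E_neq0 cav)).
rewrite wshiftr // wshifto // -h1 => /eqP.
by rewrite -subr_eq0 addrAC subrr add0r oppr_eq0 oner_eq0.
Qed.

(** When [e a c v] vanishes it spans nothing, and [vanish_bc] takes over. *)
Lemma path_abc_ex p v : weight_vec p v -> exists y, E (e b c v) = y *: e a c v.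
Proof.
move=> pv; have [acv|acv] := eqVneq (e a c v) 0.
  by exists 0; rewrite (vanish_bc pv acv) scale0r e0.
apply: (wv1 (weight_vec_e a c pv)) => //.
apply: (weight_vec_ext _ (weight_vec_e _ _ (weight_vec_e _ _ pv))) => l.
by rewrite /wshift; ring.
Qed.

Lemma path_bca y v : E (e b c v) = y *: e a c v -> e b c (E v) = (y - 1) *: e a c v.
Proof.
rewrite eCr; last ne.
by move=> h; rewrite scalerBl scale1r -h addrK.
Qed.

(** The cubic relation for [a], [b], [c], with each path replaced by its scalar. *)
Lemma cubic_scalars p v x y R P : weight_vec p v -> v != 0 ->
  e a c (e c b v) = x *: E v -> E (e b c v) = y *: e a c v ->
  e c a (e a c v) = R *: v -> e b a (E v) = P *: v -> (y - 1) * R = (x - 1) * P.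
Proof.
move=> pv v0 /path_cba hx /path_bca hy hR hP; apply: (scal_inj v0).
have := cubic_rel ab bc ac pv.
by rewrite hx hy !eZ hR hP !scalerA.
Qed.

Lemma prod_shift p v i j P : i != j -> weight_vec p v -> e j i (e i j v) = P *: v ->
  e j i (e i j (e i j v)) = (P - (p i + 1 - (p j - 1))) *: e i j v.
Proof.
move=> ij pv hP; have := eCh i j (weight_vec_e i j pv).
by rewrite hP eZ wshiftl // wshiftr // => h; rewrite [RHS]scalerBl h addrK.
Qed.

(* Subtract the relation of [cubic_scalars] at [v] from the one at [E v]. *)
Lemma prod_ac_scalar p v x y R P : weight_vec p v -> v != 0 ->
  e a c (e c b v) = x *: E v -> E (e b c v) = y *: e a c v ->
  e c a (e a c v) = R *: v -> e b a (E v) = P *: v ->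
  R = (x - 1) * (y + p a - p b).
Proof.
move=> pv v0 hx hy hR hP; have h0 := cubic_scalars pv v0 hx hy hR hP.
have := @cubic_scalars _ (E v) x (y - 1) (R + (x - 1)) (P - (p a + 1 - (p b - 1)))
  (weight_vec_e a b pv) (E_neq0 v0).
have -> : e a c (e c b (E v)) = x *: E (E v).
  rewrite (eCC c b a b); try ne; rewrite (eCC a c a b); try ne.
  by rewrite hx eZ.
have -> : E (e b c (E v)) = (y - 1) *: e a c (E v).
  by rewrite (path_bca hy) eZ (eCC a c a b) //; ne.
have -> : e c a (e a c (E v)) = (R + (x - 1)) *: E v.
  rewrite (eCC a c a b); try ne; rewrite eCr; try ne.
  by rewrite hR eZ (path_cba hx) [RHS]scalerDl.
rewrite (prod_shift ab pv hP) => /(_ erefl erefl erefl erefl) h1.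
apply/eqP; rewrite -subr_eq0.
have -> : R - (x - 1) * (y + p a - p b) =
  ((y - 1) * R - (x - 1) * P) - ((y - 1 - 1) * (R + (x - 1)) -
   (x - 1) * (P - (p a + 1 - (p b - 1)))) by ring.
by rewrite h0 h1 !subrr.
Qed.

(* The weight [p], which matters only up to a constant, is normalised so that
   its value at [c] is the scalar of [path_acb_ex]. *)
Definition good1 p v :=
  [/\ weight_vec p v, v != 0 & e a c (e c b v) = p c *: E v].

Lemma good1_ab p v : good1 p v -> good1 (wshift p a b) (E v).
Proof.
case=> pv v0 hx; split; [exact: weight_vec_e|exact: E_neq0|].
rewrite (eCC c b a b); try ne; rewrite (eCC a c a b); try ne.
by rewrite hx eZ wshifto.
Qed.

Lemma good1_ac p v : good1 p v -> e a c v != 0 ->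
  good1 (wshift p a c) (e a c v).
Proof.
case=> pv v0 hx acv; split; [exact: weight_vec_e|by []|].
rewrite (path_cba hx) eZ wshiftr; last ne.
by rewrite (eCC a c a b) //; ne.
Qed.

Lemma good1_cb p v : good1 p v -> e c b v != 0 ->
  good1 (wshift p c b) (e c b v).
Proof.
case=> pv v0 hx cbv; split; [exact: weight_vec_e|by []|].
rewrite wshiftl // [LHS]eCr; last ne.
by rewrite hx eZ (eCC c b a b) ?scalerDl ?scale1r //; ne.
Qed.

Lemma good1_ac0 p v : good1 p v -> e a c v = 0 -> p c = 1.
Proof.
case=> pv v0 /path_cba + acv; rewrite acv e0 => /esym /eqP.
by rewrite scaler_eq0 (negPf (E_neq0 v0)) orbF subr_eq0 => /eqP.
Qed.

(** [prod_ac_scalar] applies at [v] and at [e a c v] with the same [y], while [prod_shift] relates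
    the two products; together they force [y = p b]. If [e a c] kills [e a c v], then [p c = 2] and
    [prod_shift] alone suffices. *)
Lemma good1_R p v R : good1 p v -> e a c v != 0 ->
  e c a (e a c v) = R *: v ->
  E (e b c v) = p b *: e a c v /\ R = p a * (p c - 1).
Proof.
move=> g acv hR; have [pv v0 hx] := g.
have [y hy] := path_abc_ex pv; have [P hP] := prod_scalar_ex a b pv.
have hR2 := prod_ac_scalar pv v0 hx hy hR hP.
suff yE : y = p b by split; rewrite ?hy ?hR2 ?yE //; ring.
have g' := good1_ac g acv; have [pv' v0' hx'] := g'.
have hR' := prod_shift ac pv hR.
have [acv'|acv'] := eqVneq (e a c (e a c v)) 0.
  have := good1_ac0 g' acv'; rewrite wshiftr // => pc.
  move: hR'; rewrite acv' e0 => /esym /eqP.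
  rewrite scaler_eq0 (negPf acv) orbF => /eqP.
  have {pc} pc : p c = 2 by rewrite -[p c](subrK 1) pc.
  rewrite hR2 pc => h; apply/eqP; rewrite -subr_eq0 -h; apply/eqP; ring.
have [P' hP'] := prod_scalar_ex a b pv'.
have := prod_ac_scalar pv' v0' hx' _ hR' hP' => /(_ y).
rewrite (eCC b c a c); try ne; rewrite -(eCC a c a b); try ne.
rewrite hy eZ => /(_ erefl); rewrite wshiftr // wshiftl // wshifto; try ne.
rewrite hR2 => h; apply/eqP; rewrite -subr_eq0.
have -> : y - p b = (p c - 1) * (y + p a - p b) - (p a + 1 - (p c - 1)) -
  (p c - 1 - 1) * (y + (p a + 1) - p b) by ring.
by rewrite h subrr.
Qed.

Lemma good1_P1 p v : good1 p v -> e a c v != 0 -> p c != 1 ->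
  e b a (E v) = (p a * (p b - 1)) *: v.
Proof.
move=> g acv pc; have [pv v0 hx] := g.
have [R hR] := prod_scalar_ex a c pv; have [P hP] := prod_scalar_ex a b pv.
have [hy RE] := good1_R g acv hR; rewrite hP; congr (_ *: _).
have := cubic_scalars pv v0 hx hy hR hP; rewrite RE => h.
apply: (mulfI (x := p c - 1)); first by rewrite subr_eq0.
by rewrite -h; ring.
Qed.

(** In the two cases that [good1_P1] leaves out, it still applies to a neighbour of [v]: to
    [e c b v] when [e a c v = 0], and to [e a c v] when [p c = 1]. Commutators carry the formula
    back to [v]. *)
Lemma good1_P p v : good1 p v -> e b a (E v) = (p a * (p b - 1)) *: v.
Proof.
move=> g; have [pv v0 hx] := g.
have [acv|acv] := eqVneq (e a c v) 0.
  have pc := good1_ac0 g acv; rewrite pc scale1r in hx.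
  have cbv : e c b v != 0.
    by apply: contraTneq (E_neq0 v0) => h; rewrite -hx h e0 eqxx.
  have g' := good1_cb g cbv.
  have pc' : wshift p c b c != 1.
    by rewrite wshiftl // pc -subr_eq0 addrK oner_eq0.
  have acv' : e a c (e c b v) != 0 by rewrite hx E_neq0.
  have [pv' v0' hx'] := g'.
  have [R hR] := prod_scalar_ex a c pv'; have [_ RE] := good1_R g' acv' hR.
  have := good1_P1 g' acv' pc'.
  rewrite -(eCC c b a b); try ne; rewrite eCl; last ne.
  rewrite -{2}hx hR => /eqP; rewrite subr_eq -scalerDl => /eqP.
  have [P hP] := prod_scalar_ex a b pv; rewrite hP eZ => /(scal_inj cbv) ->.
  congr (_ *: _); rewrite RE wshiftr // wshiftl // wshifto; try ne.
  by rewrite pc; ring.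
have [pc|pc] := eqVneq (p c) 1; last exact: good1_P1.
have g' := good1_ac g acv.
have pc' : wshift p a c c != 1.
  rewrite wshiftr; try ne; rewrite pc -subr_eq0 subrr sub0r oppr_eq0.
  exact: oner_neq0.
have acv' : e a c (e a c v) != 0.
  by apply: contraNneq pc' => /(good1_ac0 g') ->.
have := good1_P1 g' acv' pc'.
rewrite (eCC a b a c); try ne; rewrite eCr; last ne.
have [R hR] := prod_scalar_ex a c pv; have [/path_bca hy _] := good1_R g acv hR.
have [P hP] := prod_scalar_ex a b pv.
rewrite hP eZ hy -scalerDl => /(scal_inj acv).
rewrite wshiftl ?wshifto; try ne; move=> h; congr (_ *: _).
by rewrite -[P](addrK (p b - 1)) h; ring.
Qed.

Lemma good1_all p v : good1 p v ->
  [/\ e c a (e a c v) = (p a * (p c - 1)) *: v, E (e b c v) = p b *: e a c v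
    & e c b (e b c v) = (p b * (p c - 1)) *: v].
Proof.
move=> g; have [pv v0 hx] := g.
have [R hR] := prod_scalar_ex a c pv.
have [hRE hy] : e c a (e a c v) = (p a * (p c - 1)) *: v /\ E (e b c v) = p b *: e a c v.
  have [acv|acv] := eqVneq (e a c v) 0.
    rewrite (vanish_bc pv acv) acv !e0 scaler0; split=> //.
    by rewrite (good1_ac0 g acv) subrr mulr0 scale0r.
  by rewrite hR; have [-> ->] := good1_R g acv hR.
(* Since [e c b] commutes with the injective [E], the last product can be tested after applying [E],
   where [E (e b c v)] and [path_cba] are known. *)
split=> //; apply: EI; rewrite -(eCC c b a b); try ne.
by rewrite hy !eZ (path_cba hx) scalerA.
Qed.
End ThirdIndex.

(* The formulas for e_ba e_ab given by the normalisations at [c] and at [d]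
   leave two values for their difference; moving along e_ac or e_cb leaves one. *)
Lemma good1_other c d p v : c != a -> c != b -> d != a -> d != b -> c != d ->
  good1 c p v -> e a d (e d b v) = p d *: E v.
Proof.
move=> ca cb da db cd g; have [pv v0 hx] := g.
have [q hq] := path_acb_ex d pv v0; rewrite hq; congr (_ *: _).
have key p' v' : good1 c p' v' -> p' d = p d ->
    e a d (e d b v') = q *: E v' ->
    (q - p d) * (p' a + p' b + (q - p d) - 1) = 0.
  move=> g' pd hq'; have [pv' v0' hx'] := g'.
  have g2 : good1 d (fun i => p' i + (q - p d)) v'.
    split=> //; first exact: weight_vecD.
    by rewrite hq' pd addrC subrK.
  have := good1_P ca cb g'; rewrite (good1_P da db g2) => /(scal_inj v0') h.
  transitivity ((p' a + (q - p d)) * (p' b + (q - p d) - 1) - p' a * (p' b - 1)).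
    by ring.
  by rewrite h subrr.
have h := key _ _ g erefl hq.
suff /eqP : q - p d = 0 by rewrite subr_eq0 => /eqP.
have [acv|acv] := eqVneq (e a c v) 0.
  have cbv : e c b v != 0.
    apply: contraTneq (E_neq0 v0) => h'.
    move: hx; rewrite (good1_ac0 g acv) scale1r => <-.
    by rewrite h' e0 eqxx.
  have := key _ _ (good1_cb cb g cbv).
  rewrite wshifto; try ne; move/(_ erefl).
  rewrite (eCC d b c b); try ne; rewrite (eCC a d c b); try ne.
  rewrite hq eZ (eCC c b a b); try ne; move/(_ erefl).
  rewrite wshiftr // wshifto; try ne; move=> h'.
  transitivity ((q - p d) * (p a + p b + (q - p d) - 1) -
    (q - p d) * (p a + (p b - 1) + (q - p d) - 1)); first by ring.
  by rewrite h h' subrr.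
have := key _ _ (good1_ac ca g acv).
rewrite wshifto; try ne; move/(_ erefl).
rewrite (eCC d b a c); try ne; rewrite (eCC a d a c); try ne.
rewrite hq eZ (eCC a c a b); try ne; move/(_ erefl).
rewrite wshiftl ?(wshifto _ (l := b)); try ne; move=> h'.
transitivity ((q - p d) * (p a + 1 + p b + (q - p d) - 1) -
    (q - p d) * (p a + p b + (q - p d) - 1)); first by ring.
by rewrite h h' subrr.
Qed.

Definition good p v :=
  [/\ weight_vec p v, v != 0 &
      forall c, c != a -> c != b -> e a c (e c b v) = p c *: E v].

Lemma good_good1 p v c : c != a -> c != b -> good p v -> good1 c p v.
Proof. by move=> ca cb [pv v0 hx]; split=> //; apply: hx. Qed.

(** * Vectors normalised at all third indices *)

Section GoodVectors.
Variables (c0 : I) (c0a : c0 != a) (c0b : c0 != b).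

(** The constant is fixed at [c0]; by [good1_other] it is then right at every other third index. *)
Lemma good_ex p v : weight_vec p v -> v != 0 ->
  exists t, good (fun i => p i + t) v.
Proof.
move=> pv v0; have [x hx] := path_acb_ex c0 pv v0.
exists (x - p c0); have g : good1 c0 (fun i => p i + (x - p c0)) v.
  by split=> //; [exact: weight_vecD|rewrite addrC subrK].
split=> // [|c ca cb]; first exact: weight_vecD.
have [->|] := eqVneq c c0; first by have [] := g.
by rewrite eq_sym => cc; apply: (good1_other c0a c0b ca cb cc g).
Qed.

Lemma good_ext p q v : p =1 q -> good p v -> good q v.
Proof.
move=> pq [pv v0 hx]; split=> // [|c ca cb]; first exact: weight_vec_ext pv.
by rewrite hx // pq.
Qed.

(** The operator path through [c0] determines the value of the weight at [c0], and rescaling the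
    vector does not change it. *)
Lemma good_uniq p v t z : good p v -> good (fun i => p i + t) (z *: v) -> t = 0.
Proof.
move=> [pv v0 hx] [_ zv0 /(_ _ c0a c0b)]; rewrite !eZ hx // scalerA mulrC -scalerA.
have Ev0 : z *: E v != 0 by rewrite -eZ E_neq0.
by move/(scal_inj Ev0) => h; apply: (addrI (p c0)); rewrite addr0 -h.
Qed.

Lemma good_ab p v : good p v -> good (wshift p a b) (E v).
Proof.
move=> g; split=> [||c ca cb].
- by apply: weight_vec_e; case: g.
- by apply: E_neq0; case: g.
- by have [_ _] := good1_ab ca cb (good_good1 ca cb g).
Qed.

Lemma good_ac p v c : c != a -> c != b -> good p v -> e a c v != 0 ->
  good (wshift p a c) (e a c v).
Proof.
move=> ca cb g acv; have [pv v0 hx] := g.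
split=> [||d da db] //; first exact: weight_vec_e.
have [->|dc] := eqVneq d c.
  by have [_ _] := good1_ac ca (good_good1 ca cb g) acv.
rewrite (eCC d b a c); try ne; rewrite (eCC a d a c); try ne.
by rewrite hx // eZ (eCC a c a b) ?wshifto //; ne.
Qed.

Lemma good_cb p v c : c != a -> c != b -> good p v -> e c b v != 0 ->
  good (wshift p c b) (e c b v).
Proof.
move=> ca cb g cbv; have [pv v0 hx] := g.
split=> [||d da db] //; first exact: weight_vec_e.
have [->|dc] := eqVneq d c.
  by have [_ _] := good1_cb cb (good_good1 ca cb g) cbv.
rewrite (eCC d b c b); try ne; rewrite (eCC a d c b); try ne.
by rewrite hx // eZ (eCC c b a b) ?wshifto //; ne.
Qed.

(* [E] preserves the normalisation of the weight, so that of [e i j v] can be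
   read off its image. *)
Lemma good_transport p v i j q v' z : good p v -> e i j v != 0 ->
  good q v' -> E (e i j v) = z *: v' -> wshift (wshift p i j) a b =1 q ->
  good (wshift p i j) (e i j v).
Proof.
move=> [pv v0 hx] w0 g' Ew pq.
have [t gt] := good_ex (weight_vec_e i j pv) w0.
suff t0 : t = 0 by apply: good_ext gt => l; rewrite t0 addr0.
apply: (good_uniq g' (z := z)); rewrite -Ew.
apply: good_ext (good_ab gt) => l.
by rewrite -pq /wshift; ring.
Qed.

Lemma good_ba p v : good p v -> e b a v != 0 -> good (wshift p b a) (e b a v).
Proof.
move=> g w0; have [pv v0 hx] := g; have [P hP] := prod_scalar_ex b a pv.
by apply: (good_transport g w0 g hP) => l; rewrite /wshift; ring.
Qed.

Lemma good_bc p v c : c != a -> c != b -> good p v -> e b c v != 0 ->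
  good (wshift p b c) (e b c v).
Proof.
move=> ca cb g w0; have [pv v0 hx] := g.
have acv : e a c v != 0.
  by apply: contra w0 => /eqP acv; rewrite (vanish_bc ca cb pv acv).
have [y hy] := path_abc_ex ca cb pv.
apply: (good_transport g w0 (good_ac ca cb g acv) hy) => l.
by rewrite /wshift; ring.
Qed.

Lemma good_ca p v c : c != a -> c != b -> good p v -> e c a v != 0 ->
  good (wshift p c a) (e c a v).
Proof.
move=> ca cb g w0; have [pv v0 hx] := g.
have cbv : e c b v != 0.
  by apply: contra w0 => /eqP cbv; rewrite (vanish_ca ca cb pv cbv).
have wE : wshift (wshift p c a) a b =1 wshift p c b.
  by move=> l; rewrite /wshift; ring.
have [y hy] : exists y, E (e c a v) = y *: e c b v.
  apply: (wv1 (weight_vec_e c b pv)) => //.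
  exact: weight_vec_ext wE (weight_vec_e a b (weight_vec_e c a pv)).
exact: (good_transport g w0 (good_cb ca cb g cbv) hy).
Qed.

(** * Operators between two third indices *)

Section FourthIndex.
Variables (c d : I) (ca : c != a) (cb : c != b) (da : d != a) (db : d != b).
Hypothesis cd : c != d.

(** Let [t] be the constant missing from the weight of [w = e c d v]. The paths through [c] and [d]
    at [w] differ from [p c] and [p d] times [E w] by [e a d (e c b v)] with opposite signs. Adding
    the two conditions gives [2 t = 0], and the first one then gives [E w]. *)
Lemma good_cdE p v : good p v -> e c d v != 0 ->
  good (wshift p c d) (e c d v) /\ E (e c d v) = e a d (e c b v).
Proof.
move=> g w0; have [pv v0 hx] := g.
have [t gt] := good_ex (weight_vec_e c d pv) w0.
have [_ _ hx'] := gt; have Ew0 := E_neq0 w0.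
have hc := hx' _ ca cb; have hd := hx' _ da db.
rewrite (eCC c b c d) in hc; try ne.
rewrite (eCr a c d) in hc; try ne.
rewrite hx // eZ (eCC c d a b) in hc; try ne.
rewrite (eCl d b c) in hd; try ne.
rewrite eB (eCC a d c d) in hd; try ne.
rewrite hx // eZ (eCC c d a b) in hd; try ne.
have t0 : t = 0.
  have : (p c + p d) *: E (e c d v) =
      (wshift p c d c + t + (wshift p c d d + t)) *: E (e c d v).
    by rewrite !(scalerDl _ (wshift p c d c + t)) -hc -hd scalerDl addrACA subrr addr0.
  move/(scal_inj Ew0); rewrite wshiftl // wshiftr // => h.
  have : t *+ 2 = 0.
    transitivity ((p c + 1 + t + (p d - 1 + t)) - (p c + p d)); first by ring.
    by rewrite -h subrr.
  rewrite -mulr_natr => /eqP; rewrite mulf_eq0 => /orP[/eqP //|].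
  by have /pcharf0P -> := k0.
split; first by apply: good_ext gt => l; rewrite t0 addr0.
move: hc; rewrite t0 addr0 wshiftl // [in RHS]scalerDl scale1r.
by move/addrI.
Qed.

(** Otherwise [z = e a d (e c b v)] is nonzero and killed by both [e c d] and [e c d] after [e d c],
    so the commutator forces [p c + 1 = p d - 1]. The same argument at [e c b v] and at [e a d v]
    would contradict this unless [p c + 1 = 0] and [p d - 1 = 1], which is again a contradiction. *)
Lemma good_cd0 p v : good p v -> e c d v = 0 -> p c * (p d - 1) = 0.
Proof.
have key q u : good q u -> e c d u = 0 -> q c != 0 -> q d != 1 ->
    [/\ e c b u != 0, e a d u != 0 & q c + 1 = q d - 1].
  move=> g cdu qc qd; have [qu u0 hx] := g; have Eu0 := E_neq0 u0.
  have cbu : e c b u != 0.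
    apply: contraNneq qc => h; have := hx _ ca cb; rewrite h e0 => /esym /eqP.
    by rewrite scaler_eq0 (negPf Eu0) orbF.
  have hd := path_cba (hx _ da db).
  have adu : e a d u != 0.
    apply: contraNneq qd => h; move: hd; rewrite h e0 => /esym /eqP.
    by rewrite scaler_eq0 (negPf Eu0) orbF subr_eq0.
  split=> //; pose z := e a d (e c b u).
  have z0 : z != 0.
    have : e d b z != 0.
      rewrite /z -(eCC c b a d); try ne; rewrite -(eCC c b d b); try ne.
      rewrite hd eZ (eCC c b a b); try ne.
      by rewrite scaler_eq0 negb_or subr_eq0 qd E_neq0.
    by apply: contraNneq => ->; rewrite e0.
  have cdz : e c d z = 0.
    rewrite /z (eCC c d a d); try ne; rewrite (eCC c d c b); try ne.
    by rewrite cdu !e0.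
  have qz := weight_vec_e a d (weight_vec_e c b qu).
  have [r hr] : exists r, e d c z = r *: E u.
    apply: (wv1 (weight_vec_e a b qu)) => //.
    apply: weight_vec_ext (weight_vec_e d c qz) => l.
    by rewrite /wshift; ring.
  have := eCh c d qz; rewrite -/z hr eZ (eCC c d a b); try ne.
  rewrite cdu cdz !e0 scaler0 add0r => /esym /eqP.
  rewrite scaler_eq0 (negPf z0) orbF subr_eq0 => /eqP.
  rewrite (wshifto _ (l := c)) // wshiftl //.
  by rewrite wshiftr ?wshifto //; ne.
move=> g cdv; apply/eqP; apply/negPn/negP; rewrite mulf_eq0 negb_or subr_eq0.
case/andP => pc pd; have [cbv adv h] := key _ _ g cdv pc pd.
have pc1 : p c + 1 = 0.
  apply/eqP; apply/negPn/negP => pc1.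
  have := key _ _ (good_cb ca cb g cbv).
  rewrite wshiftl // wshifto //; last ne.
  rewrite (eCC c d c b); try ne; rewrite cdv e0 => /(_ erefl pc1 pd) [_ _].
  move/eqP; rewrite -h -subr_eq0 addrAC subrr add0r oner_eq0 //.
have pd1 : p d - 1 = 1.
  apply/eqP; apply/negPn/negP => pd1.
  have := key _ _ (good_ac da db g adv).
  rewrite wshiftr; try ne; rewrite wshifto //; try ne.
  rewrite (eCC c d a d); try ne; rewrite cdv e0 => /(_ erefl pc pd1) [_ _].
  by move/eqP; rewrite h -subr_eq0 opprB addrC subrK oner_eq0.
by move: h; rewrite pc1 pd1 => /esym /eqP; rewrite oner_eq0.
Qed.
End FourthIndex.

Lemma good_cd p v c d : c != a -> c != b -> d != a -> d != b -> c != d ->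
  good p v -> e d c (e c d v) = (p c * (p d - 1)) *: v.
Proof.
move=> ca cb da db cd g; have [pv v0 hx] := g.
have [cdv|cdv] := eqVneq (e c d v) 0.
  by rewrite cdv e0 (good_cd0 ca cb da db cd g cdv) scale0r.
have dc : d != c by ne.
have [gw Ew] := good_cdE ca cb da db cd g cdv.
have [dcw|dcw] := eqVneq (e d c (e c d v)) 0.
  have := good_cd0 da db ca cb dc gw dcw.
  by rewrite wshiftr // wshiftl // addrK mulrC => ->; rewrite dcw scale0r.
(* With the roles of [c] and [d] exchanged, [good_cdE] turns the left side into a path through [a]
   and [b] whose factors are known. *)
apply: EI; have [_ ->] := good_cdE da db ca cb dc gw dcw.
rewrite (eCC a c d b); try ne.
have -> : e a c (e c d v) = p c *: e a d v.
  apply: EI; rewrite -(eCC a c a b); try ne.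
  rewrite Ew (eCC a c a d); try ne; rewrite hx // !eZ.
  by rewrite (eCC a d a b); try ne.
by rewrite !eZ (path_cba (hx _ da db)) scalerA.
Qed.

Lemma prod_sym p v i j : weight_vec p v ->
  e j i (e i j v) = (p i * (p j - 1)) *: v ->
  e i j (e j i v) = (p j * (p i - 1)) *: v.
Proof.
move=> pv h; rewrite (eCh i j pv) h -scalerDl; congr (_ *: _); ring.
Qed.

Lemma good_prod p v i j : i != j -> good p v ->
  e j i (e i j v) = (p i * (p j - 1)) *: v.
Proof.
move=> ij g; have [pv v0 hx] := g.
have Pab := good1_P c0a c0b (good_good1 c0a c0b g).
have H c : c != a -> c != b -> _ := fun ca cb =>
  good1_all ca cb (good_good1 ca cb g).
case: (eqVneq i a) ij => [->|ia] ij.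
  have [->//|jb] := eqVneq j b.
  by have [] := H j; first ne.
case: (eqVneq i b) ij => [->|ib] ij.
  case: (eqVneq j a) ij => [->|ja] ij; first exact: prod_sym Pab.
  by have [] := H j ja; first ne.
case: (eqVneq j a) ij => [->|ja] ij.
  by apply: prod_sym => //; have [] := H i ia ib.
case: (eqVneq j b) ij => [->|jb] ij.
  by apply: prod_sym => //; have [] := H i ia ib.
exact: good_cd.
Qed.

Lemma good_e p v i j : i != j -> good p v -> e i j v != 0 ->
  good (wshift p i j) (e i j v).
Proof.
move=> ij g; have [pv v0 hx] := g.
case: (eqVneq i a) ij => [->|ia] ij.
  have [->//|jb] := eqVneq j b; first by move=> _; apply: good_ab.
  by apply: good_ac => //; ne.
case: (eqVneq i b) ij => [->|ib] ij.
  case: (eqVneq j a) ij => [->|ja] ij; first exact: good_ba.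
  by apply: good_bc => //; ne.
case: (eqVneq j a) ij => [->|ja] ij; first exact: good_ca.
case: (eqVneq j b) ij => [->|jb] ij; first exact: good_cb.
by move=> w0; have [] := good_cdE ia ib ja jb ij g w0.
Qed.
End GoodVectors.
End Pointed.

(** * Modules over sl_(n+1) *)

Inductive lspan (k : fieldType) (M : lmodType k) (S : M -> Prop) : M -> Prop :=
| lspan_in v : S v -> lspan S v
| lspan0 : lspan S 0
| lspanD v w : lspan S v -> lspan S w -> lspan S (v + w)
| lspanZ c v : lspan S v -> lspan S (c *: v).

Section Span.
Variables (k : fieldType) (M : lmodType k).
Implicit Types S T : M -> Prop.

Lemma lspanN S v : lspan S v -> lspan S (- v).
Proof. by move=> h; rewrite -scaleN1r; apply: lspanZ. Qed.

Lemma lspan_sum S (J : Type) (r : seq J) (P : pred J) (F : J -> M) :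
  (forall j, P j -> lspan S (F j)) -> lspan S (\sum_(j <- r | P j) F j).
Proof.
by move=> h; elim/big_rec: _ => [|j x Pj]; [exact: lspan0|apply/lspanD/h].
Qed.

Lemma lspan_bind S T v : lspan S v -> (forall w, S w -> lspan T w) -> lspan T v.
Proof.
move=> + ST; elim=> [w /ST //||w u _ hw _ hu|c w _ hw].
- exact: lspan0.
- exact: lspanD.
- exact: lspanZ.
Qed.

Lemma lspan_map S T (f : M -> M) v : linear f -> lspan S v ->
  (forall w, S w -> lspan T (f w)) -> lspan T (f v).
Proof.
move=> fL + ST.
have f0 : f 0 = 0.
  by have := fL (-1) 0 0; rewrite scaler0 addr0 scaleN1r addNr.
elim=> [w /ST //||w u _ hw _ hu|c w _ hw].
- by rewrite f0; apply: lspan0.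
- by rewrite -[w]scale1r fL scale1r; apply: lspanD.
- by rewrite -[c *: w]addr0 fL f0 addr0; apply: lspanZ.
Qed.

Lemma lspan_eq0 S (f : M -> M) v : linear f -> lspan S v ->
  (forall w, S w -> f w = 0) -> f v = 0.
Proof.
move=> fL Sv f0; have : lspan (fun w => w = 0) (f v).
  by apply: lspan_map Sv _ => // w Sw; rewrite f0 //; apply: lspan0.
elim=> //.
- by move=> w u _ -> _ ->; rewrite addr0.
- by move=> c w _ ->; rewrite scaler0.
Qed.

Lemma lspan_seq (s : seq M) v : lspan (fun w => w \in s) v ->
  exists c : 'I_(size s) -> k, v = \sum_i c i *: s`_i.
Proof.
elim=> [w ws||w u _ [c ->] _ [d ->]|x w _ [c ->]].
- have ws' : (index w s < size s)%N by rewrite index_mem.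
  exists (fun i => (i == Ordinal ws')%:R).
  rewrite (bigD1 (Ordinal ws')) //= eqxx scale1r nth_index // big1 ?addr0 //.
  by move=> i /negPf ->; rewrite scale0r.
- by exists (fun=> 0); rewrite big1 // => i _; rewrite scale0r.
- exists (fun i => c i + d i); rewrite -big_split; apply: eq_bigr => i _.
  by rewrite scalerDl.
- exists (fun i => x * c i); rewrite scaler_sumr; apply: eq_bigr => i _.
  by rewrite scalerA.
Qed.
End Span.

Section SlModule.
Variables (k : fieldType) (k0 : [pchar k] =i pred0) (n : nat).
Variables (M : lmodType k) (a : lie_module (@sl_br k n) M).
Local Notation I := 'I_n.+1.

Fact slE_subproof (i j : I) :
  @sl_pred k n (delta_mx i j - ((i == j)%:R / n.+1%:R)%:M).
Proof.
rewrite /sl_pred raddfB /= mxtrace_scalar -[X in _ - X]mulr_natr mulfVK ?(natS_neq0 n k0) //.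
rewrite /mxtrace (bigD1 i) //= mxE eqxx big1 ?addr0 ?subrr // => l li.
by rewrite mxE (negPf li).
Qed.
(* The image of the matrix unit E_ij under the projection gl -> sl. *)
Definition slE (i j : I) : sl k n := Sl (slE_subproof i j).

Lemma mx_comm_scalar (A B : 'M[k]_n.+1) (c d : k) :
  (A - c%:M) *m (B - d%:M) - (B - d%:M) *m (A - c%:M) = A *m B - B *m A.
Proof.
rewrite mulmxBl [(B - _) *m (A - _)]mulmxBr scalar_mxC opprB addrA subrK.
by rewrite mulmxBl mulmxBr scalar_mxC opprB addrA subrK.
Qed.

Lemma slE_br i j i' j' : sl_br (slE i j) (slE i' j') =
  (j == i')%:R *: slE i j' - (j' == i)%:R *: slE i' j.
Proof.
apply: val_inj; rewrite raddfB /= !linearZ /= mx_comm_scalar !mul_delta_mx_cond.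
have S : (j == i')%:R *: ((i == j')%:R / n.+1%:R)%:M =
    (j' == i)%:R *: ((i' == j)%:R / n.+1%:R)%:M :> 'M[k]_n.+1.
  rewrite !scale_scalar_mx (eq_sym i) (eq_sym i'); congr (_ %:M).
  by rewrite mulrCA.
by rewrite scalerN !scalerBr S opprB addrA subrK !scaler_nat.
Qed.

Lemma sl_sum (x : sl k n) :
  x = \sum_i \sum_j sl_mx x i j *: slE i j.
Proof.
have valZ c (y : sl k n) : sl_mx (c *: y) = c *: sl_mx y by [].
apply: val_inj; transitivity (\sum_i \sum_j sl_mx x i j *: sl_mx (slE i j)); last first.
  rewrite raddf_sum; apply: eq_bigr => i _; rewrite raddf_sum.
  by apply: eq_bigr => j _; rewrite -valZ.
rewrite [LHS](matrix_sum_delta (sl_mx x)).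
under [RHS]eq_bigr => i _ do under eq_bigr => j _ do rewrite scalerBr.
under [RHS]eq_bigr => i _ do rewrite sumrB.
rewrite sumrB [X in _ - X](_ : _ = 0) ?subr0 //.
have -> : \sum_i \sum_j sl_mx x i j *: ((i == j)%:R / n.+1%:R)%:M =
    (\tr (sl_mx x) / n.+1%:R)%:M :> 'M[k]_n.+1.
  rewrite /mxtrace mulr_suml raddf_sum /=; apply: eq_bigr => i _.
  rewrite (bigD1 i) //= eqxx big1 ?addr0 => [|j /negPf ji].
    by rewrite scale_scalar_mx mul1r.
  by rewrite eq_sym ji mul0r raddf0 scaler0.
by case: x => x /= /eqP ->; rewrite mul0r raddf0.
Qed.

Definition lactl (v : M) : sl k n -> M := fun x => a x v.
HB.instance Definition _ v := GRing.isLinear.Build k (sl k n) M *:%R (lactl v)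
  (lact_linl a v).

Definition eop (i j : I) : M -> M := a (slE i j).
HB.instance Definition _ i j := GRing.isLinear.Build k M M *:%R (eop i j)
  (lact_linr a (slE i j)).
Definition eL i j : {linear M -> M} := eop i j.

Lemma eLC i j i' j' v : eL i j (eL i' j' v) =
  eL i' j' (eL i j v) + (j == i')%:R *: eL i j' v - (j' == i)%:R *: eL i' j v.
Proof.
have := lact_br a (slE i j) (slE i' j') v; rewrite slE_br.
rewrite -[a (_ - _) v]/(lactl v _) linearB !linearZ => h.
by rewrite -addrA [X in _ + X]h addrC subrK.
Qed.

Local Notation wv := (weight_vec eL).

Lemma lact_sum x v : a x v = \sum_i \sum_j sl_mx x i j *: eL i j v.
Proof.
rewrite -[LHS]/(lactl v x) {1}(sl_sum x) linear_sum; apply: eq_bigr => i _.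
by rewrite linear_sum; apply: eq_bigr => j _; rewrite linearZ.
Qed.

(** The diagonal of [x] has trace zero, so it acts through the differences [e i i - e j j], whose
    eigenvalues are given by [p]; [ord0] is the reference index. *)
Lemma lact_expand p x v : wv p v ->
  a x v = \sum_i \sum_(j | j != i) sl_mx x i j *: eL i j v +
    (\sum_i sl_mx x i i * p i) *: v.
Proof.
move=> pv; rewrite lact_sum.
under eq_bigr => i _ do rewrite (bigD1 i) //= addrC.
rewrite big_split /=; congr (_ + _).
transitivity (\sum_i (sl_mx x i i * (p i - p ord0)) *: v +
    \sum_i sl_mx x i i *: eL ord0 ord0 v).
  rewrite -big_split; apply: eq_bigr => i _ /=.
  by rewrite -scalerA -pv -scalerDr subrK.
have x0 : \sum_i sl_mx x i i = 0 by case: x => x /= /eqP.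
rewrite -!scaler_suml x0 scale0r addr0; congr (_ *: _).
transitivity (\sum_i sl_mx x i i * p i - (\sum_i sl_mx x i i) * p ord0).
  by rewrite mulr_suml -sumrB; apply: eq_bigr => i _; rewrite mulrBr.
by rewrite x0 mul0r subr0.
Qed.

Lemma lact_cartan p (h : cartan k n) v : wv p v ->
  a h v = (\sum_i sl_mx h i i * p i) *: v.
Proof.
move=> pv; rewrite (lact_expand _ pv) big1 ?add0r // => i _.
rewrite big1 // => j ji; case: h => h /= /is_diag_mxP -> ; first by rewrite scale0r.
by rewrite eq_sym.
Qed.

Definition mu_of (p : I -> k) (h : cartan k n) : k^o := \sum_i sl_mx h i i * p i.
Fact mu_of_linear p : linear (mu_of p).
Proof.
move=> c h h'; rewrite /mu_of scaler_sumr -big_split; apply: eq_bigr => i _ /=.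
by rewrite !mxE mulrDl -mulrA.
Qed.
HB.instance Definition _ p :=
  GRing.isLinear.Build k (cartan k n) k^o *:%R (mu_of p) (mu_of_linear p).

Lemma weight_space_mu p v : wv p v -> weight_space a (mu_of p) v.
Proof. by move=> pv h; apply: lact_cartan. Qed.

Fact slE_diag i : slE i i \in @h_pred k n.
Proof.
apply/is_diag_mxP => l m; rewrite val_eqE => lm.
rewrite !mxE (negPf lm) mulr0n subr0; case: (l =P i) lm => //= ->.
by rewrite eq_sym => /negPf ->.
Qed.

Lemma weight_space_wv mu v : weight_space a mu v ->
  exists p, wv p v.
Proof.
move=> muv; exists (fun i => mu (Cartan (slE_diag i))) => i j.
by rewrite scalerBl -!muv.
Qed.

Section Dim1.
Hypothesis pointed : completely_pointed a.

Lemma wv_dim1 p v w : wv p v -> v != 0 -> wv p w -> exists c, w = c *: v.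
Proof.
move=> pv v0 pw; have [b hb] := pointed.2 (mu_of p).
have [c vE] := hb _ (weight_space_mu pv); have [d wE] := hb _ (weight_space_mu pw).
have c0 : c != 0 by apply: contraNneq v0 => c0; rewrite vE c0 scale0r.
by exists (d / c); rewrite vE wE scalerA mulfVK.
Qed.

Lemma wv_span v : lspan (fun w => exists p, wv p w) v.
Proof.
have [m [mu [w [hw ->]]]] := pointed.1.1 v; apply: lspan_sum => j _.
exact/lspan_in/weight_space_wv/hw.
Qed.
End Dim1.

Lemma lact0 x : a x 0 = 0.
Proof. by have := lact_linr a x (-1) 0 0; rewrite scaler0 addr0 scaleN1r addNr. Qed.

Section Simple.
Hypothesis simp : simple_module a.

Lemma nonzero_wv : completely_pointed a -> exists p v, wv p v /\ v != 0.
Proof.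
move=> pt; apply: contrapT => h; have [v []] := simp.1.
elim: (wv_span pt v) => [w [p pw]||? ? _ -> _ ->|? ? _ ->].
- by apply/eqP/negPn/negP => w0; apply: h; exists p, w.
- by [].
- by rewrite addr0.
- by rewrite scaler0.
Qed.

(** The span of [S] is a submodule: diagonal elements scale weight vectors, and stability under
    off-diagonal operators is assumed. *)
Lemma span_all (S : M -> Prop) v :
  (forall w, S w -> exists p, wv p w) ->
  (forall w i j, i != j -> S w -> lspan S (eL i j w)) ->
  S v -> v != 0 -> forall w, lspan S w.
Proof.
move=> Swv Se Sv v0; have [] := simp.2 (lspan S).
- split=> [|w u|c w|x w Sw]; [exact: lspan0|exact: lspanD|exact: lspanZ|].
  apply: (lspan_map (lact_linr a x) Sw) => u Su.
  have [p pu] := Swv u Su; rewrite (lact_expand x pu); apply: lspanD.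
    apply: lspan_sum => i _; apply: lspan_sum => j ji; apply/lspanZ/Se => //.
    by rewrite eq_sym.
  exact/lspanZ/lspan_in.
- by move/(_ v (lspan_in Sv)) => h; rewrite h eqxx in v0.
- by [].
Qed.

(** The vectors killed by some power of [E] form a submodule because ad(E_ij) is nilpotent. By
    simplicity it is zero, and [E] is injective, or it is all of [M]. *)
Lemma nil_or_inj i j : i != j ->
  (forall v, eL i j v = 0 -> v = 0) \/ (forall v, exists m, iter m (eL i j) v = 0).
Proof.
move=> ij; set E := eL i j; pose N v := exists m, iter m E v = 0.
have NS m m' v : (m <= m')%N -> iter m E v = 0 -> iter m' E v = 0.
  move=> /subnK <- h; rewrite iterD h.
  by elim: (m' - m)%N => //= q ->; apply: linear0.
have iterDr m v w : iter m E (v + w) = iter m E v + iter m E w.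
  by elim: m => //= m ->; apply: linearD.
have iterZr m c v : iter m E (c *: v) = c *: iter m E v.
  by elim: m => //= m ->; apply: linearZ.
have N0 : N 0 by exists 0%N.
have ND v w : N v -> N w -> N (v + w).
  move=> [m hm] [m' hm']; exists (maxn m m'); rewrite iterDr.
  by rewrite (NS _ _ _ (leq_maxl m m') hm) (NS _ _ _ (leq_maxr m m') hm') addr0.
(* By induction on the order of nilpotency, using [E x v = x E v + [E, x] v]: stability of [N] under
   [[E, x]] gives stability under [x]. *)
have ad x : (forall v, N v -> N (a (sl_br (slE i j) x) v)) ->
    forall v, N v -> N (a x v).
  move=> h v [m]; elim: m v => [|m IH] v; first by move=> /= ->; rewrite lact0.
  rewrite iterSr => /[dup] hm /IH [q hq].
  have : N (E (a x v)).
    have -> : E (a x v) = a x (E v) + a (sl_br (slE i j) x) v.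
      by rewrite lact_br addrC subrK.
    by apply: ND; [exists q|apply: h; exists m.+1; rewrite iterSr].
  by case=> r hr; exists r.+1; rewrite iterSr.
have [||] := simp.2 N.
- split=> // [c v [m hm]|x]; first by exists m; rewrite iterZr hm scaler0.
  (* Three steps suffice: each term of the cube of ad(E_ij) contains the square of E_ij, which is
     zero. *)
  do 3 apply: (ad); move=> v _; rewrite (_ : sl_br _ _ = 0).
    by rewrite -[a 0 v]/(lactl v 0) linear0.
  apply: val_inj => /=; rewrite (negPf ij) mul0r raddf0 subr0.
  have dd : delta_mx i j *m delta_mx i j = 0 :> 'M[k]_n.+1.
    by rewrite mul_delta_mx_cond eq_sym (negPf ij).
  rewrite !(mulmxBr, mulmxBl) !mulmxA !dd !(mul0mx, mulmx0, sub0r, subr0, oppr0).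
  rewrite -!(mulmxA _ (delta_mx i j) (delta_mx i j)) !dd.
  by rewrite !(mul0mx, mulmx0, sub0r, subr0, oppr0).
- by move=> h; left=> v Ev; apply: h; exists 1%N.
- by move=> h; right.
Qed.

(* Words in the off-diagonal e_ij applied to a weight vector: as in the PBW
   theorem, permuting letters changes a word by shorter words only, the diagonal
   e_ii acting by scalars. *)
Section Words.
Variables (p0 : I -> k) (v0 : M) (pv0 : wv p0 v0).

Definition wop (w : seq (I * I)) : M := foldr (fun l => eL l.1 l.2) v0 w.
Definition letter (l : I * I) := l.1 != l.2.
Definition wspan m := lspan (fun x =>
  exists w, [/\ all letter w, (size w <= m)%N & x = wop w]).

Lemma wop_wv w : exists p, wv p (wop w).
Proof.
elim: w => [|l w [p pw]]; first by exists p0.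
by exists (wshift p l.1 l.2); apply: (weight_vec_e eLC).
Qed.

Lemma wop_wspan w m : all letter w -> (size w <= m)%N -> wspan m (wop w).
Proof. by move=> hw wm; apply: lspan_in; exists w. Qed.

Lemma wspan_cons l m x : letter l -> wspan m x -> wspan m.+1 (eL l.1 l.2 x).
Proof.
move=> hl hx; apply: (lspan_map _ hx) => [|y [w [hw wm ->]]]; first exact: linearP.
by apply: (@wop_wspan (l :: w)) => //=; rewrite hl.
Qed.

(** Moving [l] past one letter costs a commutator, which is zero, an off-diagonal operator up to
    sign, or a diagonal difference acting by a scalar. Each contributes words shorter than the
    original one. *)
Lemma wop_swap s1 l s2 : all letter (s1 ++ l :: s2) ->
  wspan (size s1 + size s2) (wop (s1 ++ l :: s2) - wop (l :: s1 ++ s2)).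
Proof.
elim: s1 => [|x s1 IH] /=; first by move=> _; rewrite subrr; apply: lspan0.
case/andP => hx hs; have {}IH := IH hs; rewrite addSn.
have [hs1 hl hs2] : [/\ all letter s1, letter l & all letter s2].
  by move: hs; rewrite all_cat /= => /and3P.
have hs12 : all letter (s1 ++ s2) by rewrite all_cat hs1.
have sz : (size (s1 ++ s2) <= size s1 + size s2)%N by rewrite size_cat.
set m := wop (s1 ++ s2) in IH *.
rewrite -(subrKA (eL x.1 x.2 (eL l.1 l.2 m))); apply: lspanD.
  rewrite -linearB; exact: wspan_cons.
case: x hx => i j /= hx; case: l hl {hs IH} => i' j' /= hl.
rewrite eLC -[in X in X - _]addrA addrAC subrr add0r.
have mcons i1 i2 : i1 != i2 -> wspan (size s1 + size s2).+1 (eL i1 i2 m).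
  by move=> i12; apply: (@wspan_cons (i1, i2)) => //; apply: wop_wspan.
have [<-|ji'] := eqVneq j i'; have [->|j'i] := eqVneq j' i;
  rewrite ?scale1r ?scale0r ?sub0r ?subr0.
- have [p pm] := wop_wv (s1 ++ s2); rewrite pm; apply/lspanZ/wop_wspan => //.
  exact: leq_trans sz _.
- by apply: mcons; rewrite eq_sym.
- by apply/lspanN/mcons; rewrite eq_sym.
- by rewrite oppr0; apply: lspan0.
Qed.

Lemma wop_perm w w' : all letter w -> perm_eq w w' ->
  wspan (size w).-1 (wop w - wop w').
Proof.
elim: w' w => [|x t IH] w hw; first by move=> /perm_nilP ->; rewrite subrr; apply: lspan0.
move=> wxt; have xw : x \in w by rewrite (perm_mem wxt) mem_head.
case/splitPr: xw hw wxt => s1 s2 hw wxt.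
have [hs1 hl hs2] : [/\ all letter s1, letter x & all letter s2].
  by move: hw; rewrite all_cat /= => /and3P.
have hs12 : all letter (s1 ++ s2) by rewrite all_cat hs1.
have {wxt}st : perm_eq (s1 ++ s2) t.
  by move: wxt; rewrite -[x :: s2]/([:: x] ++ s2) perm_catCA /= perm_cons.
rewrite size_cat /= addnS /= -(subrKA (wop (x :: s1 ++ s2))).
apply: lspanD; first exact: wop_swap.
rewrite /= -linearB.
have := IH _ hs12 st; case: (s1 ++ s2) (size_cat s1 s2) st => /= [_|y s <-] st.
  by move: st; rewrite perm_sym => /perm_nilP -> _; rewrite subrr linear0; apply: lspan0.
exact: wspan_cons.
Qed.

(** The PBW-ordered form of [w] when [ls] lists its letters. *)
Fixpoint sort_word (ls w : seq (I * I)) : seq (I * I) :=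
  if ls is l :: ls' then nseq (count_mem l w) l ++ sort_word ls' w else [::].

Lemma count_sort_word ls w x : uniq ls ->
  count_mem x (sort_word ls w) = if x \in ls then count_mem x w else 0%N.
Proof.
elim: ls => //= l ls IH /andP[lls /IH {}IH]; rewrite count_cat count_nseq IH /=.
rewrite inE [x == l]eq_sym; have [<-|] := eqVneq l x; rewrite ?mul0n //=.
by rewrite (negPf lls) mul1n addn0.
Qed.

Lemma perm_sort_word ls w : uniq ls -> {subset w <= ls} -> perm_eq w (sort_word ls w).
Proof.
move=> uls sub; apply/allP => x _ /=; rewrite count_sort_word //.
have [//|xls] := boolP (x \in ls); rewrite (count_memPn _) //.
by apply: contra xls; apply: sub.
Qed.

Lemma wop_nseq c l w : wop (nseq c l ++ w) = iter c (eL l.1 l.2) (wop w).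
Proof. by elim: c => //= c ->. Qed.

Hypothesis nil : forall i j, i != j -> forall v, exists m, iter m (eL i j) v = 0.

(** An ordered word is a power of the first letter applied to an ordered word in the others.
    Finitely many vectors span the latter, so one exponent [K] kills them all and only powers below
    [K] matter. *)
Lemma sort_word_fin ls : all letter ls ->
  exists s : seq M, forall w, lspan (fun x => x \in s) (wop (sort_word ls w)).
Proof.
elim: ls => [_|l ls IH /andP[hl /IH [s hs]]].
  by exists [:: v0] => w; apply: lspan_in; rewrite mem_head.
set E := eL l.1 l.2.
have E0 m : iter m E 0 = 0 by elim: m => //= m ->; apply: linear0.
have iterL m : linear (iter m E).
  by move=> c x y; elim: m => //= m ->; apply: linearP.
have [K hK] : exists K, forall x, x \in s -> iter K E x = 0.
  elim: s {hs} => [|x s [K hK]]; first by exists 0%N.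
  have [m hm] := nil hl x; exists (K + m)%N => y; rewrite inE => /predU1P[->|ys].
    by rewrite iterD hm E0.
  by rewrite addnC iterD hK.
exists [seq iter c E x | x <- s, c <- iota 0 K] => w /=.
rewrite wop_nseq -/E; apply: (lspan_map (iterL _) (hs w)) => x xs.
set c := count_mem l w; have [cK|cK] := ltnP c K.
  by apply: lspan_in; apply/allpairsP; exists (x, c); rewrite mem_iota.
by rewrite -(subnK cK) iterD hK // E0; apply: lspan0.
Qed.

(** Sorting a word costs only shorter words, so induction on the length reduces to ordered words. *)
Lemma wop_fin : exists s : seq M, forall w, all letter w ->
  lspan (fun x => x \in s) (wop w).
Proof.
pose ls := [seq l <- enum {: I * I} | letter l].
have uls : uniq ls by rewrite filter_uniq // enum_uniq.
have [s hs] := sort_word_fin (filter_all _ _ : all letter ls).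
exists s => w; move: {2}(size w) (leqnn (size w)) => m.
elim: m w => [|m IH] w wm hw.
  rewrite leqn0 size_eq0 in wm; rewrite (eqP wm).
  have := @perm_sort_word ls [::] uls; rewrite perm_sym => /(_ _) /perm_nilP.
  by move=> h; have := hs [::]; rewrite h.
have wls : {subset w <= ls}.
  by move=> l lw; rewrite mem_filter mem_enum andbT; apply: (allP hw).
rewrite -(subrK (wop (sort_word ls w)) (wop w)); apply: lspanD (hs w).
apply: lspan_bind (wop_perm hw (perm_sort_word uls wls)) _ => x [w' [hw' w'm ->]].
by apply: IH => //; apply: leq_trans w'm _; rewrite -ltnS; case: (size w) wm.
Qed.

Lemma fin_dim_of_nil : v0 != 0 -> ~ infinite_dim M.
Proof.
move=> v0n; have [s hs] := wop_fin; apply; exists (size s), (fun i => s`_i) => v.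
apply: lspan_seq.
have := @span_all (fun x => exists2 w, all letter w & x = wop w) v0 _ _ _ v0n v.
move/(_ _ _ _)/lspan_bind; apply.
- by move=> _ [w _ ->]; apply: wop_wv.
- move=> _ i j ij [w hw ->]; apply: lspan_in; exists ((i, j) :: w) => //=.
  by rewrite hw andbT.
- by exists [::].
- by move=> _ [w hw ->]; apply: hs.
Qed.
End Words.

Lemma ex_inj : completely_pointed a -> infinite_dim M ->
  exists i j, i != j /\ forall v, eL i j v = 0 -> v = 0.
Proof.
move=> pt inf; apply: contrapT => h; have [p [v [pv v0]]] := nonzero_wv pt.
apply: (fin_dim_of_nil pv _ v0 inf) => i j ij; have [hi|//] := nil_or_inj ij.
by case: h; exists i, j.
Qed.
End Simple.
End SlModule.

(** This interface joins the general case to that of two indices, where no third index is available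
    for the normalisation. *)
Record good_family (k : fieldType) (k0 : [pchar k] =i pred0) (n : nat)
    (M : lmodType k) (a : lie_module (@sl_br k n) M)
    (G : ('I_n.+1 -> k) -> M -> Prop) : Prop := GoodFamily {
  gf_wv : forall p v, G p v -> weight_vec (eL k0 a) p v;
  gf_neq0 : forall p v, G p v -> v != 0;
  gf_prod : forall p v i j, i != j -> G p v ->
    eL k0 a j i (eL k0 a i j v) = (p i * (p j - 1)) *: v;
  gf_e : forall p v i j, i != j -> G p v -> eL k0 a i j v != 0 ->
    G (wshift p i j) (eL k0 a i j v);
  gf_ex : exists p v, G p v
}.

Lemma monic_quadratic_root (k : closedFieldType) (b c : k) :
  exists x, x * x = b * x + c.
Proof.
have [x] := solve_monicpoly (fun i => if i == 0%N then c else b) (isT : (0 < 2)%N).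
rewrite !big_ord_recl big_ord0 /= expr2 expr0 mulr1 expr1 addr0 => h.
by exists x; rewrite h addrC.
Qed.

Theorem good_family_ex (k : closedFieldType) (k0 : [pchar k] =i pred0) (n : nat)
    (M : lmodType k) (a : lie_module (@sl_br k n) M) (i j : 'I_n.+1) :
  simple_module a -> completely_pointed a -> i != j ->
  (forall v, eL k0 a i j v = 0 -> v = 0) ->
  exists G, good_family k0 a G.
Proof.
move=> simp pt ij inj; have [p [v [pv v0]]] := nonzero_wv k0 simp pt.
have eC := eLC k0 a; have d1 := wv_dim1 (k0 := k0) pt.
have [[c [ci cj]]|no] := pselect (exists c, c != i /\ c != j).
  exists (good (eL k0 a) i j); split.
  - by move=> q w [].
  - by move=> q w [].
  - by move=> q w i' j' ij' g; apply: (good_prod k0 eC d1 ij inj ci cj).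
  - by move=> q w i' j' ij' g; apply: (good_e k0 eC d1 ij inj ci cj).
  - have [t ht] := good_ex eC d1 ij inj ci cj pv v0.
    by exists (fun l => p l + t), v.
have two c : c = i \/ c = j.
  apply: contrapT => h; apply: no; exists c.
  by split; apply/eqP => cE; apply: h; [left|right].
have two_pair i' j' : i' != j' -> (i' = i /\ j' = j) \/ (i' = j /\ j' = i).
  by case: (two i') (two j') => -> [] ->; rewrite ?eqxx //; [left|right].
exists (fun q w => [/\ weight_vec (eL k0 a) q w, w != 0 & forall i' j', i' != j' ->
  eL k0 a j' i' (eL k0 a i' j' w) = (q i' * (q j' - 1)) *: w]); split.
- by move=> q w [].
- by move=> q w [].
- by move=> q w i' j' ij' [_ _]; apply.
- move=> q w i' j' ij' [qw w0 hw] w0'; have qw' := weight_vec_e eC i' j' qw.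
  have h : eL k0 a j' i' (eL k0 a i' j' (eL k0 a i' j' w)) =
      (wshift q i' j' i' * (wshift q i' j' j' - 1)) *: eL k0 a i' j' w.
    rewrite (prod_shift eC ij' qw (hw _ _ ij')) wshiftl // wshiftr //.
    by congr (_ *: _); ring.
  split=> // i'' j'' ij''.
  have [[-> ->]|[-> ->]] : (i'' = i' /\ j'' = j') \/ (i'' = j' /\ j'' = i').
    by case: (two_pair _ _ ij') (two_pair _ _ ij'') => -[-> ->] [] [-> ->]; auto.
  - by [].
  - exact: prod_sym.
have [P hP] := prod_scalar_ex eC d1 i j pv.
(* With two indices the constant is fixed by the product formula itself: [t] solves
   [(p i + t) * (p j + t - 1) = P], which is where algebraic closedness enters. *)
have [t ht] := monic_quadratic_root (1 - p i - p j) (P - p i * (p j - 1)).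
exists (fun l => p l + t), v; have ptv := weight_vecD t pv; split=> // i' j' ij'.
have h : eL k0 a j i (eL k0 a i j v) = ((p i + t) * (p j + t - 1)) *: v.
  rewrite hP; congr (_ *: _).
  transitivity (t * t - ((1 - p i - p j) * t + (P - p i * (p j - 1))) + P).
    by rewrite ht subrr add0r.
  by ring.
by have [[-> ->]|[-> ->]] := two_pair _ _ ij'; [|apply: (prod_sym eC ptv)].
Qed.

(** * Words in the TGW construction *)

Section TgwWords.
Variables (k : fieldType) (R : algType k) (I : finType) (D : tgw_datum R I).
Local Notation C := (tgwc D).
Local Notation cst := (tgwc_cst D).
Local Notation X := (tgwc_X D).
Local Notation Y := (tgwc_Y D).
Local Notation ZI := {ffun I -> int}.

Lemma tgwcX i r : X i * cst r = cst (tgw_sigma D i r) * X i.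
Proof.
by rewrite /tgwc_cst /tgwc_X /= -!rmorphM; apply/quo_piP/ideal_gen_in/tgwc_relX.
Qed.
Lemma tgwcY i r : Y i * cst r = cst (tgw_sigmaV D i r) * Y i.
Proof.
by rewrite /tgwc_cst /tgwc_Y /= -!rmorphM; apply/quo_piP/ideal_gen_in/tgwc_relY.
Qed.
Lemma tgwcYX i : Y i * X i = cst (tgw_t D i).
Proof.
by rewrite /tgwc_cst /tgwc_X /tgwc_Y /= -!rmorphM; apply/quo_piP/ideal_gen_in/tgwc_relYX.
Qed.
Lemma tgwcXY i : X i * Y i = cst (tgw_sigma D i (tgw_t D i)).
Proof.
by rewrite /tgwc_cst /tgwc_X /tgwc_Y /= -!rmorphM; apply/quo_piP/ideal_gen_in/tgwc_relXY.
Qed.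
Lemma tgwcXYC i j : i != j -> X i * Y j = Y j * X i.
Proof.
by move=> ij; rewrite /tgwc_X /tgwc_Y -!rmorphM; apply/quo_piP/ideal_gen_in/tgwc_relC.
Qed.

Lemma tgwc_ind (P : C -> Prop) : (forall r, P (cst r)) -> (forall i, P (X i)) ->
  (forall i, P (Y i)) -> (forall x y, P x -> P y -> P (x + y)) ->
  (forall x y, P x -> P y -> P (x * y)) -> forall x, P x.
Proof.
move=> Pc PX PY PD PM; elim/quo_ind; elim/free_ind.
elim=> [r|[i|i]|x Px y Py|x Px|x Px y Py].
- exact: Pc.
- exact: PX.
- exact: PY.
- by rewrite free_piD rmorphD; apply: PD.
- rewrite free_piN rmorphN -mulN1r; apply: PM => //.
  by rewrite -(rmorph1 cst) -rmorphN; apply: Pc.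
- by rewrite free_piM rmorphM; apply: PM.
Qed.

Definition tgen (l : I + I) : C := match l with inl i => X i | inr i => Y i end.
Definition tdeg (l : I + I) : ZI :=
  match l with inl i => zdelta i | inr i => - zdelta i end.
Definition tword (w : seq (I + I)) : C := \prod_(l <- w) tgen l.
Definition twdeg (w : seq (I + I)) : ZI := \sum_(l <- w) tdeg l.

Lemma tword_cst w r : exists r', tword w * cst r = cst r' * tword w.
Proof.
elim: w r => [|l w IH] r; first by exists r; rewrite /tword big_nil mulr1 mul1r.
have [r1 h1] := IH r; rewrite /tword !big_cons -/(tword w).
rewrite -mulrA h1; case: l => i /=; rewrite !mulrA.
  by exists (tgw_sigma D i r1); rewrite tgwcX mulrA.
by exists (tgw_sigmaV D i r1); rewrite tgwcY mulrA.
Qed.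

Inductive word_span (d : ZI) : C -> Prop :=
| word_span_word r w : twdeg w = d -> word_span d (cst r * tword w)
| word_span0 : word_span d 0
| word_spanD x y : word_span d x -> word_span d y -> word_span d (x + y).

Lemma word_spanM d e x y : word_span d x -> word_span e y ->
  word_span (d + e) (x * y).
Proof.
move=> + ys; elim=> {x} [r w wd||x x' _ hx _ hx'].
- elim: ys => [r' w' we||z z' _ hz _ hz'].
  + have [r1 h1] := tword_cst w r'.
    rewrite mulrA -(mulrA (cst r)) h1 mulrA -rmorphM -mulrA.
    have -> : tword w * tword w' = tword (w ++ w') by rewrite /tword big_cat.
    by apply: word_span_word; rewrite /twdeg big_cat -/(twdeg w) wd -we.
  + by rewrite mulr0; apply: word_span0.
  + by rewrite mulrDr; apply: word_spanD.
- by rewrite mul0r; apply: word_span0.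
- by rewrite mulrDl; apply: word_spanD.
Qed.

Lemma homog_word_span d x : tgwc_homog d x -> word_span d x.
Proof.
elim=> [r|i|i|e|e y z _ hy _ hz|e f y z _ hy _ hz].
- have := @word_span_word 0 r [::]; rewrite /tword big_nil mulr1; apply.
  by rewrite /twdeg big_nil.
- have := @word_span_word (zdelta i) 1 [:: inl i].
  by rewrite /tword big_seq1 rmorph1 mul1r; apply; rewrite /twdeg big_seq1.
- have := @word_span_word (- zdelta i) 1 [:: inr i].
  by rewrite /tword big_seq1 rmorph1 mul1r; apply; rewrite /twdeg big_seq1.
- exact: word_span0.
- exact: word_spanD.
- exact: word_spanM.
Qed.

(** * Normal form of words and the degree zero component *)

Definition Xs (s : seq I) : C := \prod_(i <- s) X i.
Definition Ys (s : seq I) : C := \prod_(i <- s) Y i.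
Definition zsum (s : seq I) : ZI := \sum_(i <- s) zdelta i.

Lemma Xs_cons i s : Xs (i :: s) = X i * Xs s.
Proof. by rewrite /Xs big_cons. Qed.
Lemma Ys_cons i s : Ys (i :: s) = Y i * Ys s.
Proof. by rewrite /Ys big_cons. Qed.
Lemma zsum_cons i s : zsum (i :: s) = zdelta i + zsum s.
Proof. by rewrite /zsum big_cons. Qed.

Lemma zsum_perm s s' : perm_eq s s' -> zsum s = zsum s'.
Proof. by move=> h; rewrite /zsum (perm_big _ h). Qed.

Lemma X_Ys_comm i s : i \notin s -> X i * Ys s = Ys s * X i.
Proof.
elim: s => [|j s IH]; first by rewrite /Ys big_nil mulr1 mul1r.
rewrite inE negb_or => /andP[ij /IH h].
by rewrite Ys_cons mulrA (tgwcXYC ij) -!mulrA h.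
Qed.

(** [X i] commutes past the other letters and is absorbed by the first [Y i] into an element of R,
    which is then moved to the left. *)
Lemma X_Ys i s : i \in s ->
  exists r s', X i * Ys s = cst r * Ys s' /\ perm_eq s (i :: s').
Proof.
elim: s => // j s IH; rewrite inE; have [<- _|ij /= /IH [r [s' [h ss']]]] := eqVneq i j.
  by exists (tgw_sigma D i (tgw_t D i)), s; rewrite Ys_cons mulrA tgwcXY.
exists (tgw_sigmaV D j r), (j :: s').
rewrite !Ys_cons mulrA (tgwcXYC ij) -mulrA h !mulrA tgwcY; split=> //.
rewrite -[i :: _]/([:: i] ++ [:: j] ++ s') perm_sym perm_catCA perm_sym.
by rewrite /= perm_cons.
Qed.

(** Here [X i] moves to the left and meets the last [Y i]. *)
Lemma Ys_X i s : i \in s ->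
  exists r s', Ys s * X i = cst r * Ys s' /\ perm_eq s (i :: s').
Proof.
elim: s => // j s IH; rewrite inE => ijs.
have [/IH [r [s' [h ss']]]|nis] := boolP (i \in s).
  exists (tgw_sigmaV D j r), (j :: s').
  rewrite !Ys_cons -mulrA h !mulrA tgwcY; split=> //.
  rewrite -[i :: _]/([:: i] ++ [:: j] ++ s') perm_sym perm_catCA perm_sym.
  by rewrite /= perm_cons.
have <- : i = j by move: ijs; rewrite (negPf nis) orbF => /eqP.
by exists (tgw_t D i), s; rewrite Ys_cons -mulrA -X_Ys_comm // mulrA tgwcYX.
Qed.

(** The presentation relates neither the X nor the Y among themselves, so the orders in [s] and [s']
    remain arbitrary. *)
Lemma tword_normal w :
  exists r s s', tword w = cst r * Ys s * Xs s' /\ twdeg w = zsum s' - zsum s.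
Proof.
elim: w => [|l w [r [s [s' [h hd]]]]].
  exists 1, [::], [::]; rewrite /tword /twdeg /Ys /Xs /zsum !big_nil.
  by rewrite rmorph1 !mulr1 subr0.
rewrite /tword /twdeg !big_cons -/(tword w) -/(twdeg w) h hd; case: l => i /=.
  have [/X_Ys [r' [t [ht st]]]|nis] := boolP (i \in s).
    exists (tgw_sigma D i r * r'), t, s'; split.
      by rewrite !mulrA tgwcX -!mulrA (mulrA (X i)) ht rmorphM !mulrA.
    by rewrite (zsum_perm st) zsum_cons opprD addrCA addNKr.
  exists (tgw_sigma D i r), s, (i :: s'); split.
    by rewrite !mulrA tgwcX -!mulrA (mulrA (X i)) X_Ys_comm // Xs_cons !mulrA.
  by rewrite zsum_cons addrA.
exists (tgw_sigmaV D i r), (i :: s), s'; split.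
  by rewrite !mulrA tgwcY Ys_cons !mulrA.
by rewrite zsum_cons opprD addrCA.
Qed.

Lemma Ys_Xs s s' : perm_eq s s' -> exists r, Ys s * Xs s' = cst r.
Proof.
elim: s' s => [|i s' IH] s.
  by move/perm_nilP ->; exists 1; rewrite /Ys /Xs !big_nil mulr1 rmorph1.
move=> ss'; have is' : i \in s by rewrite (perm_mem ss') mem_head.
have [r [t [h st]]] := Ys_X is'.
have [r' hr'] : exists r', Ys t * Xs s' = cst r'.
  by apply: IH; rewrite -(perm_cons i) -(permPl st).
by exists (r * r'); rewrite Xs_cons mulrA h -mulrA hr' rmorphM.
Qed.

Lemma zsumE s i : zsum s i = (count_mem i s)%:Z.
Proof.
elim: s => [|j s IH]; first by rewrite /zsum big_nil ffunE.
by rewrite zsum_cons !ffunE IH /= PoszD eq_sym; case: (j == i).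
Qed.

(** In degree zero the Y and the X of the normal form have the same indices with multiplicity, so
    [Ys_Xs] collapses it. *)
Lemma homog0_cst x : tgwc_homog 0 x -> exists r, x = cst r.
Proof.
move/homog_word_span; elim=> [r w w0||y z _ [r ->] _ [r' ->]].
- have [r1 [s [s' [h]]]] := tword_normal w; rewrite w0 => /esym /eqP.
  rewrite subr_eq0 => /eqP ss'; have [|r2 h2] := @Ys_Xs s s'.
    apply/allP => i _ /=; apply/eqP.
    have := congr1 (fun f : ZI => f i) ss'; rewrite !zsumE => -[] //.
  by exists (r * (r1 * r2)); rewrite h -mulrA h2 -!rmorphM.
- by exists 0; rewrite rmorph0.
- by exists (r + r'); rewrite rmorphD.
Qed.

Inductive homog_sum : C -> Prop :=
| homog_sum_in d x : tgwc_homog d x -> homog_sum x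
| homog_sumD x y : homog_sum x -> homog_sum y -> homog_sum (x + y).

Lemma homog_sumP x : homog_sum x.
Proof.
elim/tgwc_ind: x => [r|i|i|x y|x y].
- exact/homog_sum_in/tgwc_homog_cst.
- exact/homog_sum_in/tgwc_homogX.
- exact/homog_sum_in/tgwc_homogY.
- exact: homog_sumD.
move=> + hy; elim=> {x} [d x hx|x x' _ hx _ hx']; last first.
  by rewrite mulrDl; apply: homog_sumD.
elim: hy => {y} [e y hy|y y' _ hy _ hy']; last by rewrite mulrDr; apply: homog_sumD.
exact: homog_sum_in (tgwc_homogM hx hy).
Qed.

(** Existence only; that the degrees separate is seen on the representations below. *)
Lemma homog_decomp x : exists (S : seq ZI) (y : ZI -> C),
  [/\ uniq S, forall d, tgwc_homog d (y d) & x = \sum_(d <- S) y d].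
Proof.
elim: (homog_sumP x) => {x} [d x hx|x x' _ [S [y [uS hy ->]]] _ [S' [y' [uS' hy' ->]]]].
  exists [:: d], (fun e => if e == d then x else 0); split=> // [e|].
    by case: eqP => [->//|_]; apply: tgwc_homog0.
  by rewrite big_seq1 eqxx.
pose T := undup (S ++ S').
have extend (S1 : seq ZI) (z : ZI -> C) : uniq S1 -> {subset S1 <= T} ->
    \sum_(d <- S1) z d = \sum_(d <- T) if d \in S1 then z d else 0.
  move=> u1 sub; rewrite -big_mkcond -big_filter; apply: perm_big.
  apply: uniq_perm => // [|d]; first by rewrite filter_uniq ?undup_uniq.
  rewrite mem_filter; have [/sub ->//|] := boolP (d \in S1); by [].
exists T, (fun d => (if d \in S then y d else 0) + (if d \in S' then y' d else 0)).
split=> [|d|]; first exact: undup_uniq.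
  by apply: tgwc_homogD; case: ifP => // _; apply: tgwc_homog0.
rewrite big_split /= -!extend // => d; rewrite mem_undup mem_cat => -> //.
by rewrite orbT.
Qed.

Lemma homogN d (x : C) : tgwc_homog d x -> tgwc_homog d (- x).
Proof.
move=> hx; rewrite -mulN1r -(rmorph1 cst) -rmorphN -[d]add0r.
by apply: tgwc_homogM => //; apply: tgwc_homog_cst.
Qed.

Lemma homogB d (x y : C) : tgwc_homog d x -> tgwc_homog d y -> tgwc_homog d (x - y).
Proof. by move=> hx /homogN; apply: tgwc_homogD. Qed.

End TgwWords.

(** * The action on skew Laurent polynomials *)

(** The induction behind writing a root vector as an iterated commutator of simple ones, along the
    chain from [i] to [j]. *)
Lemma pair_ind n (P : 'I_n.+1 -> 'I_n.+1 -> Prop) :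
  (forall i : 'I_n, P (ein i) (eout i)) -> (forall i : 'I_n, P (eout i) (ein i)) ->
  (forall i j l, i != j -> j != l -> i != l -> P i j -> P j l -> P i l) ->
  forall i j, i != j -> P i j.
Proof.
move=> Pup Pdn Ptr.
have [up dn] : (forall m (i j : 'I_n.+1), j = (i + m.+1)%N :> nat -> P i j) /\
    (forall m (i j : 'I_n.+1), j = (i + m.+1)%N :> nat -> P j i).
  have adj (i j : 'I_n.+1) : j = i.+1 :> nat ->
      exists t : 'I_n, i = ein t /\ j = eout t.
    move=> ji; have it : (i < n)%N by have := ltn_ord j; rewrite ji.
    by exists (Ordinal it); split; apply: val_inj; rewrite /= ?ji.
  have mid m (i j : 'I_n.+1) : j = (i + m.+2)%N :> nat ->
      exists l : 'I_n.+1, l = (i + m.+1)%N :> nat /\ j = l.+1 :> nat.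
    move=> ji; have lt : (i + m.+1 < n.+1)%N by have := ltn_ord j; lia.
    by exists (Ordinal lt); split=> //=; rewrite ji addnS.
  split; elim=> [|m IH] i j ji.
  - by have [t [-> ->]] := adj i j (etrans ji (addn1 i)).
  - have [l [li jl]] := mid m i j ji; have [t [lt jt]] := adj l j jl.
    apply: (Ptr i l j); rewrite -?val_eqE /=; try lia; first exact: IH.
    by rewrite lt jt.
  - by have [t [-> ->]] := adj i j (etrans ji (addn1 i)).
  - have [l [li jl]] := mid m i j ji; have [t [lt jt]] := adj l j jl.
    apply: (Ptr j l i); rewrite -?val_eqE /=; try lia; last exact: IH.
    by rewrite lt jt.
move=> i j; rewrite -val_eqE neq_ltn /= => /orP[] ij.
  by apply: (up (j - i).-1); lia.
by apply: (dn (i - j).-1); lia.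
Qed.

Section Model.
Variables (k : fieldType) (n : nat).
Local Notation RE := (RE k n).
Local Notation ZV := {ffun 'I_n -> int}.
Implicit Types (d : ZV) (q r : RE).

(* The exponent of x_e when z^d is written as a monomial in the x_e, with
   z_i = x_i / x_(i+1). *)
Definition Dof d (e : 'I_n.+1) : int :=
  \sum_i d i * ((e == ein i)%:R - (e == eout i)%:R).

Lemma DofD d d' e : Dof (d + d') e = Dof d e + Dof d' e.
Proof. by rewrite /Dof -big_split; apply: eq_bigr => i _; rewrite ffunE mulrDl. Qed.
Lemma Dof0 e : Dof 0 e = 0.
Proof. by rewrite /Dof big1 // => i _; rewrite ffunE mul0r. Qed.
Lemma DofN d e : Dof (- d) e = - Dof d e.
Proof. by apply/eqP; rewrite -addr_eq0 -DofD addNr Dof0. Qed.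
Lemma Dof_delta i e : Dof (zdelta i) e = (e == ein i)%:R - (e == eout i)%:R.
Proof.
rewrite /Dof (bigD1 i) //= ffunE eqxx mul1r big1 ?addr0 // => j ji.
by rewrite ffunE (negPf ji) mul0r.
Qed.

Lemma sum_Dof d : \sum_e Dof d e = 0.
Proof.
rewrite exchange_big big1 // => i _; rewrite -mulr_sumr sumrB.
have s (j : 'I_n.+1) : \sum_e (e == j)%:R = 1 :> int.
  by rewrite (bigD1 j) //= eqxx big1 ?addr0 // => e /negPf ->.
by rewrite !s subrr mulr0.
Qed.

(** The value of [Dof d] at edge [m] is [d m] minus [d (m - 1)], so the coordinates vanish one after
    the other. *)
Lemma Dof_inj d : (forall e, Dof d e = 0) -> d = 0.
Proof.
move=> h; apply/ffunP => -[m mn]; rewrite ffunE.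
elim/ltn_ind: m mn => m IH mn.
have := h (ein (Ordinal mn)); rewrite /Dof (bigD1 (Ordinal mn)) //= eqxx.
rewrite eq_sym (negPf (eout_neq_ein _)) subr0 mulr1 big1 ?addr0 // => i im.
have -> : ein (Ordinal mn) == ein i = false.
  by apply/negbTE; apply: contra im; rewrite -!val_eqE eq_sym.
rewrite -val_eqE /= /bump /= add1n; case: eqP => [mi|_]; last by rewrite subr0 mulr0.
have im' : (i < m)%N by rewrite mi.
have -> : i = Ordinal (ltn_ord i) by apply: val_inj.
by rewrite IH ?mul0r.
Qed.

Definition zshift d : RE -> RE :=
  comp_mpoly [tuple 'X_e - ((Dof d e)%:~R)%:MP | e < n.+1].
HB.instance Definition _ d := GRing.LRMorphism.copy (zshift d)
  (comp_mpoly [tuple 'X_e - ((Dof d e)%:~R)%:MP | e < n.+1]).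

Lemma zshiftX d e : zshift d 'X_e = 'X_e - ((Dof d e)%:~R)%:MP.
Proof. by rewrite /zshift /= comp_mpolyXU -tnth_nth tnth_mktuple. Qed.
Lemma zshiftC d c : zshift d c%:MP = c%:MP.
Proof. exact: comp_mpolyC. Qed.

Lemma zshiftD d d' r : zshift d (zshift d' r) = zshift (d + d') r.
Proof.
apply: (mpoly_rmorph_eq (f := zshift d \o zshift d')) => [c|e] /=.
  by rewrite !zshiftC.
rewrite !zshiftX rmorphB /= zshiftC zshiftX DofD.
by rewrite intrD mpolyCD opprD addrA.
Qed.

Lemma zshift0 r : zshift 0 r = r.
Proof.
apply: (mpoly_rmorph_eq (f := zshift 0) (g := idfun)) => [c|e] /=.
  by rewrite zshiftC.
by rewrite zshiftX Dof0 subr0.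
Qed.

Lemma gammaAE (e : 'I_n.+1) (i : 'I_n) :
  gammaA k e i = ((e == ein i)%:R - (e == eout i)%:R : int)%:~R.
Proof.
rewrite /gammaA; have [->|] := eqVneq e (ein i).
  by rewrite eq_sym (negPf (eout_neq_ein i)).
by move=> _; rewrite sub0r rmorphN; case: eqP; rewrite ?oppr0.
Qed.

Lemma sigmaAE i r : tgw_sigma (datumA k n) i r = zshift (zdelta i) r.
Proof.
apply: (mpoly_rmorph_eq (f := sigmaA k i) (g := zshift (zdelta i))) => [c|e] /=.
  by rewrite zshiftC shiftAC.
by rewrite zshiftX shiftAX mul1r gammaAE Dof_delta.
Qed.

Lemma sigmaVAE i r : tgw_sigmaV (datumA k n) i r = zshift (- zdelta i) r.
Proof.
apply: (mpoly_rmorph_eq (f := sigmaVA k i) (g := zshift (- zdelta i))) => [c|e] /=.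
  by rewrite zshiftC shiftAC.
by rewrite zshiftX shiftAX mulN1r gammaAE DofN Dof_delta mulrNz.
Qed.

Local Notation FM := (ZV -> RE).

Fact oq_linear q d : linear (fun (g : FM) => (fun e => q * zshift d (g (e - d))) : FM).
Proof.
move=> c g h; apply: funext => e.
rewrite -[(c *: g + h) _]/(c *: g (e - d) + h (e - d)) linearP mulrDr.
by rewrite -scalerAr.
Qed.
(* Left multiplication by [q z^d] on the skew Laurent polynomials over [RE],
   with [z^d r = zshift d r z^d]; elements of [FM] are families of
   coefficients. *)
Definition oq q d : lend FM := mk_lend (oq_linear q d).

Lemma oqM q d q' d' : oq q d * oq q' d' = oq (q * zshift d q') (d + d').
Proof.
apply: lendP => g; apply: funext => e.
rewrite -[LHS]/(q * zshift d (q' * zshift d' (g (e - d - d')))).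
rewrite -[RHS]/(q * zshift d q' * zshift (d + d') (g (e - (d + d')))).
by rewrite rmorphM /= zshiftD mulrA opprD addrA.
Qed.

Lemma oqD q q' d : oq (q + q') d = oq q d + oq q' d.
Proof. by apply: lendP => g; apply: funext => e; apply: mulrDl. Qed.
Lemma oqB q q' d : oq (q - q') d = oq q d - oq q' d.
Proof.
by apply: lendP => g; apply: funext => e; apply: mulrBl.
Qed.
Lemma oq0 d : oq 0 d = 0.
Proof. by apply: lendP => g; apply: funext => e; apply: mul0r. Qed.

Definition oqc r : lend FM := oq r 0.
Fact oqc_zmod : zmod_morphism oqc.
Proof. by move=> r q; apply: oqB. Qed.
HB.instance Definition _ := GRing.isZmodMorphism.Build RE (lend FM) oqc oqc_zmod.
Fact oqc_monoid : monoid_morphism oqc.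
Proof.
split=> [|r q]; last by rewrite /oqc oqM zshift0 addr0.
apply: lendP => g; apply: funext => e.
by rewrite -[LHS]/(1 * zshift 0 (g (e - 0))) zshift0 mul1r subr0.
Qed.
HB.instance Definition _ := GRing.isMonoidMorphism.Build RE (lend FM) oqc oqc_monoid.

Definition oq_gen (l : 'I_n + 'I_n) : lend FM :=
  match l with
  | inl i => oq 'X_(eout i) (zdelta i)
  | inr i => oq 'X_(ein i) (- zdelta i)
  end.

Lemma eoutein_eq (i : 'I_n) : (eout i == ein i) = false.
Proof. exact/negbTE/eout_neq_ein. Qed.
Lemma einout_eq (i : 'I_n) : (ein i == eout i) = false.
Proof. by rewrite eq_sym eoutein_eq. Qed.
Lemma ein_eq (i j : 'I_n) : (ein i == ein j) = (i == j).
Proof. by rewrite -!val_eqE. Qed.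
Lemma eout_eq (i j : 'I_n) : (eout i == eout j) = (i == j).
Proof. by rewrite -!val_eqE /= /bump /= !add1n eqSS. Qed.

Fact repF_rel x : tgwc_rel (datumA k n) x -> free_lift oqc oq_gen x = 0.
Proof.
pose L : {rmorphism _ -> lend FM} := free_lift oqc oq_gen.
rewrite -[free_lift _ _ x]/(L x).
have LX i : L (free_gen (inl i)) = oq 'X_(eout i) (zdelta i).
  exact: free_lift_gen.
have LY i : L (free_gen (inr i)) = oq 'X_(ein i) (- zdelta i).
  exact: free_lift_gen.
have Lc r : L (free_cst r) = oq r 0 by exact: free_lift_cst.
have oqE q q' d d' : q = q' -> d = d' -> oq q d - oq q' d' = 0.
  by move=> -> ->; rewrite subrr.
case=> [i r|i r|i|i|i j ij]; rewrite (rmorphB L) !(rmorphM L).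
- rewrite LX !Lc !oqM; apply: oqE; last by rewrite addr0 add0r.
  by rewrite zshift0 -sigmaAE mulrC.
- rewrite LY !Lc !oqM; apply: oqE; last by rewrite addr0 add0r.
  by rewrite zshift0 -sigmaVAE mulrC.
- rewrite LX LY Lc oqM; apply: oqE; last by rewrite addNr.
  rewrite zshiftX DofN Dof_delta eqxx eoutein_eq sub0r opprK.
  by rewrite mulr1z mpolyC1.
- rewrite LX LY Lc oqM; apply: oqE; last by rewrite addrN.
  rewrite sigmaAE /= /tA rmorphM rmorphB rmorph1 /= !zshiftX !Dof_delta !eqxx.
  rewrite einout_eq eoutein_eq sub0r subr0 mulrNz mulr1z mpolyCN opprK.
  by rewrite mpolyC1 addrK mulrC.
- rewrite LX LY !oqM; apply: oqE; last by rewrite addrC.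
  rewrite !zshiftX DofN !Dof_delta ein_eq eout_eq (negPf ij) [j == i]eq_sym (negPf ij).
  rewrite sub0r subr0 [ein j == _]eq_sym; have [->|_] := eqVneq (eout i) (ein j).
    by [].
  by rewrite (_ : (1 *- false)%:~R = 0 :> k) // mpolyC0 !subr0 mulrC.
Qed.

Definition repF : tgwc (datumA k n) -> lend FM := quo_lift (@repF_rel).
HB.instance Definition _ := GRing.RMorphism.copy repF (quo_lift (@repF_rel)).

Lemma repF_cst r : repF (tgwc_cst _ r) = oq r 0.
Proof. by apply: (etrans (quo_liftE _ _)); rewrite /= free_lift_cst. Qed.
Lemma repF_X i : repF (tgwc_X _ i) = oq 'X_(eout i) (zdelta i).
Proof. by apply: (etrans (quo_liftE _ _)); rewrite /= free_lift_gen. Qed.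
Lemma repF_Y i : repF (tgwc_Y _ i) = oq 'X_(ein i) (- zdelta i).
Proof. by apply: (etrans (quo_liftE _ _)); rewrite /= free_lift_gen. Qed.

End Model.

(** * Graded components in the model *)

Section ModelComponents.
Variables (k : fieldType) (n : nat).
Local Notation RE := (RE k n).
Local Notation ZV := {ffun 'I_n -> int}.
Local Notation FM := (ZV -> RE).
Implicit Types (d : ZV) (q r : RE).
Local Notation Dt := (datumA k n).
Local Notation repF := (@repF k n).

Definition rise (x : RE) (m : nat) : RE := \prod_(j < m) (x + j%:R).

Lemma rise_add x m m' : rise x (m + m') = rise x m * rise (x + m%:R) m'.
Proof.
rewrite /rise big_split_ord /=; congr (_ * _); apply: eq_bigr => j _.
by rewrite natrD addrA.
Qed.

Lemma rise0 x : rise x 0 = 1.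
Proof. by rewrite /rise big_ord0. Qed.
Lemma rise1 x : rise x 1 = x.
Proof. by rewrite /rise big_ord1 addr0. Qed.

Definition npart (m : int) : nat := if m is Negz j then j.+1 else 0%N.

Lemma npartE m : npart m = `|Num.min m 0|%N.
Proof. by case: m => m /=; lia. Qed.

(** The one-variable case of [zgen_dvd]. For negative [m] the two factors are consecutive runs of
    one rising factorial, and [npart] is subadditive. For [m >= 0] the second run starts [m] steps
    lower, and its terms from [x] on, if any, form the required factor. *)
Lemma rise_npart (m m' : int) x : exists s,
  rise x (npart m) * rise (x - (m%:~R)%:MP) (npart m') = s * rise x (npart (m + m')).
Proof.
have dv (y : RE) a b : (a <= b)%N -> exists s, rise y b = s * rise y a.
  by move=> /subnKC <-; exists (rise (y + a%:R) (b - a)); rewrite rise_add mulrC.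
have [m0|m0] := lerP 0 m; last first.
  have -> : x - (m%:~R)%:MP = x + (npart m)%:R.
    have mE : m = - (npart m)%:Z by rewrite npartE; lia.
    have -> : m%:~R = - (npart m)%:R :> k by rewrite {1}mE mulrNz.
    by rewrite mpolyCN opprK mpolyC_nat.
  by rewrite -rise_add; apply: dv; rewrite !npartE; lia.
have -> : npart m = 0%N by rewrite npartE; lia.
rewrite rise0 mul1r; have [mm|mm] := leqP `|m|%N (npart m').
  exists (rise (x - (m%:~R)%:MP) `|m|%N).
  have -> : npart m' = (`|m|%N + npart (m + m'))%N by move: mm; rewrite !npartE; lia.
  rewrite rise_add; congr (_ * rise _ _).
  have -> : m%:~R = `|m|%N%:R :> k by rewrite pmulrn; congr (_ *~ _); lia.
  by rewrite -mpolyC_nat subrK.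
exists (rise (x - (m%:~R)%:MP) (npart m')).
have -> : npart (m + m') = 0%N by move: mm; rewrite !npartE; lia.
by rewrite rise0 mulr1.
Qed.

(* The coefficient of the monomial x^(D+) partial^(D-) of the Weyl algebra,
   D = Dof d, on which [RE] z^d is modelled. *)
Definition zgen d : RE := \prod_e rise 'X_e (npart (Dof d e)).

Lemma zshift_rise d x m : zshift d (rise x m) = rise (zshift d x) m.
Proof.
rewrite /rise rmorph_prod; apply: eq_bigr => j _.
by rewrite rmorphD rmorph_nat.
Qed.

Lemma zgen_dvd d d' : exists s, zgen d * zshift d (zgen d') = s * zgen (d + d').
Proof.
have h e := rise_npart (Dof d e) (Dof d' e) 'X_e.
exists (\prod_e sval (cid (h e))); rewrite /zgen rmorph_prod -!big_split.
apply: eq_bigr => e _ /=; rewrite zshift_rise zshiftX DofD.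
exact: (svalP (cid (h e))).
Qed.

(** The Laurent polynomial 1; the coefficient of an operator [oq q d] is read off from its value
    there. *)
Definition fdelta : FM := fun e => if e == 0 then 1 else 0.

Lemma oq_fdelta q d e : lend_fun (oq q d) fdelta e = if e == d then q else 0.
Proof.
rewrite -[LHS]/(q * zshift d (fdelta (e - d))) /fdelta subr_eq0.
by case: eqP => _; rewrite ?rmorph1 ?rmorph0 ?mulr1 ?mulr0.
Qed.

Lemma oq_inj q q' d : oq q d = oq q' d -> q = q'.
Proof.
move=> h; have := congr1 (fun f : lend FM => lend_fun f fdelta d) h.
by rewrite !oq_fdelta eqxx.
Qed.

Lemma zgen0 : zgen 0 = 1.
Proof. by rewrite /zgen big1 // => e _; rewrite Dof0 rise0. Qed.

Lemma zgen_delta i : zgen (zdelta i) = 'X_(eout i).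
Proof.
rewrite /zgen (bigD1 (eout i)) //= Dof_delta eqxx eoutein_eq sub0r rise1.
rewrite big1 ?mulr1 // => e /negPf ei; rewrite Dof_delta ei subr0.
by case: (e == _); rewrite rise0.
Qed.

Lemma zgen_deltaN i : zgen (- zdelta i) = 'X_(ein i).
Proof.
rewrite /zgen (bigD1 (ein i)) //= DofN Dof_delta eqxx einout_eq subr0 rise1.
rewrite big1 ?mulr1 // => e /negPf ei; rewrite DofN Dof_delta ei sub0r opprK.
by case: (e == _); rewrite rise0.
Qed.

Lemma repF_homog d x : tgwc_homog d x -> exists q, repF x = oq (q * zgen d) d.
Proof.
elim=> [r|i|i|e|e y z _ [q hq] _ [q' hq']|e f y z _ [q hq] _ [q' hq']].
- by exists r; rewrite repF_cst zgen0 mulr1.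
- by exists 1; rewrite repF_X zgen_delta mul1r.
- by exists 1; rewrite repF_Y zgen_deltaN mul1r.
- by exists 0; rewrite rmorph0 mul0r oq0.
- by exists (q + q'); rewrite rmorphD /= hq hq' mulrDl oqD.
have [s hs] := zgen_dvd e f; exists (q * zshift e q' * s).
rewrite rmorphM /= hq hq' oqM rmorphM; congr (oq _ _).
by rewrite mulrACA hs mulrA.
Qed.

(** Values at [fdelta] separate the degrees, so the components of a kernel element lie in the
    kernel; in degree zero R_E acts faithfully by multiplication. Hence the kernel is contained in
    the radical. *)
Lemma repF_ker_graded : tgw_graded_ideal (D := Dt) (fun x => repF x = 0).
Proof.
split.
- split=> [|x y hx hy|y x hx|y x hx]; first exact: rmorph0.
  + by rewrite rmorphD /= hx hy addr0.
  + by rewrite rmorphM /= hx mulr0.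
  + by rewrite rmorphM /= hx mul0r.
- move=> x; have [S [y [uS hy ->]]] := homog_decomp x => h.
  exists (size S), (fun a => nth 0 S a), (fun a => y (nth 0 S a)).
  split; last by rewrite (big_nth 0) big_mkord.
  move=> [a aS] /=; split=> //; set d := nth 0 S a.
  have [q hq] := repF_homog (hy d); rewrite hq.
  suff -> : q * zgen d = 0 by rewrite oq0.
  have := congr1 (fun f : lend FM => lend_fun f fdelta d) h.
  rewrite rmorph_sum /= (bigD1_seq d) ?mem_nth //= hq.
  rewrite -[lend_fun (_ + _) _ _]/(lend_fun (oq _ _) _ d + lend_fun _ _ d).
  rewrite oq_fdelta eqxx => h0; apply: (etrans _ h0).
  rewrite -[LHS]addr0; congr (_ + _).
  elim/big_ind: _ => // [f f' hf hf'|e ed].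
    by rewrite -[RHS]/(lend_fun f fdelta d + lend_fun f' fdelta d) -hf -hf' addr0.
  by have [r ->] := repF_homog (hy e); rewrite oq_fdelta eq_sym (negPf ed).
move=> x h /homog0_cst [r xr]; move: h; rewrite xr repF_cst -(oq0 _ 0).
by move/oq_inj ->; rewrite rmorph0.
Qed.

Lemma repF_rad x : repF x = 0 -> quo_pi (tgw_rad (D := Dt)) x = 0.
Proof.
move=> hx; apply: quo_pi0; exists (fun x => repF x = 0); split=> //.
exact: repF_ker_graded.
Qed.

(** In the commutator of the elements for [(i, j)] and [(j, l)], the two coefficients are [u_j u_l]
    and [u_l (u_j - 1)], which leaves [u_l]. *)
Lemma root_elt i j : i != j -> exists d c,
  [/\ forall e, Dof d e = (e == i)%:R - (e == j)%:R, tgwc_homog (D := Dt) d c &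
      repF c = oq 'X_j d].
Proof.
move: i j; apply: pair_ind => [i|i|i j l ij jl il [d1 [c1 [D1 h1 r1]]] [d2 [c2 [D2 h2 r2]]]].
- exists (zdelta i), (tgwc_X Dt i); split; first exact: Dof_delta.
    exact: tgwc_homogX.
  exact: repF_X.
- exists (- zdelta i), (tgwc_Y Dt i); split; last exact: repF_Y.
    by move=> e; rewrite DofN Dof_delta opprB.
  exact: tgwc_homogY.
exists (d1 + d2), (c1 * c2 - c2 * c1); split.
- by move=> e; rewrite DofD D1 D2 addrA subrK.
- by apply: homogB; [|rewrite addrC]; apply: tgwc_homogM.
rewrite rmorphB !rmorphM /= r1 r2 !oqM [d2 + d1]addrC -oqB; congr (oq _ _).
rewrite !zshiftX D1 D2 eqxx [l == i]eq_sym [l == j]eq_sym (negPf il) (negPf jl).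
rewrite (_ : (false%:R - false%:R)%:~R = 0 :> k) //.
rewrite (_ : (true%:R - false%:R)%:~R = 1 :> k) //.
rewrite mpolyC0 mpolyC1.
by ring.
Qed.

(** By induction on the total negative part of [Dof d]: a root with positive entry at [i] and
    negative entry at [j] is split off on the left, and contributes the first factor ['X_j] of the
    rising factorial at [j]. *)
Lemma zgen_ex d : exists c, tgwc_homog (D := Dt) d c /\ repF c = oq (zgen d) d.
Proof.
have [m] := ubnP (\sum_e npart (Dof d e)); elim: m d => // m IH d hm.
have [d0|] := pselect (forall e, 0 <= Dof d e).
  have {}d0 : d = 0.
    apply: Dof_inj => e; apply/eqP; have := sum_Dof d => /eqP.
    by rewrite psumr_eq0 // => /allP /(_ e (mem_index_enum e)).
  rewrite d0; exists 1; rewrite zgen0 rmorph1; split.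
    by rewrite -(rmorph1 (tgwc_cst Dt)); apply: tgwc_homog_cst.
  by rewrite -(rmorph1 (@oqc k n)).
move=> /existsNP [j /negP]; rewrite -ltNge => dj.
have [i di] : exists i, 0 < Dof d i.
  apply: contrapT => h; have := sum_Dof d => /eqP.
  rewrite -oppr_eq0 -sumrN psumr_eq0 => [/allP /(_ j (mem_index_enum j))|e _].
    by rewrite oppr_eq0 => /eqP dj0; rewrite dj0 ltxx in dj.
  by rewrite oppr_ge0 leNgt; apply/negP => de; apply: h; exists e.
have ij : i != j by apply: contraTneq dj => <-; rewrite -leNgt ltW.
have [da [ca [Da ha ra]]] := root_elt ij.
have Dd e : Dof (d - da) e = Dof d e - ((e == i)%:R - (e == j)%:R).
  by rewrite DofD DofN Da.
have Ddj : Dof (d - da) j = Dof d j + 1.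
  by rewrite Dd eqxx eq_sym (negPf ij) sub0r opprK.
have Ddo e : e != j -> npart (Dof (d - da) e) = npart (Dof d e).
  move=> ej; rewrite Dd (negPf ej) subr0; have [->|_] := eqVneq e i; last by rewrite subr0.
  by rewrite !npartE; lia.
have [|c [hc rc]] := IH (d - da).
  rewrite ltnS in hm; apply: leq_trans hm; rewrite [in X in (_ <= X)%N](bigD1 j) //=.
  rewrite (bigD1 j) //= -addSn; apply: leq_add.
    by rewrite Ddj !npartE; lia.
  by apply: leq_sum => e ej; rewrite Ddo.
exists (ca * c); split.
  by rewrite -[d](subrKC da); apply: tgwc_homogM.
rewrite rmorphM /= ra rc oqM subrKC; congr (oq _ _).
rewrite /zgen rmorph_prod (bigD1 j) //= [RHS](bigD1 j) //= mulrA; congr (_ * _).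
  rewrite zshift_rise zshiftX Da eqxx [j == i]eq_sym (negPf ij) Ddj.
  have -> : npart (Dof d j) = (1 + npart (Dof d j + 1)%R)%N by rewrite !npartE; lia.
  rewrite rise_add rise1 (_ : (false%:R - true%:R)%:~R = -1 :> k) // mpolyCN.
  by rewrite mpolyC1 opprK.
apply: eq_bigr => e ej; rewrite zshift_rise zshiftX Da (negPf ej) Ddo //.
have [->|_] := eqVneq e i.
  have -> : npart (Dof d i) = 0%N by rewrite npartE; lia.
  by rewrite !rise0.
by rewrite (_ : (false%:R - false%:R)%:~R = 0 :> k) // mpolyC0 subr0.
Qed.

Lemma homog_zgen d x Z : tgwc_homog (D := Dt) d x -> repF Z = oq (zgen d) d ->
  exists r, quo_pi (tgw_rad (D := Dt)) x =
    quo_pi (tgw_rad (D := Dt)) (tgwc_cst Dt r * Z).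
Proof.
move=> hx rZ; have [r hr] := repF_homog hx; exists r.
apply/eqP; rewrite -subr_eq0 -rmorphB; apply/eqP/repF_rad.
by rewrite rmorphB rmorphM /= hr rZ repF_cst oqM zshift0 add0r subrr.
Qed.

(** The product has degree zero, hence lies in R_E, where the model is faithful. *)
Lemma zgen_zgenN d Z Z' : tgwc_homog (D := Dt) d Z -> repF Z = oq (zgen d) d ->
  tgwc_homog (D := Dt) (- d) Z' -> repF Z' = oq (zgen (- d)) (- d) ->
  Z * Z' = tgwc_cst Dt (zgen d * zshift d (zgen (- d))).
Proof.
move=> hZ rZ hZ' rZ'; have := tgwc_homogM hZ hZ'; rewrite subrr.
move=> /homog0_cst [r hr]; rewrite hr; congr (tgwc_cst _ _).
apply: (@oq_inj _ _ 0); rewrite -repF_cst -hr rmorphM /= rZ rZ' oqM.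
by rewrite subrr.
Qed.

Lemma zgen_neq0 (A : idomainType) (f : {rmorphism RE -> A}) d :
  (forall e c, f ('X_e + c%:MP) != 0) -> f (zgen d * zshift d (zgen (- d))) != 0.
Proof.
move=> h; have hr e c m : f (rise ('X_e + c%:MP) m) != 0.
  rewrite /rise rmorph_prod; apply/prodf_neq0 => j _.
  by rewrite -mpolyC_nat -addrA -mpolyCD.
rewrite rmorphM mulf_neq0 //.
  rewrite /zgen rmorph_prod; apply/prodf_neq0 => e _.
  by rewrite -['X_e]addr0 -mpolyC0.
rewrite /zgen !rmorph_prod; apply/prodf_neq0 => e _ /=.
by rewrite zshift_rise zshiftX -mpolyCN.
Qed.
End ModelComponents.

(** * Density of the weights *)

Lemma poly_inj_roots (A : idomainType) (f : nat -> A) (Q : {poly A}) :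
  injective f -> (forall m, Q.[f m] = 0) -> Q = 0.
Proof.
move=> finj h; apply/eqP; apply/negPn/negP => Q0.
have := @max_poly_roots _ Q (map f (iota 0 (size Q))) Q0.
rewrite map_inj_uniq ?iota_uniq // size_map size_iota ltnn => H.
suff rts : all (root Q) (map f (iota 0 (size Q))) by have := H rts isT.
by apply/allP => x /mapP [m _ ->]; rewrite rootE h.
Qed.

Lemma natr_inj (k : fieldType) : [pchar k] =i pred0 ->
  injective (fun m : nat => m%:R : k).
Proof.
move=> k0; suff H (m m' : nat) : (m <= m')%N -> m%:R = m'%:R :> k -> m = m'.
  by move=> m m' h; have [/H|/ltnW /H] := leqP m m'; [apply|move=> ->].
move=> mm h; have := natrB k mm; rewrite h subrr => /eqP.
by rewrite ((pcharf0P _).1 k0) => /eqP; lia.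
Qed.

Lemma intr_inj0 (k : fieldType) (m : int) : [pchar k] =i pred0 ->
  m%:~R = 0 :> k -> m = 0.
Proof.
move=> k0 /eqP; case: m => m; first by rewrite -pmulrn ((pcharf0P _).1 k0) => /eqP ->.
by rewrite NegzE mulrNz oppr_eq0 -pmulrn ((pcharf0P _).1 k0).
Qed.

Section MpolyVanish.
Variables (k : fieldType) (k0 : [pchar k] =i pred0).

Lemma mpoly_ring_ind m (P : {mpoly k[m]} -> Prop) : (forall c, P c%:MP) ->
  (forall i, P 'X_i) -> (forall p q, P p -> P q -> P (p + q)) ->
  (forall p q, P p -> P q -> P (p * q)) -> forall p, P p.
Proof.
move=> PC PX PD PM p; rewrite (mpolyE p); elim/big_ind: _ => // [|a _].
  by rewrite -mpolyC0.
rewrite -mul_mpolyC mpolyXE_id; apply: (PM) => //.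
elim/big_ind: _ => [|? ?|i _]; [by rewrite -mpolyC1|exact: PM|].
by elim: (a i) => [|b IH]; rewrite ?expr0 -?mpolyC1 // exprS; apply: PM.
Qed.

Lemma mpoly_vanish m (p : {mpoly k[m]}) : (forall v, p.@[v] = 0) -> p = 0.
Proof.
move=> h.
(* [sub j v] evaluates the variables of index at least [j] at [v]. *)
pose sub j (v : 'I_m -> k) : {mpoly k[m]} -> {mpoly k[m]} :=
  comp_mpoly [tuple if (i < j)%N then 'X_i else (v i)%:MP | i < m].
have subX j v i : sub j v 'X_i = if (i < j)%N then 'X_i else (v i)%:MP.
  by rewrite /sub comp_mpolyXU -tnth_nth tnth_mktuple.
have subC j v c : sub j v c%:MP = c%:MP by exact: comp_mpolyC.
suff H j v : sub j v p = 0.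
  rewrite -[RHS](H m (fun=> 0)).
  apply: (mpoly_rmorph_eq (f := idfun) (g := comp_mpoly _)) => [c|i] /=.
    by rewrite comp_mpolyC.
  by have := subX m (fun=> 0) i; rewrite /sub ltn_ord => ->.
elim: j v => [|j IH] v.
  transitivity (mpolyC m p.@[v]); last by rewrite h mpolyC0.
  apply: (mpoly_rmorph_eq (f := comp_mpoly _) (g := @mpolyC m k \o meval v)) => [c|i] /=.
    by rewrite comp_mpolyC mevalC.
  by have := subX 0%N v i; rewrite /sub mevalXU => ->.
have [jm|jm] := ltnP j m; last first.
  rewrite -(IH v); apply: (mpoly_rmorph_eq (f := comp_mpoly _) (g := comp_mpoly _)) => [c|i] /=.
    by rewrite !comp_mpolyC.
  have := subX j v i; have := subX j.+1 v i; rewrite /sub => -> ->.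
  have ij : (i < j)%N := leq_trans (ltn_ord i) jm.
  by rewrite ij ltnS ltnW.
(* [Q p] is [p] as a polynomial in the variable [j], with the later variables evaluated at [v]. By
   [IH] it vanishes at all natural numbers. *)
pose g (i : 'I_m) : {poly {mpoly k[m]}} :=
  if (i < j)%N then ('X_i)%:P else if i == j :> nat then 'X else ((v i)%:MP)%:P.
pose Q : {rmorphism {mpoly k[m]} -> {poly {mpoly k[m]}}} := mmap (polyC \o @mpolyC m k) g.
have QX i : Q 'X_i = g i by rewrite /Q /= mmapX mmap1U.
have QC c : Q c%:MP = (c%:MP)%:P by exact: mmapC.
have Qc x (t : m.-tuple {mpoly k[m]}) :
    (forall i, (g i).[x] = tnth t i) -> (Q p).[x] = p \mPo t.
  move=> gx; apply: (mpoly_rmorph_eq (f := horner_eval x \o Q) (g := comp_mpoly t)) => [c|i] /=.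
    by rewrite /horner_eval QC hornerC comp_mpolyC.
  by rewrite /horner_eval QX gx comp_mpolyXU (tnth_nth 0).
have Q0 : Q p = 0.
  apply: (@poly_inj_roots _ (fun c => (c%:R)%:MP)).
    by move=> c c' /(congr1 (meval (fun=> 0))); rewrite !mevalC; apply: natr_inj.
  move=> c; rewrite -(IH (fun i => if i == j :> nat then c%:R else v i)); apply: Qc => i.
  rewrite tnth_mktuple /g; case: (i < j)%N; first by rewrite hornerC.
  by case: eqP => _; rewrite ?hornerX ?hornerC.
rewrite -(horner0 'X_(Ordinal jm)) -Q0; symmetry; apply: Qc => i.
rewrite tnth_mktuple /g ltnS.
case: (ltngtP i j) => ij /=; rewrite ?hornerC ?hornerX //.
by have -> : i = Ordinal jm by apply: val_inj.
Qed.
End MpolyVanish.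

Lemma meval_line (k : fieldType) (k0 : [pchar k] =i pred0) m (r : {mpoly k[m]})
    (p b : 'I_m -> k) :
  (forall x : nat, r.@[fun e => p e + x%:R * b e] = 0) ->
  forall t, r.@[fun e => p e + t * b e] = 0.
Proof.
move=> h; pose g e : {poly k} := (p e)%:P + (b e)%:P * 'X.
pose Q : {rmorphism {mpoly k[m]} -> {poly k}} := mmap (@polyC k) g.
have QE t : (Q r).[t] = r.@[fun e => p e + t * b e].
  apply: (mpoly_rmorph_eq (f := horner_eval t \o Q) (g := meval _)) => [c|e] /=.
    by rewrite /horner_eval mevalC mmapC hornerC.
  rewrite /horner_eval mevalXU mmapX mmap1U /g.
  by rewrite hornerD hornerM !hornerC hornerX [b e * t]mulrC.
suff Q0 : Q r = 0 by move=> t; rewrite -QE Q0 horner0.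
apply: (poly_inj_roots (natr_inj k0)) => x.
by rewrite QE.
Qed.

(** * The weights of good vectors inside their hyperplane *)

Section Density.
Variables (k : fieldType) (k0 : [pchar k] =i pred0) (n : nat).
Variables (M : lmodType k) (a : lie_module (@sl_br k n) M).
Local Notation I := 'I_n.+1.
Local Notation e := (eL k0 a).
Variables (G : (I -> k) -> M -> Prop) (gG : good_family k0 a G).
Hypothesis simp : simple_module a.
Variables (i0 j0 : I) (ij0 : i0 != j0).

Definition op_inj (l : I * I) := forall v, e l.1 l.2 v = 0 -> v = 0.
Hypothesis inj0 : op_inj (i0, j0).

Definition dir (l : I * I) (x : I) : k := (x == l.1)%:R - (x == l.2)%:R.

Lemma gf_iter p v l m : l.1 != l.2 -> op_inj l -> G p v ->
  exists p' v', G p' v' /\ p' =1 (fun x => p x + m%:R * dir l x).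
Proof.
move=> hl inj g; elim: m => [|m [p' [v' [g' pE]]]].
  by exists p, v; split=> // x; rewrite mul0r addr0.
exists (wshift p' l.1 l.2), (e l.1 l.2 v'); split.
  apply: (gf_e gG) => //; apply: contra (gf_neq0 gG g') => /eqP h.
  by rewrite (inj _ h).
by move=> x; rewrite /wshift pE /dir -natr1; ring.
Qed.

(** If both were locally nilpotent, [e i0 c] would kill a good vector; the product formula at it and
    at its image under [e i0 j0] gives [p c = 1]. From there powers of [e c j0] never vanish, as
    [p c] stays a positive integer and [p j0] avoids 1. *)
Lemma third_inj c : c != i0 -> c != j0 -> op_inj (i0, c) \/ op_inj (c, j0).
Proof.
move=> ci cj; have ic : i0 != c by rewrite eq_sym.
have [|nil1] := nil_or_inj k0 simp ic; first by left.
have [|nil2] := nil_or_inj k0 simp cj; first by right.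
exfalso; have [p1 [v1 g1]] := gf_ex gG.
have [p2 [v2 [g2 v20]]] : exists p v, G p v /\ e i0 c v = 0.
  have [m] := nil1 v1; elim: m p1 v1 g1 => [|m IH] p v g.
    by move=> /= v0; have := gf_neq0 gG g; rewrite v0 eqxx.
  rewrite iterSr; have [v0 _|v0] := eqVneq (e i0 c v) 0; first by exists p, v.
  exact: IH (gf_e gG ic g v0).
have p2c : p2 c = 1.
  have h1 : p2 i0 * (p2 c - 1) = 0.
    apply: (scal_inj (gf_neq0 gG g2)).
    by rewrite -(gf_prod gG ic g2) v20 linear0 scale0r.
  have E0 : e i0 j0 v2 != 0.
    by apply: contra (gf_neq0 gG g2) => /eqP /inj0 ->.
  have := gf_prod gG ic (gf_e gG ij0 g2 E0).
  have ji0 : j0 != i0 by rewrite eq_sym.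
  rewrite (@eCC _ _ _ _ (eLC k0 a) i0 c i0 j0) // v20 !linear0.
  move=> /esym /eqP; rewrite scaler_eq0 (negPf E0) orbF.
  rewrite wshiftl // wshifto // mulrDl h1 mul1r add0r subr_eq0.
  by move/eqP.
(* If [p2 j0] is a natural number [N], applying [e i0 j0] [N] times lowers it to 0; otherwise [v2]
   already serves. *)
have [p3 [v3 [g3 p3c p3j]]] : exists p v, [/\ G p v, p c = 1 &
    forall m : nat, p j0 != m.+1%:R].
  have [[N hN]|no] := pselect (exists N : nat, p2 j0 = N%:R); last first.
    exists p2, v2; split=> // m; apply/eqP => h; apply: no.
    by exists m.+1.
  have [p' [v' [g' pE]]] := gf_iter N (l := (i0, j0)) ij0 inj0 g2.
  exists p', v'; split=> // [|m]; rewrite pE /dir /=.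
    by rewrite (negPf ci) (negPf cj) subrr mulr0 addr0.
  rewrite eqxx [j0 == i0]eq_sym (negPf ij0) sub0r mulrN1 hN subrr eq_sym.
  by rewrite ((pcharf0P _).1 k0).
have [m] := nil2 v3; apply/eqP.
have : exists p, [/\ G p (iter m (e c j0) v3), p c = m.+1%:R & p j0 = p3 j0 - m%:R].
  elim: m => [|m [p [g pc pj]]]; first by exists p3; rewrite subr0.
  have h0 : e c j0 (iter m (e c j0) v3) != 0.
    apply: contraNneq (gf_neq0 gG g) => h.
    have := gf_prod gG cj g; rewrite h linear0 => /esym /eqP.
    rewrite scaler_eq0 pc pj mulf_eq0 ((pcharf0P _).1 k0) /= -addrA -opprD natr1.
    by rewrite subr_eq0 (negPf (p3j m)).
  exists (wshift p c j0); split; first exact: gf_e.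
    by rewrite wshiftl // pc natr1.
  by rewrite wshiftr // pj -addrA -opprD natr1.
by case=> p [g _ _]; apply: (gf_neq0 gG g).
Qed.

(** Directions are freed one at a time: an injective operator yields the weights at all natural
    multiples of its direction, and [meval_line] passes to all scalars. *)
Lemma gf_dense_dirs (r : {mpoly k[n.+1]}) T :
  (forall p v, G p v -> r.@[p] = 0) ->
  (forall l, l \in T -> l.1 != l.2 /\ op_inj l) ->
  forall p v (t : I * I -> k), G p v ->
    r.@[fun x => p x + \sum_(l <- T) t l * dir l x] = 0.
Proof.
move=> h; elim: T => [|l T IH] hT p v t g.
  by rewrite -[RHS](h _ _ g); apply: meval_eq => x; rewrite big_nil addr0.
have hT' l' : l' \in T -> l'.1 != l'.2 /\ op_inj l'.
  by move=> hl'; apply: hT; rewrite inE hl' orbT.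
have {}IH := IH hT'.
have [hl inj] := hT l (mem_head _ _).
rewrite -[RHS](meval_line k0 (r := r) (p := fun x => p x + \sum_(l <- T) t l * dir l x)
  (b := dir l) _ (t l)).
  by apply: meval_eq => x; rewrite big_cons addrA addrAC.
move=> m; have [p' [v' [g' pE]]] := gf_iter m hl inj g.
rewrite -[RHS](IH _ _ t g'); apply: meval_eq => x.
by rewrite pE addrAC.
Qed.

Lemma gf_dense (lam : k) (r : {mpoly k[n.+1]}) :
  (forall p v, G p v -> \sum_x (p x - 1) = lam) ->
  (forall p v, G p v -> r.@[p] = 0) ->
  forall q, \sum_x (q x - 1) = lam -> r.@[q] = 0.
Proof.
move=> Glam h q qlam; have [p [v g]] := gf_ex gG.
pose third := [pred c : I | (c != i0) && (c != j0)].
have hd c : exists l, third c -> op_inj l /\ (l = (i0, c) \/ l = (c, j0)).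
  case: (boolP (third c)) => [/andP[ci cj]|_]; last by exists (c, c).
  by have [inj|inj] := third_inj ci cj; [exists (i0, c)|exists (c, j0)]; auto.
pose dr c := sval (cid (hd c)).
have drP c : third c -> op_inj (dr c) /\ (dr c = (i0, c) \/ dr c = (c, j0)).
  exact: (svalP (cid (hd c))).
(* Only [dr c] moves the third coordinate [c], by a sign that squares to one. The coefficient [u]
   below corrects [i0], and [j0] then agrees since both points have sum [lam]. *)
pose s c : k := (q c - p c) * dir (dr c) c.
pose sub x := \sum_(c | third c) s c * dir (dr c) x.
pose T := (i0, j0) :: [seq dr c | c <- enum third].
pose u := (q i0 - p i0) - sub i0.
pose t (l : I * I) : k := if l == (i0, j0) then u else
  if l.1 == i0 then s l.2 else s l.1.
have tE x : \sum_(l <- T) t l * dir l x = u * dir (i0, j0) x + sub x.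
  rewrite big_cons /t eqxx; congr (_ + _); rewrite big_map big_enum.
  apply: eq_bigr => c hc; have /andP[ci cj] := hc.
  have [_ [->|->]] := drP c hc; rewrite xpair_eqE eqxx /= ?(negPf ci) ?(negPf cj) //.
have dirS l : l.1 != l.2 -> \sum_x dir l x = 0.
  move=> hl; rewrite sumrB; have S (y : I) : \sum_x (x == y)%:R = 1 :> k.
    by rewrite (bigD1 y) //= eqxx big1 ?addr0 // => z /negPf ->.
  by rewrite !S subrr.
have hT l : l \in T -> l.1 != l.2 /\ op_inj l.
  rewrite inE => /predU1P[->//|/mapP[c]]; rewrite mem_enum => hc ->.
  have [inj D] := drP c hc; split=> //; move: hc => /andP[ci cj].
  by case: D => -> //=; rewrite eq_sym.
rewrite -[RHS](gf_dense_dirs h hT t g); apply: meval_eq.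
pose P x := p x + \sum_(l <- T) t l * dir l x.
have qP x : x != j0 -> q x = P x.
  move=> xj; rewrite /P tE; have [->|xi] := eqVneq x i0.
    by rewrite /dir /= eqxx (negPf ij0) subr0 mulr1 /u subrK addrC subrK.
  rewrite /dir /= (negPf xi) (negPf xj) subrr mulr0 add0r /sub (bigD1 x) /=; last by rewrite xi.
  rewrite big1 ?addr0.
    rewrite /s -mulrA; have /drP [_ D] : third x by rewrite /= xi.
    have -> : dir (dr x) x * dir (dr x) x = 1.
      by case: D => ->; rewrite /dir /= ?eqxx ?(negPf xi) ?(negPf xj) ?sub0r ?subr0 ?mulrNN mulr1.
    by rewrite mulr1 addrC subrK.
  move=> c /andP[hc cx]; have [_ D] := drP c hc.
  suff -> : dir (dr c) x = 0 by rewrite mulr0.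
  by case: D => ->; rewrite /dir /= ?(negPf xi) ?(negPf xj) [x == c]eq_sym (negPf cx) subrr.
move=> x; have [->|] := eqVneq x j0; last exact: qP.
have : \sum_x (q x - 1) = \sum_x (P x - 1).
  rewrite qlam -(Glam _ _ g) !sumrB; congr (_ - _).
  rewrite /P big_split /= exchange_big /= [X in _ + X]big1_seq ?addr0 //.
  by move=> l /andP[_ /hT [hl _]]; rewrite -mulr_sumr dirS // mulr0.
rewrite (bigD1 j0) //= [in RHS](bigD1 j0) //=.
rewrite (eq_bigr (fun x => P x - 1)) => [|y yj]; last by rewrite qP.
by move/addIr/addIr.
Qed.
End Density.

(** [wshift] preserves the sum of the entries, so the family can be restricted to the value taken at
    one of its members. *)
Lemma good_family_lam (k : fieldType) (k0 : [pchar k] =i pred0) (n : nat)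
    (M : lmodType k) (a : lie_module (@sl_br k n) M) G :
  good_family k0 a G -> exists lam,
    good_family k0 a (fun p v => G p v /\ \sum_x (p x - 1) = lam).
Proof.
move=> gG; have [p0 [v0 g0]] := gf_ex gG.
exists (\sum_x (p0 x - 1)); split.
- by move=> p v [g _]; apply: (gf_wv gG g).
- by move=> p v [g _]; apply: (gf_neq0 gG g).
- by move=> p v i j ij [g _]; apply: (gf_prod gG ij g).
- move=> p v i j ij [g <-] h; split; first exact: (gf_e gG).
  have S (y : 'I_n.+1) : \sum_x (x == y)%:R = 1 :> k.
    by rewrite (bigD1 y) //= eqxx big1 ?addr0 // => z /negPf ->.
  by rewrite !sumrB big_split /= !S addrK.
- by exists p0, v0.
Qed.

(** * The action of the TGW algebra on the module *)

Section Lend.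
Variables (k : fieldType) (M : lmodType k).

Lemma lend0 (f : lend M) : lend_fun f 0 = 0.
Proof. by have := lend_lin f (-1) 0 0; rewrite scaler0 addr0 scaleN1r addNr. Qed.

Lemma lendZ (f : lend M) c v : lend_fun f (c *: v) = c *: lend_fun f v.
Proof. by have := lend_lin f c v 0; rewrite lend0 !addr0. Qed.

Lemma lend_mulE (f g : lend M) v : lend_fun (f * g) v = lend_fun f (lend_fun g v).
Proof. by []. Qed.

Lemma lend_addE (f g : lend M) v : lend_fun (f + g) v = lend_fun f v + lend_fun g v.
Proof. by []. Qed.

Lemma lend_subE (f g : lend M) v : lend_fun (f - g) v = lend_fun f v - lend_fun g v.
Proof. by []. Qed.

Lemma lend_sumE (J : Type) (s : seq J) (F : J -> lend M) v :
  lend_fun (\sum_(j <- s) F j) v = \sum_(j <- s) lend_fun (F j) v.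
Proof. by elim: s => [|j s IH]; rewrite ?big_nil ?big_cons // lend_addE IH. Qed.
End Lend.

Section Theta.
Variables (k : fieldType) (k0 : [pchar k] =i pred0) (n : nat).
Variables (M : lmodType k) (a : lie_module (@sl_br k n) M).
Local Notation I := 'I_n.+1.
Local Notation e := (eL k0 a).
Local Notation ZV := {ffun 'I_n -> int}.
Local Notation Dt := (datumA k n).
Local Notation wv := (weight_vec e).
Variables (G : (I -> k) -> M -> Prop) (gG : good_family k0 a G) (lam : k).
Hypothesis Glam : forall p v, G p v -> \sum_x (p x - 1) = lam.
Hypothesis simp : simple_module a.

Lemma slE_eps (x : I) : slE k0 x x = sl_eps k x.
Proof.
apply: val_inj; rewrite /= eqxx.
transitivity (n.+1%:R^-1 *: \sum_(j < n.+1) (delta_mx x x - delta_mx j j : 'M[k]_n.+1)).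
  rewrite sumrB sumr_const card_ord -mx1_sum_delta scalerBr -scaler_nat scalerA.
  by rewrite mulVf ?(natS_neq0 n k0) // scale1r div1r scalemx1.
transitivity (n.+1%:R^-1 *: sl_mx (\sum_(j < n.+1) sl_diag k x j)); last by [].
by congr (_ *: _); symmetry; apply: (raddf_sum (val : {additive sl k n -> 'M[k]_n.+1})).
Qed.

Lemma slE_e (i : 'I_n) : slE k0 (ein i) (eout i) = sl_e k i.
Proof. by apply: val_inj; rewrite /= einout_eq mul0r raddf0 subr0. Qed.
Lemma slE_f (i : 'I_n) : slE k0 (eout i) (ein i) = sl_f k i.
Proof. by apply: val_inj; rewrite /= eoutein_eq mul0r raddf0 subr0. Qed.

Lemma env_act_gen x v : lend_fun (env_act a (env_gen _ x)) v = a x v.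
Proof. by rewrite /env_act env_lift_gen. Qed.

Definition thR : RE k n -> lend M := env_act a \o RE_U lam.
HB.instance Definition _ := GRing.RMorphism.copy thR (env_act a \o RE_U lam).

Lemma thR_C c : thR c%:MP = lend_scal M c.
Proof. by rewrite /thR /= RE_UC /env_act env_lift_cst. Qed.

(** The correction term makes the scalar insensitive to adding a constant to [p]; it vanishes on
    normalised weights. *)
Lemma thR_X p v x : wv p v ->
  lend_fun (thR 'X_x) v = (p x + n.+1%:R^-1 * (lam - \sum_y (p y - 1))) *: v.
Proof.
move=> pv; rewrite /thR /= RE_UX /Uu rmorphD /=.
rewrite -[LHS]/(lend_fun (env_act a (env_cst _ _)) v + lend_fun (env_act a (env_gen _ _)) v).
rewrite env_act_gen {1}/env_act env_lift_cst -slE_eps.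
rewrite -[lend_fun _ v]/((n.+1%:R^-1 * (lam + n.+1%:R)) *: v).
rewrite (lact_cartan (Cartan (slE_diag k0 x)) pv) -scalerDl; congr (_ *: _).
rewrite (eq_bigr (fun y => (y == x)%:R * p y - n.+1%:R^-1 * p y)); last first.
  by move=> y _; rewrite !mxE eqxx andbb div1r eqxx mulr1n mulrBl.
rewrite sumrB -mulr_sumr (bigD1 x) //= eqxx mul1r big1 ?addr0; last first.
  by move=> y /negPf ->; rewrite mul0r.
rewrite [in RHS]sumrB sumr_const card_ord.
by ring.
Qed.

Lemma thR_good p v r : G p v -> lend_fun (thR r) v = r.@[p] *: v.
Proof.
move=> g; elim/mpoly_ring_ind: r => [c|x|r q hr hq|r q hr hq].
- by rewrite thR_C mevalC.
- by rewrite (thR_X _ (gf_wv gG g)) (Glam g) subrr mulr0 addr0 mevalXU.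
- by rewrite rmorphD mevalD scalerDl -hr -hq.
- rewrite rmorphM mevalM -[LHS]/(lend_fun (thR r) (lend_fun (thR q) v)) hq.
  by rewrite lendZ hr scalerA mulrC.
Qed.

Lemma good_span v : lspan (fun w => exists p, G p w) v.
Proof.
have [p [w g]] := gf_ex gG.
apply: (span_all (k0 := k0) simp (v := w)) (gf_neq0 gG g) _.
- by move=> u [q gu]; exists q; apply: (gf_wv gG gu).
- move=> u i j ij [q gu]; have [->|h] := eqVneq (e i j u) 0; first exact: lspan0.
  by apply: lspan_in; exists (wshift q i j); apply: (gf_e gG).
- by exists p.
Qed.

Lemma lend_ext (f g : lend M) :
  (forall p v, G p v -> lend_fun f v = lend_fun g v) -> f = g.
Proof.
move=> h; apply: lendP => v; apply/eqP; rewrite -subr_eq0 -lend_subE; apply/eqP.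
apply: (lspan_eq0 (lend_lin _) (good_span v)) => w [p gw].
by rewrite lend_subE (h _ _ gw) subrr.
Qed.

Lemma meval_zshift d (r : RE k n) p :
  (zshift d r).@[p] = r.@[fun x => p x - (Dof d x)%:~R].
Proof.
rewrite /zshift comp_mpoly_meval; apply: meval_eq => x.
by rewrite tnth_mktuple mevalB mevalXU mevalC.
Qed.

Definition thgen (l : 'I_n + 'I_n) : lend M :=
  match l with inl i => lact_end a (sl_e k i) | inr i => lact_end a (sl_f k i) end.

Lemma thgenX i v : lend_fun (thgen (inl i)) v = e (ein i) (eout i) v.
Proof. by rewrite /= -slE_e. Qed.
Lemma thgenY i v : lend_fun (thgen (inr i)) v = e (eout i) (ein i) v.
Proof. by rewrite /= -slE_f. Qed.

Lemma thR_shift p v i j d r : i != j -> G p v ->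
  (forall x, Dof d x = (x == i)%:R - (x == j)%:R) ->
  e i j (lend_fun (thR r) v) = lend_fun (thR (zshift d r)) (e i j v).
Proof.
move=> ij g D; rewrite (thR_good _ g) linearZ.
have [->|h] := eqVneq (e i j v) 0; first by rewrite lend0 /= scaler0.
rewrite (thR_good _ (gf_e gG ij g h)) meval_zshift /=; congr (_ *: _).
apply: meval_eq => x; rewrite D /wshift.
by case: (x == i); case: (x == j); rewrite /=; ring.
Qed.

Fact theta_rel x : tgwc_rel Dt x -> free_lift thR thgen x = 0.
Proof.
pose L : {rmorphism _ -> lend M} := free_lift thR thgen.
rewrite -[free_lift _ _ x]/(L x).
have LX i : L (free_gen (inl i)) = thgen (inl i) by exact: free_lift_gen.
have LY i : L (free_gen (inr i)) = thgen (inr i) by exact: free_lift_gen.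
have Lc r : L (free_cst r) = thR r by exact: free_lift_cst.
move=> xrel; apply: lend_ext => p v g; rewrite -[RHS]/(0 : M); apply/eqP.
case: xrel => [i r|i r|i|i|i j ij]; rewrite (rmorphB L) !(rmorphM L) lend_subE subr_eq0.
- rewrite LX !Lc !lend_mulE !thgenX sigmaAE; apply/eqP.
  by apply: (thR_shift _ _ g); [rewrite einout_eq|exact: Dof_delta].
- rewrite LY !Lc !lend_mulE !thgenY sigmaVAE; apply/eqP.
  by apply: (thR_shift _ _ g) => [|z]; [rewrite eoutein_eq|rewrite DofN Dof_delta opprB].
- rewrite LX LY !Lc lend_mulE thgenX thgenY (gf_prod gG _ g) ?einout_eq //.
  by rewrite (thR_good _ g) /= /tA mevalM mevalB !mevalXU meval1.
- rewrite LX LY !Lc lend_mulE thgenX thgenY (gf_prod gG _ g) ?eoutein_eq //.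
  rewrite (thR_good _ g) sigmaAE meval_zshift /= /tA mevalM mevalB !mevalXU meval1.
  apply/eqP; congr (_ *: _); rewrite !Dof_delta !eqxx einout_eq eoutein_eq /=.
  by ring.
- rewrite LX LY !lend_mulE !thgenX !thgenY; apply/eqP; apply: (eCC (eLC k0 a)).
    by rewrite eout_eq.
  by rewrite ein_eq eq_sym.
Qed.

Definition theta : tgwc Dt -> lend M := quo_lift theta_rel.
HB.instance Definition _ := GRing.RMorphism.copy theta (quo_lift theta_rel).

Lemma theta_cst r : theta (tgwc_cst _ r) = thR r.
Proof. by apply: (etrans (quo_liftE _ _)); rewrite /= free_lift_cst. Qed.
Lemma theta_X i : theta (tgwc_X _ i) = lact_end a (sl_e k i).
Proof. by apply: (etrans (quo_liftE _ _)); rewrite /= free_lift_gen. Qed.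
Lemma theta_Y i : theta (tgwc_Y _ i) = lact_end a (sl_f k i).
Proof. by apply: (etrans (quo_liftE _ _)); rewrite /= free_lift_gen. Qed.

(** Off-diagonal units are iterated commutators of simple root vectors, and diagonal ones are the
    [u_i] up to a constant. *)
Lemma theta_sl x : exists c, lact_end a x = theta c.
Proof.
have off i j : i != j -> exists c, lact_end a (slE k0 i j) = theta c.
  move: i j; apply: pair_ind => [i|i|i j l ij jl il [c hc] [c' hc']].
  - by exists (tgwc_X Dt i); rewrite theta_X slE_e.
  - by exists (tgwc_Y Dt i); rewrite theta_Y slE_f.
  exists (c * c' - c' * c); rewrite rmorphB !rmorphM /= -hc -hc' -lact_end_br slE_br.
  by rewrite eqxx eq_sym (negPf il) scale1r scale0r subr0.
have diag i : exists c, lact_end a (slE k0 i i) = theta c.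
  exists (tgwc_cst Dt ('X_i - (n.+1%:R^-1 * (lam + n.+1%:R))%:MP)).
  rewrite theta_cst rmorphB /= thR_C /thR /= RE_UX /Uu rmorphD /= /env_act.
  by rewrite env_lift_cst env_lift_gen slE_eps addrC addKr.
have all i j : exists c, lact_end a (slE k0 i j) = theta c.
  by have [->|] := eqVneq i j; [apply: diag|apply: off].
rewrite (sl_sum k0 x); elim/big_ind: _ => [|y z|i _].
- by exists 0; rewrite rmorph0; apply: lendP => v; rewrite /= -[RHS](linear0 (lactl a v)).
- move=> [c hc] [c' hc']; exists (c + c').
  by have := lact_end_lin a 1 y z; rewrite scale1r rmorph1 mul1r rmorphD /= hc hc'.
elim/big_ind: _ => [|y z|j _].
- by exists 0; rewrite rmorph0; apply: lendP => v; rewrite /= -[RHS](linear0 (lactl a v)).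
- move=> [c hc] [c' hc']; exists (c + c').
  by have := lact_end_lin a 1 y z; rewrite scale1r rmorph1 mul1r rmorphD /= hc hc'.
have [c hc] := all i j; exists (tgwc_cst Dt (sl_mx x i j)%:MP * c).
by rewrite rmorphM /= theta_cst thR_C -hc; apply: lendP => v;
  rewrite -[LHS]/(lactl a v _) linearZ.
Qed.
End Theta.

(** * The radical acts by zero *)

Section ThetaRadical.
Variables (k : fieldType) (k0 : [pchar k] =i pred0) (n : nat).
Variables (M : lmodType k) (a : lie_module (@sl_br k n) M).
Local Notation I := 'I_n.+1.
Local Notation e := (eL k0 a).
Local Notation ZV := {ffun 'I_n -> int}.
Local Notation Dt := (datumA k n).
Local Notation wv := (weight_vec e).
Variables (G : (I -> k) -> M -> Prop) (gG : good_family k0 a G) (lam : k).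
Hypothesis Glam : forall p v, G p v -> \sum_x (p x - 1) = lam.
Hypothesis simp : simple_module a.
Local Notation theta := (theta gG Glam simp).
Local Notation thR := (thR a lam).

Lemma thR_scal p v r : wv p v -> exists c, lend_fun (thR r) v = c *: v.
Proof.
move=> pv; elim/mpoly_ring_ind: r => [c|x|r q [c hr] [d hq]|r q [c hr] [d hq]].
- by exists c; rewrite thR_C.
- by eexists; apply: (thR_X _ _ pv).
- by exists (c + d); rewrite rmorphD lend_addE hr hq scalerDl.
- by exists (d * c); rewrite rmorphM lend_mulE hq lendZ hr scalerA.
Qed.

Lemma weight_vec_add p v w : wv p v -> wv p w -> wv p (v + w).
Proof.
by move=> pv pw i j; rewrite !(eD e) opprD addrACA pv pw scalerDr.
Qed.

Definition dshift (p : I -> k) (d : ZV) (x : I) : k := p x + (Dof d x)%:~R.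

Lemma theta_weight d c p v : tgwc_homog d c -> wv p v ->
  wv (dshift p d) (lend_fun (theta c) v).
Proof.
move=> hc; elim: hc p v => {d c} [r|i|i|d|d x y _ hx _ hy|d f x y _ hx _ hy] p v pv.
- have [c hc] := thR_scal r pv; rewrite theta_cst hc; apply: weight_vecZ.
  by apply: weight_vec_ext pv => x; rewrite /dshift Dof0 addr0.
- rewrite theta_X -[lend_fun _ v]/(lend_fun (thgen a (inl i)) v) (thgenX k0).
  apply: weight_vec_ext (weight_vec_e (eLC k0 a) _ _ pv) => x.
  by rewrite /dshift /wshift Dof_delta rmorphB /= !rmorph_nat addrA.
- rewrite theta_Y -[lend_fun _ v]/(lend_fun (thgen a (inr i)) v) (thgenY k0).
  apply: weight_vec_ext (weight_vec_e (eLC k0 a) _ _ pv) => x.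
  by rewrite /dshift /wshift DofN Dof_delta opprB rmorphB /= !rmorph_nat addrA.
- by move=> i j; rewrite rmorph0 -[lend_fun 0 v]/(0 : M) !(e0 e) subrr scaler0.
- by rewrite rmorphD lend_addE; apply: weight_vec_add; [apply: hx|apply: hy].
- rewrite rmorphM lend_mulE; apply: weight_vec_ext (hx _ _ (hy _ _ pv)) => z.
  by rewrite /dshift DofD rmorphD /= addrA addrAC.
Qed.

(** Applying [e i i - e j j] minus its eigenvalue at [d0] removes that term, and induction handles
    the rest. If [d] and [d0] had the same eigenvalues, [Dof (d - d0)] would be constant by
    characteristic zero, with sum zero, hence zero. *)
Lemma weight_indep p (S : seq ZV) (w : ZV -> M) : uniq S ->
  (forall d, d \in S -> wv (dshift p d) (w d)) -> \sum_(d <- S) w d = 0 ->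
  forall d, d \in S -> w d = 0.
Proof.
elim: S w => // d0 S IH w /= /andP[d0S uS] hw.
rewrite big_cons => sum0.
have wS d : d \in S -> w d = 0.
  move=> dS; have dd0 : d != d0 by apply: contraNneq d0S => <-.
  pose chi i j d := dshift p d i - dshift p d j.
  have hchi i j : (chi i j d - chi i j d0) *: w d = 0.
    apply: (IH (fun d => (chi i j d - chi i j d0) *: w d)) => // [f fS|].
      by apply/weight_vecZ/hw; rewrite inE fS orbT.
    have := congr1 (fun m => (e i i m - e j j m) - chi i j d0 *: m) sum0.
    rewrite /= !(e0 e) subrr scaler0 subrr !(eD e) opprD addrACA.
    rewrite (hw _ (mem_head _ _)) -/(chi i j d0) scalerDr opprD addrACA subrr add0r.
    move=> h0; apply: etrans h0.
    rewrite (raddf_sum (e i i)) (raddf_sum (e j j)) scaler_sumr -!sumrB /=.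
    apply: eq_big_seq => f fS /=.
    by rewrite hw ?inE ?fS ?orbT // scalerBl.
  apply: contrapT => /eqP wd; move: dd0; rewrite -subr_eq0 => /eqP; apply.
  have cst i j : Dof (d - d0) i = Dof (d - d0) j.
    apply/eqP; rewrite -subr_eq0; apply/eqP/(intr_inj0 k0).
    have /eqP := hchi i j; rewrite scaler_eq0 (negPf wd) orbF => /eqP h.
    by rewrite -[RHS]h /chi /dshift !DofD !DofN !(rmorphB, rmorphD, rmorphN) /=; ring.
  apply: Dof_inj => i; have := sum_Dof (d - d0).
  rewrite (eq_bigr (fun=> Dof (d - d0) i)) // sumr_const card_ord => /eqP.
  by rewrite mulrn_eq0 => /eqP.
move=> d; rewrite inE => /predU1P[->|]; last exact: wS.
by move: sum0; rewrite big_seq big1 ?addr0.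
Qed.

(* If [w = theta y v] were nonzero, simplicity would give a homogeneous [c] of
   degree - d with theta c w = v, but c y lies in J and has degree 0. *)
Lemma theta_homog_J (J : tgwc Dt -> Prop) d y : tgw_graded_ideal J ->
  J y -> tgwc_homog d y -> theta y = 0.
Proof.
move=> [[J0 JD Jl Jr] _ J00] Jy hy; apply: (lend_ext gG simp) => p v g.
rewrite -[RHS]/(0 : M); set w := lend_fun (theta y) v.
have pv := gf_wv gG g; have v0 := gf_neq0 gG g.
pose N u := exists c, u = lend_fun (theta c) w.
have NL : lie_submodule a N.
  split.
  - by exists 0; rewrite rmorph0.
  - by move=> u u' [c ->] [c' ->]; exists (c + c'); rewrite rmorphD lend_addE.
  - move=> z u [c ->]; exists (tgwc_cst Dt z%:MP * c).
    by rewrite rmorphM lend_mulE /= theta_cst thR_C.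
  - move=> x u [c ->]; have [c' hc'] := theta_sl gG Glam simp x.
    by exists (c' * c); rewrite rmorphM lend_mulE /= -hc'.
have [N0|Nall] := simp.2 N NL; first by apply: N0; exists 1; rewrite rmorph1.
have [c vE] := Nall v; have [S [z [uS hz cE]]] := homog_decomp c.
exfalso; move/eqP: v0; apply.
(* The nonzero degrees of the components of [c * y]. Since the degree zero component acts by zero,
   [v] minus the remaining terms is a vanishing sum over distinct degrees. *)
pose S' := [seq f + d | f <- S & f != - d].
pose u (f : ZV) := if f == 0 then v else - lend_fun (theta (z (f - d) * y)) v.
have zS' : 0 \notin S'.
  apply/mapP => -[f]; rewrite mem_filter => /andP[/eqP fd _] /esym /eqP.
  by rewrite addr_eq0 => /eqP.
have -> : v = u 0 by rewrite /u eqxx.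
apply: (@weight_indep p (0 :: S')); rewrite ?mem_head //=.
- rewrite zS' map_inj_uniq ?filter_uniq //; exact: addIr.
- move=> f _; rewrite /u; case: eqP => [->|_].
    by apply: weight_vec_ext pv => x; rewrite /dshift Dof0 addr0.
  rewrite -scaleN1r; apply: weight_vecZ; rewrite -[f in dshift _ f](subrK d).
  exact: theta_weight (tgwc_homogM (hz _) hy) pv.
rewrite big_cons {1}/u eqxx big_map big_filter {1}vE cE rmorph_sum lend_sumE /=.
rewrite (bigID (fun f => f != - d)) /= [X in _ + X + _]big1 ?addr0.
  rewrite -big_split big1 //= => f fd; rewrite /u addr_eq0 (negPf fd) addrK.
  by rewrite rmorphM lend_mulE subrr.
move=> f /negPn /eqP ->; rewrite /w -lend_mulE -rmorphM /=.
have -> : z (- d) * y = 0; last by rewrite rmorph0.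
apply: J00; first exact: Jl.
by rewrite -[0](addNr d); apply: tgwc_homogM.
Qed.

Lemma theta_rad x : tgw_rad x -> theta x = 0.
Proof.
move=> [J [gJ Jx]]; have [_ gr _] := gJ; have [m [d [y [hy ->]]]] := gr x Jx.
rewrite rmorph_sum big1 // => i _; have [hyi Jyi] := hy i.
exact: theta_homog_J gJ Jyi hyi.
Qed.

Definition thetaA : algA k n -> lend M := quo_lift theta_rad.
HB.instance Definition _ := GRing.RMorphism.copy thetaA (quo_lift theta_rad).

Lemma thetaA_pi x : thetaA (quo_pi _ x) = theta x.
Proof. exact: quo_liftE. Qed.

Fact thetaL_rel x : Alam_rel lam x -> thetaA x = 0.
Proof.
move=> ->; rewrite thetaA_pi theta_cst; apply: (lend_ext gG simp) => p v g.
rewrite (thR_good gG Glam _ g) mevalB mevalC /eulerA rmorph_sum /=.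
rewrite (eq_bigr (fun x => p x - 1)); first by rewrite (Glam g) subrr scale0r.
by move=> y _; rewrite mevalB mevalXU meval1.
Qed.

Definition thetaL : Alam n lam -> lend M := quo_lift thetaL_rel.
HB.instance Definition _ := GRing.RMorphism.copy thetaL (quo_lift thetaL_rel).

Lemma thetaL_pi x : thetaL (quo_pi _ (quo_pi _ x)) = theta x.
Proof. exact: etrans (quo_liftE _ _) (thetaA_pi _). Qed.

(** Subtracting the total from the component of degree [f], taken as zero if [f] is not in [S],
    gives a relation between independent weights. *)
Lemma theta_comp S (y : ZV -> tgwc Dt) : uniq S -> (forall d, tgwc_homog d (y d)) ->
  forall p v, wv p v ->
  forall f, wv (dshift p f) (lend_fun (theta (\sum_(d <- S) y d)) v) ->
  forall d, d \in S -> d != f -> lend_fun (theta (y d)) v = 0.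
Proof.
move=> uS hy p v pv f hf d dS df.
pose S' := f :: [seq g <- S | g != f].
pose fS := if f \in S then lend_fun (theta (y f)) v else 0.
pose u g := if g == f then fS - lend_fun (theta (\sum_(d <- S) y d)) v
            else lend_fun (theta (y g)) v.
have -> : lend_fun (theta (y d)) v = u d by rewrite /u (negPf df).
apply: (@weight_indep p S'); last by rewrite inE mem_filter df dS orbT.
- by rewrite /= mem_filter eqxx filter_uniq.
- move=> g _; rewrite /u; case: eqP => [->|_]; last exact: theta_weight.
  rewrite -scaleN1r; apply: weight_vec_add (weight_vecZ _ hf).
  rewrite /fS; case: ifP => _; first exact: theta_weight.
  by move=> i j; rewrite !(e0 e) subrr scaler0.
rewrite big_cons {1}/u eqxx big_filter.
rewrite (eq_bigr (fun g => lend_fun (theta (y g)) v)); last first.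
  by move=> g /negPf gf; rewrite /u gf.
rewrite rmorph_sum lend_sumE /= (bigID (fun g => g == f) predT) /= opprD addrA subrK.
rewrite /fS; case: ifP => fSm.
  by rewrite -big_filter filter_pred1_uniq // big_seq1 subrr.
rewrite big1_seq ?subr0 // => g /andP[/eqP -> ]; rewrite fSm.
by [].
Qed.
End ThetaRadical.

(** * Faithfulness and the isomorphism *)

(* [elim0] eliminates the variable of index 0 by means of the Euler relation; its
   target is a domain and its kernel is the ideal generated by the relation. *)
Section Elim.
Variables (k : fieldType) (k0 : [pchar k] =i pred0) (n : nat) (lam : k).
Local Notation I := 'I_n.+1.

Definition elim0 : RE k n -> RE k n := comp_mpoly
  [tuple if x == ord0 then (lam + n.+1%:R)%:MP - \sum_(y | y != ord0) 'X_y
         else 'X_x | x < n.+1].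
HB.instance Definition _ := GRing.RMorphism.copy elim0 (comp_mpoly
  [tuple if x == ord0 then (lam + n.+1%:R)%:MP - \sum_(y | y != ord0) 'X_y
         else 'X_x | x < n.+1]).

Lemma elim0X x : elim0 'X_x =
  if x == ord0 then (lam + n.+1%:R)%:MP - \sum_(y | y != ord0) 'X_y else 'X_x.
Proof. by rewrite /elim0 /= comp_mpolyXU -tnth_nth tnth_mktuple. Qed.
Lemma elim0C c : elim0 c%:MP = c%:MP.
Proof. exact: comp_mpolyC. Qed.

Lemma elim0_pi r : quo_pi (Rlam_rel lam) (elim0 r) = quo_pi (Rlam_rel lam) r.
Proof.
apply: (mpoly_rmorph_eq (f := quo_pi (Rlam_rel lam) \o elim0)
  (g := quo_pi (Rlam_rel lam))) => [c|x] /=; first by rewrite elim0C.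
rewrite elim0X; case: eqP => [->|//]; apply/quo_piP.
have -> : (lam + n.+1%:R)%:MP - \sum_(y | y != ord0) 'X_y - 'X_ord0 =
    - (eulerA k n - lam%:MP).
  rewrite /eulerA sumrB sumr_const card_ord [in RHS](bigD1 ord0) //= mpolyCD mpolyC_nat.
  by ring.
exact/ideal_genN/ideal_gen_in.
Qed.

Lemma elim0_eval r q : (elim0 r).@[q] =
  r.@[fun x => if x == ord0 then lam + n.+1%:R - \sum_(y | y != ord0) q y else q x].
Proof.
rewrite /elim0 comp_mpoly_meval; apply: meval_eq => x; rewrite tnth_mktuple.
case: eqP => _; last by rewrite mevalXU.
rewrite mevalB mevalC rmorph_sum /=; congr (_ - _).
by apply: eq_bigr => y _; rewrite mevalXU.
Qed.

(** Every value of [elim0 r] is a value of [r] at a point of the hyperplane. *)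
Lemma elim0_vanish r :
  (forall q, \sum_x (q x - 1) = lam -> r.@[q] = 0) -> elim0 r = 0.
Proof.
move=> h; apply: (mpoly_vanish k0) => q; rewrite elim0_eval; apply: h.
rewrite sumrB sumr_const card_ord (bigD1 ord0) //=.
rewrite [X in _ + X - _](eq_bigr q) => [|y /negPf ->//].
by rewrite subrK addrK.
Qed.

(** With a second variable at hand, the image of each ['X_x] takes two different values. *)
Lemma elim0_linear_neq0 x c : (1 <= n)%N -> elim0 ('X_x + c%:MP) != 0.
Proof.
move=> n1; apply/eqP => h0.
have ev q := congr1 (meval q) h0.
pose f (q : I -> k) := (if x == ord0 then
  lam + n.+1%:R - \sum_(y | y != ord0) q y else q x) + c.
have {}ev q : f q = 0.
  by have := ev q; rewrite elim0_eval mevalD mevalXU mevalC meval0.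
suff [q hq] : exists q, f q <> f (fun=> 0) by apply: hq; rewrite !ev.
rewrite /f; case: eqP => [_|/eqP x0]; last first.
  exists (fun=> 1) => /addIr /eqP; apply/negP; exact: oner_neq0.
have [t t0] : exists t : I, t != ord0 by exists (lift ord0 (Ordinal n1)).
exists (fun y => (y == t)%:R) => /addIr /addrI /oppr_inj /eqP.
rewrite (bigD1 t) //= eqxx !big1 ?addr0 ?oner_eq0 //.
by move=> y /andP[_ /negPf ->].
Qed.
End Elim.

(** * Comparison of the two algebras inside End(M) *)

Section Isomorphism.
Variables (k : fieldType) (k0 : [pchar k] =i pred0) (n : nat) (n1 : (1 <= n)%N).
Variables (M : lmodType k) (a : lie_module (@sl_br k n) M).
Local Notation I := 'I_n.+1.
Local Notation e := (eL k0 a).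
Local Notation ZV := {ffun 'I_n -> int}.
Local Notation Dt := (datumA k n).
Local Notation wv := (weight_vec e).
Variables (G : (I -> k) -> M -> Prop) (gG : good_family k0 a G) (lam : k).
Hypothesis Glam : forall p v, G p v -> \sum_x (p x - 1) = lam.
Hypothesis simp : simple_module a.
Variables (i0 j0 : I) (ij0 : i0 != j0).
Hypothesis inj0 : forall v, e i0 j0 v = 0 -> v = 0.
Local Notation theta := (theta gG Glam simp).
Local Notation thetaL := (thetaL gG Glam simp).
Local Notation thR := (thR a lam).
Local Notation piA := (fun x : tgwc Dt =>
  quo_pi (Alam_rel lam) (quo_pi (tgw_rad (D := Dt)) x)).

(** Multiplying by [Z'] of degree [- d] brings [c] into R_E, where density applies; the extra linear
    factors survive [elim0] and can be cancelled in a domain. *)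
Lemma thetaL_homog0 d c : tgwc_homog d c -> theta c = 0 -> piA c = 0.
Proof.
move=> hc tc0; have [Z [hZ rZ]] := zgen_ex k d; have [Z' [hZ' rZ']] := zgen_ex k (- d).
have [r hr] := homog_zgen hc rZ.
have : theta (tgwc_cst Dt r * Z) = 0 by rewrite -tc0 -!thetaA_pi hr.
move=> /(congr1 (fun f => f * theta Z')); rewrite mul0r -rmorphM -mulrA.
rewrite (zgen_zgenN hZ rZ hZ' rZ') -rmorphM /= theta_cst => rs0.
have e0 : elim0 lam (r * (zgen k d * zshift d (zgen k (- d)))) = 0.
  apply: (elim0_vanish k0); apply: (gf_dense gG simp ij0 inj0 Glam) => p v g.
  apply: (scal_inj (gf_neq0 gG g)); rewrite -(thR_good gG Glam _ g) rs0 scale0r.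
  by [].
have {e0}r0 : elim0 lam r = 0.
  move/eqP: e0; rewrite rmorphM mulf_eq0 => /orP[/eqP //|/negPn].
  rewrite (zgen_neq0 (f := elim0 lam)) // => x z.
  exact: elim0_linear_neq0.
have q0 : quo_pi (Alam_rel lam) (tgw_cst Dt r) = 0.
  have h : Alam_cst lam (quo_pi _ r) = quo_pi (Alam_rel lam) (tgw_cst Dt r).
    exact: quo_liftE.
  by rewrite -h -(elim0_pi lam r) r0 !rmorph0.
by rewrite hr rmorphM rmorphM /= [X in X * _]q0 mul0r.
Qed.

(** Components of different degrees send a weight vector to independent weights, so each of them
    acts by zero separately. *)
Lemma thetaL_inj : injective thetaL.
Proof.
suff H y : thetaL y = 0 -> y = 0.
  by move=> y y' h; apply/eqP; rewrite -subr_eq0; apply/eqP/H; rewrite rmorphB /= h subrr.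
elim/quo_ind: y; elim/quo_ind => c; rewrite thetaL_pi.
have [S [y [uS hy ->]]] := homog_decomp c => t0.
rewrite !rmorph_sum big1_seq //= => d dS.
apply: (thetaL_homog0 (hy d)); apply: (lend_ext gG simp) => p v g.
have H := weight_indep (k0 := k0) (a := a) (p := p)
  (w := fun d => lend_fun (theta (y d)) v) uS.
apply: (H _ _ d dS).
  by move=> f _; apply: theta_weight => //; apply: (gf_wv gG g).
by have := congr1 (fun f => lend_fun f v) t0; rewrite rmorph_sum lend_sumE.
Qed.

Fact Uact_rel u : env_ann a u -> env_act a u = 0.
Proof. by move=> h; apply: lendP => v; rewrite h. Qed.
Definition Uact : Uquo a -> lend M := quo_lift Uact_rel.
HB.instance Definition _ := GRing.RMorphism.copy Uact (quo_lift Uact_rel).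

Lemma Uact_pi u : Uact (Uquo_pi a u) = env_act a u.
Proof. exact: quo_liftE. Qed.

Lemma Uact_inj : injective Uact.
Proof.
suff H y : Uact y = 0 -> y = 0.
  by move=> y y' h; apply/eqP; rewrite -subr_eq0; apply/eqP/H; rewrite rmorphB /= h subrr.
elim/quo_ind: y => u; rewrite [Uact _]Uact_pi => u0; apply: quo_pi0 => v.
by rewrite u0.
Qed.

Lemma env_act_theta u : exists c, env_act a u = theta c.
Proof.
elim/quo_ind: u; elim/free_ind; elim=> [c|x|x [c hc] y [c' hc']|x [c hc]|x [c hc] y [c' hc']].
- by exists (tgwc_cst Dt c%:MP); rewrite theta_cst thR_C; apply: (env_lift_cst _ _ _ c).
- have [c hc] := theta_sl gG Glam simp x; exists c; rewrite -hc.
  exact: env_lift_gen.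
- by exists (c + c'); rewrite free_piD !rmorphD /= hc hc'.
- by exists (- c); rewrite free_piN !rmorphN /= hc.
- by exists (c * c'); rewrite free_piM !rmorphM /= hc hc'.
Qed.

Lemma theta_env_act c : exists u, theta c = env_act a u.
Proof.
elim/tgwc_ind: c => [r|i|i|x y [u hu] [u' hu']|x y [u hu] [u' hu']].
- by exists (RE_U lam r); rewrite theta_cst.
- by exists (env_gen _ (sl_e k i)); rewrite theta_X; symmetry; apply: env_lift_gen.
- by exists (env_gen _ (sl_f k i)); rewrite theta_Y; symmetry; apply: env_lift_gen.
- by exists (u + u'); rewrite !rmorphD /= hu hu'.
- by exists (u * u'); rewrite !rmorphM /= hu hu'.
Qed.

Lemma Uact_thetaL x : exists y, thetaL y = Uact x.
Proof.
elim/quo_ind: x => u; have [c hc] := env_act_theta u.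
by exists (piA c); rewrite thetaL_pi [RHS]Uact_pi hc.
Qed.

Lemma thetaL_Uact y : exists x, Uact x = thetaL y.
Proof.
elim/quo_ind: y; elim/quo_ind => c; have [u hu] := theta_env_act c.
by exists (Uquo_pi a u); rewrite thetaL_pi Uact_pi hu.
Qed.

(** Both algebras embed in End(M) with the same image; [phi] matches elements acting equally, and
    injectivity of [thetaL] makes the choice unique. *)
Definition phi x : Alam n lam := sval (cid (Uact_thetaL x)).
Lemma phiP x : thetaL (phi x) = Uact x.
Proof. exact: (svalP (cid (Uact_thetaL x))). Qed.

Fact phi_zmod : zmod_morphism phi.
Proof. by move=> x y; apply: thetaL_inj; rewrite rmorphB /= !phiP rmorphB. Qed.
HB.instance Definition _ :=
  GRing.isZmodMorphism.Build (Uquo a) (Alam n lam) phi phi_zmod.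
Fact phi_monoid : monoid_morphism phi.
Proof.
split=> [|x y]; apply: thetaL_inj; first by rewrite phiP !rmorph1.
by rewrite rmorphM /= !phiP rmorphM.
Qed.
HB.instance Definition _ :=
  GRing.isMonoidMorphism.Build (Uquo a) (Alam n lam) phi phi_monoid.

Lemma phi_bij : bijective phi.
Proof.
exists (fun y => sval (cid (thetaL_Uact y))) => [x|y].
  by apply: Uact_inj; rewrite (svalP (cid (thetaL_Uact _))) phiP.
by apply: thetaL_inj; rewrite phiP (svalP (cid (thetaL_Uact _))).
Qed.

Lemma phi_cst r : phi (Uquo_pi a (Rlam_U k0 lam r)) = Alam_cst lam r.
Proof.
apply: thetaL_inj; rewrite phiP Uact_pi; elim/quo_ind: r => r.
rewrite [Rlam_U _ _ _]quo_liftE [Alam_cst _ _]quo_liftE /=.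
by rewrite thetaL_pi theta_cst.
Qed.

Lemma root_evalE d (h : cartan k n) :
  root_eval d h = \sum_x sl_mx h x x * (Dof d x)%:~R.
Proof.
have S (y : I) : \sum_x sl_mx h x x * (x == y)%:R = sl_mx h y y.
  rewrite (bigD1 y) //= eqxx mulr1 big1 ?addr0 // => z /negPf ->.
  by rewrite mulr0.
rewrite /root_eval; under [RHS]eq_bigr => x _ do rewrite /Dof rmorph_sum mulr_sumr.
rewrite exchange_big; apply: eq_bigr => i _ /=.
rewrite -{1}(S (ein i)) -{1}(S (eout i)) -sumrB -mulrzr mulr_suml.
by apply: eq_bigr => x _; rewrite rmorphM rmorphB /= !rmorph_nat; ring.
Qed.

Lemma cartan_dshift p d (h : cartan k n) v : wv (dshift p d) v ->
  a h v = (\sum_x sl_mx h x x * p x + root_eval d h) *: v.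
Proof.
move=> /(lact_cartan h) ->; congr (_ *: _); rewrite root_evalE -big_split.
by apply: eq_bigr => x _; rewrite /dshift mulrDr.
Qed.

Lemma wv_of_cartan p d w :
  (forall h : cartan k n, a h w = (\sum_x sl_mx h x x * p x + root_eval d h) *: w) ->
  wv (dshift p d) w.
Proof.
move=> hw i j; have := hw (Cartan (sl_diag_h k i j)).
have -> : a (Cartan (sl_diag_h k i j)) w = e i i w - e j j w.
  rewrite -[LHS]/(lactl a w (sl_diag k i j)) -[e i i w]/(lactl a w (slE k0 i i)).
  rewrite -[e j j w]/(lactl a w (slE k0 j j)) -linearB; congr (lactl a w _).
  by apply: val_inj; rewrite raddfB /= !eqxx opprB addrA subrK.
move=> ->; congr (_ *: _); rewrite root_evalE -big_split /=.
rewrite (eq_bigr (fun x => (x == i)%:R * dshift p d x - (x == j)%:R * dshift p d x)).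
  have S (z : I) : \sum_x (x == z)%:R * dshift p d x = dshift p d z.
    rewrite (bigD1 z) //= eqxx mul1r big1 ?addr0 // => x /negPf ->.
    by rewrite mul0r.
  by rewrite sumrB !S.
by move=> x _; rewrite -mulrDr -/(dshift p d x) !mxE !andbb mulrBl.
Qed.

Lemma Uquo_homogE d x : Uquo_homog d x <->
  forall h : cartan k n, lact_end a h * Uact x - Uact x * lact_end a h =
    lend_scal M (root_eval d h) * Uact x.
Proof.
have Ug h : Uact (Uquo_pi a (env_gen (@sl_br k n) h)) = lact_end a h.
  by rewrite Uact_pi; apply: env_lift_gen.
have Uc c : Uact (Uquo_pi a (env_cst (@sl_br k n) c)) = lend_scal M c.
  by rewrite Uact_pi; apply: env_lift_cst.
split=> hx h.
  by rewrite -Ug -Uc -!rmorphM -rmorphB hx.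
by apply: Uact_inj; rewrite rmorphB !rmorphM /= Ug Uc.
Qed.

(** From right to left, [theta_weight] computes the commutator with [h] on good vectors, which span.
    Conversely, an element of adjoint weight [d] sends weight [p] to [dshift p d]; by [theta_comp]
    its components of other degrees kill [M], so they are zero. *)
Lemma phi_homog d x : Uquo_homog d x <-> Alam_homog d (phi x).
Proof.
rewrite Uquo_homogE; split=> [hx|[y [[c [hc ->]] xE]] h]; last first.
  rewrite -phiP xE thetaL_pi; apply: (lend_ext gG simp) => p v g.
  have pv := gf_wv gG g; rewrite lend_subE !lend_mulE.
  have := theta_weight gG Glam simp hc pv => /(cartan_dshift h) H.
  rewrite [lend_fun (lact_end a h) _]H [lend_fun (lact_end a h) v](lact_cartan h pv).
  by rewrite lendZ -scalerBl addrC addKr.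
have [c [cx]] : exists c, phi x = piA c /\ Uact x = theta c.
  rewrite -phiP; elim/quo_ind: (phi x); elim/quo_ind => c.
  by exists c; rewrite thetaL_pi.
have [S [y [uS hy cE]]] := homog_decomp c => xc.
have y0 f : f \in S -> f != d -> piA (y f) = 0.
  move=> fS fd; apply: (thetaL_homog0 (hy f)); apply: (lend_ext gG simp) => p v g.
  have pv := gf_wv gG g.
  apply: (theta_comp (gG := gG) (Glam := Glam) (simp := simp) uS hy pv _ fS fd).
  rewrite -cE -xc; apply: wv_of_cartan => h.
  have := congr1 (fun f => lend_fun f v) (hx h).
  rewrite lend_subE !lend_mulE [lend_fun (lact_end a h) v](lact_cartan h pv) lendZ.
  move/eqP; rewrite subr_eq addrC => /eqP.
  rewrite -[lend_fun (lact_end a h) _]/(a h _) => ->.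
  by rewrite [in RHS]scalerDl.
exists (quo_pi (tgw_rad (D := Dt)) (if d \in S then y d else 0)); split.
  exists (if d \in S then y d else 0); split=> //.
  by case: ifP => _; [exact: hy|exact: tgwc_homog0].
rewrite cx cE !rmorph_sum /=; case: ifP => dS.
  rewrite (bigD1_seq d) //= big1_seq ?addr0 // => f /andP[fd fS].
  exact: y0.
rewrite !rmorph0 big1_seq // => f /andP[_ fS]; apply: y0 => //.
by apply: contraFneq dS => <-.
Qed.

Lemma Uquo_Alam_iso : exists f : {rmorphism Uquo a -> Alam n lam},
  [/\ bijective f,
      forall r, f (Uquo_pi a (Rlam_U k0 lam r)) = Alam_cst lam r
    & forall d x, Uquo_homog d x <-> Alam_homog d (f x)].
Proof.
exists phi; split; [exact: phi_bij|exact: phi_cst|exact: phi_homog].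
Qed.
End Isomorphism.

Theorem theorem5p8 (k : closedFieldType) (k0 : [pchar k] =i pred0)
    (n : nat) (n_ge1 : (1 <= n)%N)
    (M : lmodType k) (a : lie_module (@sl_br k n) M)
    (M_infdim : infinite_dim M) (M_simple : simple_module a)
    (M_pointed : completely_pointed a) :
  exists (lam : k) (phi : {rmorphism Uquo a -> Alam n lam}),
    [/\ bijective phi,
        forall r : Rlam n lam,
          phi (Uquo_pi a (Rlam_U k0 lam r)) = Alam_cst lam r
      & forall (d : {ffun 'I_n -> int}) (x : Uquo a),
          Uquo_homog d x <-> Alam_homog d (phi x)].
Proof.
have [i [j [ij inj]]] := ex_inj k0 M_simple M_pointed M_infdim.
have [G0 /good_family_lam [lam gG]] := good_family_ex M_simple M_pointed ij inj.
have Glam p v : G0 p v /\ \sum_x (p x - 1) = lam -> \sum_x (p x - 1) = lam.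
  by case.
by exists lam; apply: (Uquo_Alam_iso n_ge1 gG Glam M_simple ij inj).
Qed.
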